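(* The system $\mathcal{F}^\omega[\mathbb{P},\mathrm{Integral},X]$ proves: if $X$ converges almost uniformly metastable pointwisely, i.e. $$\forall k^0,a^0,F^1\,\exists b^0\left(\mathbb{P}\left(\bigcap_{m=0}^b\bigcup_{i=m}^{F(m)}\bigcup_{j=m}^{F(m)}P(a,i,j)^c\right)\leq_{\mathbb{R}}2^{-k}\right),$$ then $X$ converges almost uniformly with respect to finite unions, i.e. $$\forall k^0,a^0\,\exists b^0\,\forall c^0\left(\mathbb{P}\left(\bigcup_{i=b}^c\bigcup_{j=b}^cP(a,i,j)^c\right)\leq_{\mathbb{R}}2^{-k}\right).$$
   Context: **Base system.** Finite types $T$: $0\in T$ (natural numbers) and $\rho,\tau\in T\Rightarrow\rho(\tau)\in T$ (functions mapping objects of type $\tau$ to objects of type $\rho$); $1:=0(0)$. $\mathsf{WE}\text{-}\mathsf{PA}^\omega$ is weakly extensional classical Peano arithmetic in all finite types: the only primitive relation is $=_0$, and $x=_{\tau(\xi)}y:\equiv\forall z^\xi(xz=_\tau yz)$; it has the usual arithmetical axioms, full induction, combinators (hence $\lambda$-abstraction), constants for simultaneous Gödel primitive recursion in all types, and, instead of full extensionality, only the quantifier-free extensionality rule: from $A_0\to s=_\rho t$ infer $A_0\to r[s/x^\rho]=_\tau r[t/x^\rho]$ ($A_0$ quantifier-free). $\mathcal{A}^\omega:=\mathsf{WE}\text{-}\mathsf{PA}^\omega+\mathsf{QF}\text{-}\mathsf{AC}+\mathsf{DC}$, where $\mathsf{QF}\text{-}\mathsf{AC}$ is $\forall\underline{x}\exists\underline{y}A_0(\underline{x},\underline{y})\to\exists\underline{Y}\forall\underline{x}A_0(\underline{x},\underline{Y}\underline{x})$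 for $A_0$ quantifier-free (all types) and $\mathsf{DC}$ is $\forall x^0,\underline{y}\,\exists\underline{z}\,A(x,\underline{y},\underline{z})\to\exists\underline{f}\,\forall x^0A(x,\underline{f}(x),\underline{f}(x+1))$ for arbitrary $A$ (all tuples of types). **Reals.** Rationals are coded by natural numbers via a pairing function. A type-1 object $x$ represents a real via $\widehat{x}$, where $\widehat{x}n:=xn$ if $|xk-_{\mathbb{Q}}x(k+1)|<2^{-k-1}$ for all $k<n$, and $\widehat{x}n:=xk$ for the least $k<n$ violating this otherwise. $=_{\mathbb{R}},\leq_{\mathbb{R}},<_{\mathbb{R}}$ and arithmetic on type-1 objects are the usual ones; naturals and rationals are embedded as constant sequences. $[x](n)$ denotes the $n$-th element (a natural number coding a rational) of the sequence $x$. **$\mathcal{F}^\omega$.** Types $T^{\Omega,S}$: generated from $0,\Omega,S$ by $\rho,\tau\mapsto\rho(\tau)$. $\mathcal{F}^\omega$ is $\mathcal{A}^\omega$ formulated over all types in $T^{\Omega,S}$ with additional constants $\mathrm{eq}^{0(\Omega)(\Omega)}$, $\in^{0(S)(\Omega)}$, $\cup^{S(S)(S)}$, $((\cdot)^c)^{S(S)}$, $\emptyset^S$, $c_\Omega^\Omega$. Abbreviations: $x=_\Omega y:\equiv\mathrm{eq}\,xy=_00$; $x\in A:\equiv\ \in xA=_00$; $A\cap B:=(A^c\cup B^c)^c$; $A=_SB:\equiv\forall x^\Omega(x\in A\leftrightarrow x\in B)$; $A\subseteq_SB:\equiv\forall x^\Omega(x\in A\to x\in B)$. Axioms: $\mathrm{eq}\,xy\leq_01$;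 $=_\Omega$ is an equivalence relation; $\in xA\leq_01$; $x\notin\emptyset$; $x\in A\cup B\leftrightarrow x\in A\lor x\in B$; $x\in A^c\leftrightarrow x\notin A$. Finite unions $\bigcup_{i=n}^mA(i)$ of $A^{S(0)}$ are defined by recursion from $\cup$ (and are $\emptyset$ if $m<n$); $\bigcap_{i=n}^mA(i):=(\bigcup_{i=n}^mA(i)^c)^c$. **$\mathcal{F}^\omega[\mathbb{P}]$.** Adds a constant $\mathbb{P}^{1(S)}$ with axioms $\forall A(0\leq_{\mathbb{R}}\mathbb{P}(A)\leq_{\mathbb{R}}1)$; $\mathbb{P}(\emptyset)=_{\mathbb{R}}0$; $\forall A,B(\mathbb{P}(A\cup B)=_{\mathbb{R}}\mathbb{P}(A)+\mathbb{P}(B)-\mathbb{P}(A\cap B))$; $\forall A,B\exists x^\Omega(\mathbb{P}(A)>_{\mathbb{R}}\mathbb{P}(B)\to x\in A\land x\notin B)$. **$\mathcal{F}^\omega[\mathbb{P},\mathrm{Integral}]$.** Adds: (i) a constant $[\cdot,\cdot]$ of type $0(1)(1)(1)$, writing $r\in[a,b]$ for $[a,b](r)=_00$, with axioms $[a,b](r)\leq_01$; $r\in[a,b]\to a\leq_{\mathbb{R}}r\leq_{\mathbb{R}}b$; $a<_{\mathbb{R}}r<_{\mathbb{R}}b\to r\in[a,b]$; $a,b\in[a,b]$ (for all $a^1,b^1,r^1$); (ii) a constant $(\cdot)^{-1}$ of type $0(\Omega)(0(1))(1(\Omega))$ with axioms $f^{-1}Ax\leq_01$ and $x\in f^{-1}A\leftrightarrow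 f(x)\in A$ for $f^{1(\Omega)},A^{0(1)},x^\Omega$, where $x\in f^{-1}A:\equiv f^{-1}Ax=_00$ and $f(x)\in A:\equiv A(f(x))=_00$; (iii) constants $I^{0(1(\Omega))}$, $\|\cdot\|_\infty^{1(1(\Omega))}$, $\left(\int\cdot\,\mathrm{d}\mathbb{P}\right)^{1(1(\Omega))}$; write $f\in I$ for $If=_00$, $\chi_A:=\lambda x.(x\in A^c)$ (the value of $\in xA^c$, so $1$ iff $x\in A$), $b_f:=[\|f\|_\infty](0)+1$, and $\alpha f+\beta g$, $|f|$ for the pointwise operations. Axioms (for all $f,g$ of type $1(\Omega)$, $A$ of type $S$, $\alpha,\beta,a,b$ of type $1$, $k$ of type $0$): $If\leq_01$; $(\lambda x.(x\in A))\in I$; $\forall f,a,b\exists A^S\forall x^\Omega(f\in I\to(x\in f^{-1}([a,b])\leftrightarrow x\in A))$; $f\in I\to|f(x)|\leq_{\mathbb{R}}\|f\|_\infty$; $\forall f,k\exists x^\Omega(f\in I\to\|f\|_\infty-2^{-k}\leq_{\mathbb{R}}|f(x)|)$; $f,g\in I\to\alpha f+\beta g\in I$; $f\in I\to|f|\in I$; $f\in I\to\lambda x.(f(x)(x\in A))\in I$; $\int\chi_A\,\mathrm{d}\mathbb{P}=_{\mathbb{R}}\mathbb{P}(A)$; $f,g\in I\to\int(\alpha f+\beta g)\,\mathrm{d}\mathbb{P}=_{\mathbb{R}}\alpha\int f\,\mathrm{d}\mathbb{P}+\beta\int g\,\mathrm{d}\mathbb{P}$; $\forall f,k\exists A^{S(0)}\left(f\in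 I\to\int\left|f-\sum_{i=0}^{2^{k+1}b_f-1}\left(-b_f+\frac{i}{2^k}\right)\chi_{A(i)}\right|\mathrm{d}\mathbb{P}\leq_{\mathbb{R}}2^{-k}\right)$; $\forall f,k\exists x^\Omega(f\in I\land\int f\,\mathrm{d}\mathbb{P}<_{\mathbb{R}}-2^{-k}\to f(x)\leq_{\mathbb{R}}-2^{-k})$. **$\mathcal{F}^\omega[\mathbb{P},\mathrm{Integral},X]$.** Adds a constant $X$ of type $1(\Omega)(0)$ (a sequence of random variables) with axiom $\forall n^0(X(n)\in I)$, and a constant $P$ of type $S(0)(0)(0)$ with axiom $$\forall a^0,b^0,c^0,x^\Omega\left(x\in P(a,b,c)\leftrightarrow x\in(|X(c)-X(b)|)^{-1}([0,2^{-a}])\right).$$ *)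

(* Defs.v *)
From Stdlib Require Import List.
Import ListNotations.

Set Implicit Arguments.
Unset Strict Implicit.
Set Contextual Implicit.

(** * Types, contexts, terms *)

(** [tO] is Omega, [tS] the type of events; [σ ⇒ τ] is written τ(σ) in the
    notation of the finite types. *)
Inductive ty : Type :=
| tN : ty
| tO : ty
| tS : ty
| tArr : ty -> ty -> ty.

Infix "⇒" := tArr (at level 55, right associativity).

Notation t1 := (tN ⇒ tN).
Notation tRV := (tO ⇒ t1).

Definition ctx := list ty.

Fixpoint arrs (σs : list ty) (τ : ty) : ty :=
  match σs with
  | [] => τ
  | σ :: σs' => σ ⇒ arrs σs' τ
  end.

Inductive var : ctx -> ty -> Type :=
| VZ : forall (Γ : ctx) (τ : ty), var (τ :: Γ) τ
| VS : forall (Γ : ctx) (σ τ : ty), var Γ τ -> var (σ :: Γ) τ.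

(** Type of the step function for the component of type [τ] of a simultaneous
    recursion producing a tuple of types [ρs]. *)
Definition step_ty (ρs : list ty) (τ : ty) : ty := arrs ρs (tN ⇒ τ).

(** [cRec ρs i] is the component [i] of the simultaneous recursor for the tuple
    [ρs]; it takes the argument, the initial values and the step functions. *)
Inductive cst : ty -> Type :=
| cZero : cst tN
| cSucc : cst t1
| cK : forall ρ τ, cst (ρ ⇒ τ ⇒ ρ)
| cS : forall δ ρ τ, cst ((δ ⇒ ρ ⇒ τ) ⇒ (δ ⇒ ρ) ⇒ δ ⇒ τ)
| cRec : forall (ρs : list ty) (τ : ty), var ρs τ ->
    cst (tN ⇒ arrs ρs (arrs (map (step_ty ρs) ρs) τ))
| cEq : cst (tO ⇒ tO ⇒ tN)
| cIn : cst (tO ⇒ tS ⇒ tN)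
| cCup : cst (tS ⇒ tS ⇒ tS)
| cCompl : cst (tS ⇒ tS)
| cEmpty : cst tS
| cOmega : cst tO
| cProb : cst (tS ⇒ t1)
| cItv : cst (t1 ⇒ t1 ⇒ t1 ⇒ tN)
| cInv : cst (tRV ⇒ (t1 ⇒ tN) ⇒ tO ⇒ tN)
| cI : cst (tRV ⇒ tN)
| cNorm : cst (tRV ⇒ t1)
| cInt : cst (tRV ⇒ t1)
| cX : cst (tN ⇒ tRV)
| cP : cst (tN ⇒ tN ⇒ tN ⇒ tS).

Inductive tm (Γ : ctx) : ty -> Type :=
| Var : forall τ, var Γ τ -> tm Γ τ
| Cst : forall τ, cst τ -> tm Γ τ
| App : forall σ τ, tm Γ (σ ⇒ τ) -> tm Γ σ -> tm Γ τ.

Infix "·" := App (at level 38, left associativity).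

(** ** Simultaneous substitution; terms contain no binders *)

Definition sub (Γ Δ : ctx) : Type := forall τ, var Γ τ -> tm Δ τ.

Fixpoint tsub Γ Δ (f : sub Γ Δ) τ (t : tm Γ τ) : tm Δ τ :=
  match t with
  | Var v => f _ v
  | Cst c => Cst c
  | App s u => tsub f s · tsub f u
  end.

Definition wk Γ σ τ (t : tm Γ τ) : tm (σ :: Γ) τ :=
  tsub (fun _ v => Var (VS v)) t.

Definition vcons Γ σ (P : forall τ, var (σ :: Γ) τ -> Type)
    (z : P σ VZ) (s : forall τ (v : var Γ τ), P τ (VS v)) :
    forall τ (v : var (σ :: Γ) τ), P τ v :=
  fun τ v =>
    match v as v0 in var Γ0 τ0 return
      match Γ0 as Γ1 return var Γ1 τ0 -> Type with
      | [] => fun _ => unit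
      | σ' :: Γ' => fun w =>
          forall P : forall τ, var (σ' :: Γ') τ -> Type,
            P σ' VZ -> (forall τ (u : var Γ' τ), P τ (VS u)) -> P τ0 w
      end v0
    with
    | VZ => fun _ z _ => z
    | VS u => fun _ _ s => s _ u
    end P z s.
Arguments vcons {Γ σ} P z s τ v.

Definition scons Γ Δ σ (s : tm Δ σ) (f : sub Γ Δ) : sub (σ :: Γ) Δ :=
  vcons (fun τ _ => tm Δ τ) s f.

Definition sid Γ : sub Γ Γ := fun _ v => Var v.

Definition sup Γ Δ σ (f : sub Γ Δ) : sub (σ :: Γ) (σ :: Δ) :=
  scons (Var VZ) (fun _ v => wk (f _ v)).

(** ** Tuples *)

Fixpoint apps Γ (σs : list ty) τ : tm Γ (arrs σs τ) -> sub σs Γ -> tm Γ τ :=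
  match σs with
  | [] => fun t _ => t
  | σ :: σs' => fun t a => apps (t · a _ VZ) (fun _ i => a _ (VS i))
  end.

Fixpoint vmap (F : ty -> ty) (Γ : ctx) τ (v : var Γ τ) : var (map F Γ) (F τ) :=
  match v in var Γ0 τ0 return var (map F Γ0) (F τ0) with
  | VZ => VZ
  | VS u => VS (vmap u)
  end.
Arguments vmap F {Γ τ} v.

Fixpoint vl (Σ Γ : ctx) τ (v : var Σ τ) : var (Σ ++ Γ) τ :=
  match v in var Σ0 τ0 return var (Σ0 ++ Γ) τ0 with
  | VZ => VZ
  | VS u => VS (vl u)
  end.
Arguments vl {Σ} Γ {τ} v.

Fixpoint vr (Σ Γ : ctx) τ (v : var Γ τ) : var (Σ ++ Γ) τ :=
  match Σ with
  | [] => v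
  | _ :: Σ' => VS (vr v)
  end.
Arguments vr Σ {Γ τ} v.

Fixpoint sapp (Σ Γ Δ : ctx) : sub Σ Δ -> sub Γ Δ -> sub (Σ ++ Γ) Δ :=
  match Σ with
  | [] => fun _ g => g
  | _ :: _ => fun f g => scons (f _ VZ) (sapp (fun _ i => f _ (VS i)) g)
  end.

(** ** Lambda-abstraction through the combinators *)

(** [inl]: the abstracted variable does not occur; [inr]: it does. *)
Fixpoint abs Γ σ τ (t : tm (σ :: Γ) τ) : tm Γ τ + tm Γ (σ ⇒ τ) :=
  match t with
  | Var v =>
      vcons (fun τ _ => (tm Γ τ + tm Γ (σ ⇒ τ))%type)
        (inr (Cst cS · Cst cK · Cst (cK (τ := σ))))
        (fun _ u => inl (Var u)) _ v
  | Cst c => inl (Cst c)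
  | App s u =>
      match abs s, abs u with
      | inl s', inl u' => inl (s' · u')
      | inl s', inr u' => inr (Cst cS · (Cst cK · s') · u')
      | inr s', inl u' => inr (Cst cS · s' · (Cst cK · u'))
      | inr s', inr u' => inr (Cst cS · s' · u')
      end
  end.

Definition lam Γ σ τ (t : tm (σ :: Γ) τ) : tm Γ (σ ⇒ τ) :=
  match abs t with
  | inl s => Cst cK · s
  | inr s => s
  end.

Definition v0 {Γ a} : tm (a :: Γ) a := Var VZ.
Definition v1 {Γ a b} : tm (a :: b :: Γ) b := Var (VS VZ).
Definition v2 {Γ a b c} : tm (a :: b :: c :: Γ) c := Var (VS (VS VZ)).
Definition v3 {Γ a b c d} : tm (a :: b :: c :: d :: Γ) d := Var (VS (VS (VS VZ))).
Definition v4 {Γ a b c d e} : tm (a :: b :: c :: d :: e :: Γ) e := Var (VS (VS (VS (VS VZ)))).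
Definition v5 {Γ a b c d e f} : tm (a :: b :: c :: d :: e :: f :: Γ) f := Var (VS (VS (VS (VS (VS VZ))))).

(** * Formulas *)

Inductive fm : ctx -> Type :=
| Eq0 : forall Γ, tm Γ tN -> tm Γ tN -> fm Γ
| Bot : forall Γ, fm Γ
| And : forall Γ, fm Γ -> fm Γ -> fm Γ
| Or : forall Γ, fm Γ -> fm Γ -> fm Γ
| Imp : forall Γ, fm Γ -> fm Γ -> fm Γ
| All : forall Γ σ, fm (σ :: Γ) -> fm Γ
| Ex : forall Γ σ, fm (σ :: Γ) -> fm Γ.

Arguments All {Γ} σ A.
Arguments Ex {Γ} σ A.

Declare Scope fm_scope.
Delimit Scope fm_scope with fm.
Bind Scope fm_scope with fm.
Local Open Scope fm_scope.

Infix "≈" := Eq0 (at level 70, no associativity) : fm_scope.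
Notation "⊥" := Bot : fm_scope.
Infix "/\" := And : fm_scope.
Infix "\/" := Or : fm_scope.
Infix "⊃" := Imp (at level 90, right associativity) : fm_scope.
Notation "~ A" := (Imp A Bot) : fm_scope.
Notation "A <-> B" := (And (Imp A B) (Imp B A)) : fm_scope.

Fixpoint fsub Γ (A : fm Γ) : forall Δ, sub Γ Δ -> fm Δ :=
  match A with
  | Eq0 s t => fun _ f => tsub f s ≈ tsub f t
  | Bot => fun _ _ => ⊥
  | And B C => fun _ f => fsub B f /\ fsub C f
  | Or B C => fun _ f => fsub B f \/ fsub C f
  | Imp B C => fun _ f => fsub B f ⊃ fsub C f
  | All σ B => fun _ f => All σ (fsub B (sup f))
  | Ex σ B => fun _ f => Ex σ (fsub B (sup f))
  end.

Definition fwk Γ σ (A : fm Γ) : fm (σ :: Γ) := fsub A (fun _ v => Var (VS v)).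

Definition finst Γ σ (A : fm (σ :: Γ)) (t : tm Γ σ) : fm Γ :=
  fsub A (scons t (sid (Γ := Γ))).

Fixpoint qf Γ (A : fm Γ) : Prop :=
  match A with
  | Eq0 _ _ | Bot => True
  | And B C | Or B C | Imp B C => qf B /\ qf C
  | All _ _ | Ex _ _ => False
  end.

Fixpoint Alls Γ (σs : list ty) : fm (σs ++ Γ) -> fm Γ :=
  match σs with
  | [] => fun A => A
  | σ :: σs' => fun A => Alls (All σ A)
  end.

Fixpoint Exs Γ (σs : list ty) : fm (σs ++ Γ) -> fm Γ :=
  match σs with
  | [] => fun A => A
  | σ :: σs' => fun A => Exs (Ex σ A)
  end.

Definition zero {Γ} : tm Γ tN := Cst cZero.
Definition succ {Γ} : tm Γ t1 := Cst cSucc.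
Definition one {Γ} : tm Γ tN := succ · zero.
Definition two {Γ} : tm Γ tN := succ · one.

Definition mem {Γ} (x : tm Γ tO) (A : tm Γ tS) : fm Γ := Cst cIn · x · A ≈ zero.

Fixpoint eqt Γ (τ : ty) : tm Γ τ -> tm Γ τ -> fm Γ :=
  match τ with
  | tN => fun s t => s ≈ t
  | tO => fun s t => Cst cEq · s · t ≈ zero
  | tS => fun s t => All tO (mem v0 (wk s) <-> mem v0 (wk t))
  | σ ⇒ τ' => fun s t => All σ (eqt (wk s · v0) (wk t · v0))
  end.

(** * Primitive recursive functions as closed terms *)

(** [natrec n a f] is [a] for [n = 0] and [f (natrec m a f) m] for [n = m+1]. *)
Definition natrec Γ τ (n : tm Γ tN) (a : tm Γ τ) (f : tm Γ (τ ⇒ tN ⇒ τ)) : tm Γ τ :=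
  Cst (cRec (ρs := [τ]) VZ) · n · a · f.

Definition pred {Γ} : tm Γ t1 := lam (natrec v0 zero (lam (lam v0))).
Definition plus {Γ} : tm Γ (tN ⇒ tN ⇒ tN) :=
  lam (lam (natrec v0 v1 (lam (lam (succ · v1))))).
Definition times {Γ} : tm Γ (tN ⇒ tN ⇒ tN) :=
  lam (lam (natrec v0 zero (lam (lam (plus · v1 · v3))))).
(** Truncated subtraction. *)
Definition minus {Γ} : tm Γ (tN ⇒ tN ⇒ tN) :=
  lam (lam (natrec v0 v1 (lam (lam (pred · v1))))).
Definition pow2 {Γ} : tm Γ t1 :=
  lam (natrec v0 one (lam (lam (plus · v1 · v1)))).
(** [cond n a b] is [a] if [n = 0] and [b] otherwise. *)
Definition cond {Γ} : tm Γ (tN ⇒ tN ⇒ tN ⇒ tN) :=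
  lam (lam (lam (natrec v2 v1 (lam (lam v2))))).
Definition half {Γ} : tm Γ t1 :=
  lam (natrec v0 zero (lam (lam (minus · v0 · v1)))).
Definition parity {Γ} : tm Γ t1 :=
  lam (natrec v0 zero (lam (lam (minus · one · v1)))).
(** The least [k < n] with [g k <> 0], and [n] if there is none. *)
Definition search {Γ} : tm Γ (t1 ⇒ tN ⇒ tN) :=
  lam (lam (natrec v0 zero
    (lam (lam (cond · (minus · v0 · v1)
                    · (cond · (v3 · v0) · (succ · v0) · v0)
                    · v1))))).

Definition le0 {Γ} (s t : tm Γ tN) : fm Γ := minus · s · t ≈ zero.

(** ** Cantor pairing *)

Definition triangle {Γ} : tm Γ t1 :=
  lam (natrec v0 zero (lam (lam (plus · v1 · (succ · v0))))).
Definition pair {Γ} : tm Γ (tN ⇒ tN ⇒ tN) :=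
  lam (lam (plus · (triangle · (plus · v1 · v0)) · v1)).

(** The projections enumerate the pairs in the order of their codes: [(x, 0)] is
    followed by [(0, x+1)] and [(x, y+1)] by [(x+1, y)]. *)
Definition fst_step {Γ} : tm Γ (tN ⇒ tN ⇒ tN ⇒ tN) :=
  lam (lam (lam (cond · v1 · zero · (succ · v2)))).
Definition snd_step {Γ} : tm Γ (tN ⇒ tN ⇒ tN ⇒ tN) :=
  lam (lam (lam (cond · v1 · (succ · v2) · (pred · v1)))).
Definition proj1 {Γ} : tm Γ t1 :=
  lam (Cst (cRec (ρs := [tN; tN]) VZ) · v0 · zero · zero · fst_step · snd_step).
Definition proj2 {Γ} : tm Γ t1 :=
  lam (Cst (cRec (ρs := [tN; tN]) (VS VZ)) · v0 · zero · zero
         · fst_step · snd_step).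

(** ** Rationals *)

(** The code [pair p q] stands for [(p/2)/(q+1)] if [p] is even and for
    [-((p+1)/2)/(q+1)] if [p] is odd.  Thus every number codes the rational
    [(qpos c - qneg c) / qden c]. *)
Definition qpos {Γ} : tm Γ t1 :=
  lam (times · (minus · one · (parity · (proj1 · v0))) · (half · (proj1 · v0))).
Definition qneg {Γ} : tm Γ t1 :=
  lam (times · (parity · (proj1 · v0)) · (half · (succ · (proj1 · v0)))).
Definition qden {Γ} : tm Γ t1 := lam (succ · (proj2 · v0)).
(** [qmake a b d] codes [(a - b) / d] for [d > 0]. *)
Definition qmake {Γ} : tm Γ (tN ⇒ tN ⇒ tN ⇒ tN) :=
  lam (lam (lam (pair
    · (cond · (minus · v1 · v2)
            · (times · two · (minus · v2 · v1))
            · (pred · (times · two · (minus · v1 · v2))))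
    · (pred · v0)))).

Definition qnat {Γ} : tm Γ t1 := lam (qmake · v0 · zero · one).
Definition qopp {Γ} : tm Γ t1 := lam (qmake · (qneg · v0) · (qpos · v0) · (qden · v0)).
Definition qabs {Γ} : tm Γ t1 :=
  lam (qmake · (plus · (qpos · v0) · (qneg · v0)) · zero · (qden · v0)).
Definition qadd {Γ} : tm Γ (tN ⇒ tN ⇒ tN) :=
  lam (lam (qmake
    · (plus · (times · (qpos · v1) · (qden · v0)) · (times · (qpos · v0) · (qden · v1)))
    · (plus · (times · (qneg · v1) · (qden · v0)) · (times · (qneg · v0) · (qden · v1)))
    · (times · (qden · v1) · (qden · v0)))).
Definition qsub {Γ} : tm Γ (tN ⇒ tN ⇒ tN) := lam (lam (qadd · v1 · (qopp · v0))).
Definition qmul {Γ} : tm Γ (tN ⇒ tN ⇒ tN) :=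
  lam (lam (qmake
    · (plus · (times · (qpos · v1) · (qpos · v0)) · (times · (qneg · v1) · (qneg · v0)))
    · (plus · (times · (qpos · v1) · (qneg · v0)) · (times · (qneg · v1) · (qpos · v0)))
    · (times · (qden · v1) · (qden · v0)))).

(** Characteristic functions: the value is [0] iff the relation holds. *)
Definition qle {Γ} : tm Γ (tN ⇒ tN ⇒ tN) :=
  lam (lam (minus
    · (plus · (times · (qpos · v1) · (qden · v0)) · (times · (qneg · v0) · (qden · v1)))
    · (plus · (times · (qpos · v0) · (qden · v1)) · (times · (qneg · v1) · (qden · v0))))).
Definition qlt {Γ} : tm Γ (tN ⇒ tN ⇒ tN) :=
  lam (lam (minus · one · (qle · v0 · v1))).

Definition qmax {Γ} : tm Γ (tN ⇒ tN ⇒ tN) := lam (lam (cond · (qle · v1 · v0) · v0 · v1)).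
(** [n / 2^k] and [2^-k]. *)
Definition qdyadic {Γ} : tm Γ (tN ⇒ tN ⇒ tN) :=
  lam (lam (qmake · v1 · zero · (pow2 · v0))).
Definition qhalfpow {Γ} : tm Γ t1 := lam (qdyadic · one · v0).

(** ** Reals *)

Definition hat {Γ} : tm Γ (t1 ⇒ t1) :=
  lam (lam (v1 · (search
    · (lam (qlt · (qabs · (qsub · (v2 · v0) · (v2 · (succ · v0))))
                · (qhalfpow · (succ · v0))))
    · v0))).

Definition rconst {Γ} : tm Γ (tN ⇒ t1) := lam (lam v1).
Definition rnat {Γ} : tm Γ (tN ⇒ t1) := lam (rconst · (qnat · v0)).

Definition radd {Γ} : tm Γ (t1 ⇒ t1 ⇒ t1) :=
  lam (lam (lam (qadd · (hat · v2 · (succ · v0)) · (hat · v1 · (succ · v0))))).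
Definition rsub {Γ} : tm Γ (t1 ⇒ t1 ⇒ t1) :=
  lam (lam (lam (qsub · (hat · v2 · (succ · v0)) · (hat · v1 · (succ · v0))))).
Definition rabs {Γ} : tm Γ (t1 ⇒ t1) := lam (lam (qabs · (hat · v1 · v0))).

(** [1 + ⌈log2 (max (|x 0| + 1) (|y 0| + 1))⌉]; the search bound suffices since
    the absolute value of a rational is at most its code. *)
Definition rmul_shift {Γ} : tm Γ (t1 ⇒ t1 ⇒ tN) :=
  lam (lam (succ · (search
    · (lam (qlt · (qnat · (pow2 · v0))
                · (qadd · (qmax · (qabs · (v2 · zero)) · (qabs · (v1 · zero)))
                        · (qnat · one))))
    · (succ · (plus · (v1 · zero) · (v0 · zero)))))).
Definition rmul {Γ} : tm Γ (t1 ⇒ t1 ⇒ t1) :=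
  lam (lam (lam (qmul
    · (hat · v2 · (plus · v0 · (rmul_shift · v2 · v1)))
    · (hat · v1 · (plus · v0 · (rmul_shift · v2 · v1)))))).

(** [rsum a m] is [a 0 + ... + a m]. *)
Definition rsum {Γ} : tm Γ ((tN ⇒ t1) ⇒ tN ⇒ t1) :=
  lam (lam (natrec v0 (v1 · zero)
    (lam (lam (radd · v1 · (v3 · (succ · v0))))))).

Definition rlt {Γ} (x y : tm Γ t1) : fm Γ :=
  Ex tN (qle · (qhalfpow · v0)
             · (qsub · (hat · wk y · (succ · v0)) · (hat · wk x · (succ · v0)))
         ≈ zero).
Definition rle {Γ} (x y : tm Γ t1) : fm Γ := ~ rlt y x.
Definition req {Γ} (x y : tm Γ t1) : fm Γ :=
  All tN (qlt · (qabs · (qsub · (hat · wk x · (succ · v0)) · (hat · wk y · (succ · v0))))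
              · (qhalfpow · v0)
          ≈ zero).

Definition rhalfpow {Γ} : tm Γ (tN ⇒ t1) := lam (rconst · (qhalfpow · v0)).
Definition rnhalfpow {Γ} : tm Γ (tN ⇒ t1) := lam (rconst · (qopp · (qhalfpow · v0))).

(** * Events, random variables *)

Notation "x ∈ A" := (mem x A) (at level 70, no associativity) : fm_scope.
Notation "x ∉ A" := (~ mem x A)%fm (at level 70, no associativity) : fm_scope.

Definition inA {Γ} : tm Γ (tO ⇒ tS ⇒ tN) := Cst cIn.
Definition emptyset {Γ} : tm Γ tS := Cst cEmpty.
Definition cup {Γ} : tm Γ (tS ⇒ tS ⇒ tS) := Cst cCup.
Definition compl {Γ} : tm Γ (tS ⇒ tS) := Cst cCompl.
Definition cap {Γ} : tm Γ (tS ⇒ tS ⇒ tS) :=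
  lam (lam (compl · (cup · (compl · v1) · (compl · v0)))).

(** [bigcup A n m] is the union of the [A i] with [n <= i <= m]. *)
Definition bigcup {Γ} : tm Γ ((tN ⇒ tS) ⇒ tN ⇒ tN ⇒ tS) :=
  lam (lam (lam (natrec (minus · (succ · v0) · v1) emptyset
    (lam (lam (cup · v1 · (v4 · (plus · v3 · v0)))))))).
Definition bigcap {Γ} : tm Γ ((tN ⇒ tS) ⇒ tN ⇒ tN ⇒ tS) :=
  lam (lam (lam (compl · (bigcup · (lam (compl · (v3 · v0))) · v1 · v0)))).

Definition Pr {Γ} : tm Γ (tS ⇒ t1) := Cst cProb.
Definition itv {Γ} : tm Γ (t1 ⇒ t1 ⇒ t1 ⇒ tN) := Cst cItv.
Definition preim {Γ} : tm Γ (tRV ⇒ (t1 ⇒ tN) ⇒ tO ⇒ tN) := Cst cInv.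
Definition norm {Γ} : tm Γ (tRV ⇒ t1) := Cst cNorm.
Definition integral {Γ} : tm Γ (tRV ⇒ t1) := Cst cInt.
Definition Xseq {Γ} : tm Γ (tN ⇒ tRV) := Cst cX.
Definition Pset {Γ} : tm Γ (tN ⇒ tN ⇒ tN ⇒ tS) := Cst cP.

Definition in_itv {Γ} (r a b : tm Γ t1) : fm Γ := itv · a · b · r ≈ zero.
Definition in_preim {Γ} (x : tm Γ tO) (f : tm Γ tRV) (A : tm Γ (t1 ⇒ tN)) : fm Γ :=
  preim · f · A · x ≈ zero.
Definition integrable {Γ} (f : tm Γ tRV) : fm Γ := Cst cI · f ≈ zero.

(** The value of [inA] is [0] on members, so that this is the function which is
    [1] on [A] and [0] elsewhere. *)
Definition chi {Γ} : tm Γ (tS ⇒ tRV) := lam (lam (rnat · (inA · v0 · (compl · v1)))).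
Definition fabs {Γ} : tm Γ (tRV ⇒ tRV) := lam (lam (rabs · (v1 · v0))).
Definition fdiff {Γ} : tm Γ (tRV ⇒ tRV ⇒ tRV) :=
  lam (lam (lam (rsub · (v2 · v0) · (v1 · v0)))).
(** [flin a b f g] is [a f + b g]. *)
Definition flin {Γ} : tm Γ (t1 ⇒ t1 ⇒ tRV ⇒ tRV ⇒ tRV) :=
  lam (lam (lam (lam (lam
    (radd · (rmul · v4 · (v2 · v0)) · (rmul · v3 · (v1 · v0))))))).

(** The natural number [b_f]: the code of the rational [‖f‖ 0], plus one.  It
    bounds [‖f‖] because a rational is at most its code. *)
Definition bnd {Γ} : tm Γ (tRV ⇒ tN) := lam (succ · (norm · v0 · zero)).
(** [sum_(i = 0)^(2^(k+1) b_f - 1) (- b_f + i / 2^k) chi_(A i)]. *)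
Definition simple_approx {Γ} : tm Γ (tRV ⇒ tN ⇒ (tN ⇒ tS) ⇒ tRV) :=
  lam (lam (lam (lam (rsum
    · (lam (rmul
        · (rconst · (qadd · (qopp · (qnat · (bnd · v4))) · (qdyadic · v0 · v3)))
        · (chi · (v2 · v0) · v1)))
    · (pred · (times · (pow2 · (succ · v2)) · (bnd · v3))))))).

(** * Axioms *)

(** Instances of the axioms of [WE-PA^ω]. *)
Inductive ax_WEPA {Γ : ctx} : fm Γ -> Prop :=
| ax_refl : forall s, ax_WEPA (s ≈ s)
| ax_sym : forall s t, ax_WEPA (s ≈ t ⊃ t ≈ s)
| ax_trans : forall s t u, ax_WEPA (s ≈ t /\ t ≈ u ⊃ s ≈ u)
| ax_succ_neq0 : forall s, ax_WEPA (~ succ · s ≈ zero)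
| ax_succ_inj : forall s t, ax_WEPA (succ · s ≈ succ · t ⊃ s ≈ t)
| ax_ind : forall A : fm (tN :: Γ),
    ax_WEPA (finst A zero
             /\ All tN (A ⊃ fsub A (scons (succ · v0) (fun _ v => Var (VS v))))
             ⊃ All tN A)
| ax_K : forall ρ τ (s : tm Γ ρ) (t : tm Γ τ), ax_WEPA (eqt (Cst cK · s · t) s)
| ax_S : forall δ ρ τ (s : tm Γ (δ ⇒ ρ ⇒ τ)) (t : tm Γ (δ ⇒ ρ)) (u : tm Γ δ),
    ax_WEPA (eqt (Cst cS · s · t · u) (s · u · (t · u)))
| ax_rec0 : forall ρs τ (i : var ρs τ)
    (y : sub ρs Γ) (z : sub (map (step_ty ρs) ρs) Γ),
    ax_WEPA (eqt (apps (apps (Cst (cRec i) · zero) y) z) (y τ i))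
| ax_recS : forall ρs τ (i : var ρs τ) (n : tm Γ tN)
    (y : sub ρs Γ) (z : sub (map (step_ty ρs) ρs) Γ),
    ax_WEPA (eqt (apps (apps (Cst (cRec i) · (succ · n)) y) z)
                 (apps (z _ (vmap (step_ty ρs) i))
                       (fun _ j => apps (apps (Cst (cRec j) · n) y) z)
                  · n)).

(** In [A] the last-introduced variables come first: the context of [A] lists
    [ys], then [xs], then the parameters. *)
Definition QF_AC {Γ} (xs ys : list ty) (A : fm (ys ++ xs ++ Γ)) : fm Γ :=
  let Ys := map (arrs xs) ys in
  let Δ := xs ++ Ys ++ Γ in
  let x : sub xs Δ := fun _ j => Var (vl (Ys ++ Γ) j) in
  let Yx : sub ys Δ := fun _ i =>
    apps (Var (vr xs (vl Γ (vmap (arrs xs) i)))) x in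
  let p : sub Γ Δ := fun _ v => Var (vr xs (vr Ys v)) in
  Alls (Exs A) ⊃ Exs (Alls (fsub A (sapp Yx (sapp x p)))).

(** The context of [A] lists [zs], [ys] (both of types [ρs]), then [x]. *)
Definition DC {Γ} (ρs : list ty) (A : fm (ρs ++ ρs ++ tN :: Γ)) : fm Γ :=
  let fs := map (tArr tN) ρs in
  let Δ := tN :: fs ++ Γ in
  let x : tm Δ tN := Var VZ in
  let f (n : tm Δ tN) : sub ρs Δ := fun _ i =>
    Var (VS (vl Γ (vmap (tArr tN) i))) · n in
  let p : sub Γ Δ := fun _ v => Var (VS (vr fs v)) in
  All tN (Alls (Exs A))
  ⊃ Exs (All tN (fsub A (sapp (f (succ · x)) (sapp (f x) (scons x p))))).

Inductive ax_choice {Γ : ctx} : fm Γ -> Prop :=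
| ax_QF_AC : forall xs ys (A : fm (ys ++ xs ++ Γ)), qf A -> ax_choice (QF_AC A)
| ax_DC : forall ρs (A : fm (ρs ++ ρs ++ tN :: Γ)), ax_choice (DC A).

Inductive ax_F {Γ : ctx} : fm Γ -> Prop :=
| ax_eq_le1 : ax_F (All tO (All tO (le0 (Cst cEq · v1 · v0) one)))
| ax_eq_refl : ax_F (All tO (eqt v0 v0))
| ax_eq_sym : ax_F (All tO (All tO (eqt v1 v0 ⊃ eqt v0 v1)))
| ax_eq_trans :
    ax_F (All tO (All tO (All tO (eqt v2 v1 /\ eqt v1 v0 ⊃ eqt v2 v0))))
| ax_in_le1 : ax_F (All tO (All tS (le0 (inA · v1 · v0) one)))
| ax_in_empty : ax_F (All tO (v0 ∉ emptyset))
| ax_in_cup :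
    ax_F (All tO (All tS (All tS (v2 ∈ cup · v1 · v0 <-> (v2 ∈ v1 \/ v2 ∈ v0)))))
| ax_in_compl : ax_F (All tO (All tS (v1 ∈ compl · v0 <-> v1 ∉ v0))).

Inductive ax_Pr {Γ : ctx} : fm Γ -> Prop :=
| ax_Pr_bounds :
    ax_Pr (All tS (rle (rnat · zero) (Pr · v0) /\ rle (Pr · v0) (rnat · one)))
| ax_Pr_empty : ax_Pr (req (Pr · emptyset) (rnat · zero))
| ax_Pr_cup :
    ax_Pr (All tS (All tS
      (req (Pr · (cup · v1 · v0))
           (rsub · (radd · (Pr · v1) · (Pr · v0)) · (Pr · (cap · v1 · v0))))))
| ax_Pr_mono :
    ax_Pr (All tS (All tS (Ex tO
      (rlt (Pr · v1) (Pr · v2) ⊃ v0 ∈ v2 /\ v0 ∉ v1)))).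

(** Two readings of the axiom [a, b ∈ [a,b]].  Imposed on all [a] and [b]
    ([unrestricted]), together with [ax_itv_bounds] it yields [a ≤ b] for all [a]
    and [b], so that the system is inconsistent; [ordered] restricts it to
    [a ≤ b]. *)
Inductive endpoints : Type := unrestricted | ordered.

Definition endpoint_axiom {Γ} (e : endpoints) : fm Γ :=
  match e with
  | unrestricted => All t1 (All t1 (in_itv v1 v1 v0 /\ in_itv v0 v1 v0))
  | ordered => All t1 (All t1 (rle v1 v0 ⊃ in_itv v1 v1 v0 /\ in_itv v0 v1 v0))
  end.

Inductive ax_Integral (e : endpoints) {Γ : ctx} : fm Γ -> Prop :=
| ax_itv_le1 : ax_Integral e (All t1 (All t1 (All t1 (le0 (itv · v2 · v1 · v0) one))))
| ax_itv_bounds :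
    ax_Integral e (All t1 (All t1 (All t1 (in_itv v0 v2 v1 ⊃ rle v2 v0 /\ rle v0 v1))))
| ax_itv_interior :
    ax_Integral e (All t1 (All t1 (All t1 (rlt v2 v0 /\ rlt v0 v1 ⊃ in_itv v0 v2 v1))))
| ax_itv_endpoints : ax_Integral e (endpoint_axiom e)
| ax_preim_le1 :
    ax_Integral e (All tRV (All (t1 ⇒ tN) (All tO (le0 (preim · v2 · v1 · v0) one))))
| ax_preim :
    ax_Integral e (All tRV (All (t1 ⇒ tN) (All tO
      (in_preim v0 v2 v1 <-> v1 · (v2 · v0) ≈ zero))))
| ax_I_le1 : ax_Integral e (All tRV (le0 (Cst cI · v0) one))
| ax_I_in : ax_Integral e (All tS (integrable (lam (rnat · (inA · v0 · v1)))))
| ax_I_preim :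
    ax_Integral e (All tRV (All t1 (All t1 (Ex tS (All tO
      (integrable v4 ⊃ (in_preim v0 v4 (itv · v3 · v2) <-> v0 ∈ v1)))))))
| ax_norm_ub :
    ax_Integral e (All tRV (All tO
      (integrable v1 ⊃ rle (rabs · (v1 · v0)) (norm · v1))))
| ax_norm_approx :
    ax_Integral e (All tRV (All tN (Ex tO
      (integrable v2 ⊃ rle (rsub · (norm · v2) · (rhalfpow · v1)) (rabs · (v2 · v0))))))
| ax_I_lin :
    ax_Integral e (All tRV (All tRV (All t1 (All t1
      (integrable v3 /\ integrable v2 ⊃ integrable (flin · v1 · v0 · v3 · v2))))))
| ax_I_abs : ax_Integral e (All tRV (integrable v0 ⊃ integrable (fabs · v0)))
| ax_I_mul :
    ax_Integral e (All tRV (All tS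
      (integrable v1
       ⊃ integrable (lam (rmul · (v2 · v0) · (rnat · (inA · v0 · v1)))))))
| ax_int_chi : ax_Integral e (All tS (req (integral · (chi · v0)) (Pr · v0)))
| ax_int_lin :
    ax_Integral e (All tRV (All tRV (All t1 (All t1
      (integrable v3 /\ integrable v2
       ⊃ req (integral · (flin · v1 · v0 · v3 · v2))
             (radd · (rmul · v1 · (integral · v3)) · (rmul · v0 · (integral · v2))))))))
| ax_int_approx :
    ax_Integral e (All tRV (All tN (Ex (tN ⇒ tS)
      (integrable v2
       ⊃ rle (integral · (fabs · (fdiff · v2 · (simple_approx · v2 · v1 · v0))))
             (rhalfpow · v1)))))
| ax_int_neg :
    ax_Integral e (All tRV (All tN (Ex tO
      (integrable v2 /\ rlt (integral · v2) (rnhalfpow · v1)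
       ⊃ rle (v2 · v0) (rnhalfpow · v1))))).

Inductive ax_X {Γ : ctx} : fm Γ -> Prop :=
| ax_X_integrable : ax_X (All tN (integrable (Xseq · v0)))
| ax_P :
    ax_X (All tN (All tN (All tN (All tO
      (v0 ∈ Pset · v3 · v2 · v1
       <-> in_preim v0 (fabs · (fdiff · (Xseq · v1) · (Xseq · v2)))
                    (itv · (rnat · zero) · (rhalfpow · v3))))))).

Inductive axiom (e : endpoints) {Γ : ctx} (A : fm Γ) : Prop :=
| axiom_WEPA : ax_WEPA A -> axiom e A
| axiom_choice : ax_choice A -> axiom e A
| axiom_F : ax_F A -> axiom e A
| axiom_Pr : ax_Pr A -> axiom e A
| axiom_Integral : ax_Integral e A -> axiom e A
| axiom_X : ax_X A -> axiom e A.

(** * Derivability in [F^ω[P, Integral, X]] *)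

(** Natural deduction for classical many-sorted logic.  In the quantifier-free
    extensionality rule [d_qf_er] the premise must be derived without open
    assumptions. *)
Inductive derivable (e : endpoints) : forall Γ : ctx, list (fm Γ) -> fm Γ -> Prop :=
| d_axiom : forall Γ (H : list (fm Γ)) A, axiom e A -> derivable e H A
| d_hyp : forall Γ (H : list (fm Γ)) A, In A H -> derivable e H A
| d_bot_e : forall Γ (H : list (fm Γ)) A, derivable e H ⊥ -> derivable e H A
| d_dne : forall Γ (H : list (fm Γ)) A, derivable e H (~ ~ A) -> derivable e H A
| d_and_i : forall Γ (H : list (fm Γ)) A B,
    derivable e H A -> derivable e H B -> derivable e H (A /\ B)
| d_and_e1 : forall Γ (H : list (fm Γ)) A B, derivable e H (A /\ B) -> derivable e H A
| d_and_e2 : forall Γ (H : list (fm Γ)) A B, derivable e H (A /\ B) -> derivable e H B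
| d_or_i1 : forall Γ (H : list (fm Γ)) A B, derivable e H A -> derivable e H (A \/ B)
| d_or_i2 : forall Γ (H : list (fm Γ)) A B, derivable e H B -> derivable e H (A \/ B)
| d_or_e : forall Γ (H : list (fm Γ)) A B C,
    derivable e H (A \/ B) -> derivable e (A :: H) C -> derivable e (B :: H) C ->
    derivable e H C
| d_imp_i : forall Γ (H : list (fm Γ)) A B,
    derivable e (A :: H) B -> derivable e H (A ⊃ B)
| d_imp_e : forall Γ (H : list (fm Γ)) A B,
    derivable e H (A ⊃ B) -> derivable e H A -> derivable e H B
| d_all_i : forall Γ (H : list (fm Γ)) σ (A : fm (σ :: Γ)),
    derivable e (map (fwk (σ := σ)) H) A -> derivable e H (All σ A)
| d_all_e : forall Γ (H : list (fm Γ)) σ (A : fm (σ :: Γ)) t,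
    derivable e H (All σ A) -> derivable e H (finst A t)
| d_ex_i : forall Γ (H : list (fm Γ)) σ (A : fm (σ :: Γ)) t,
    derivable e H (finst A t) -> derivable e H (Ex σ A)
| d_ex_e : forall Γ (H : list (fm Γ)) σ (A : fm (σ :: Γ)) B,
    derivable e H (Ex σ A) -> derivable e (A :: map (fwk (σ := σ)) H) (fwk B) ->
    derivable e H B
| d_qf_er : forall Γ (H : list (fm Γ)) ρ τ A (s t : tm Γ ρ) (r : tm (ρ :: Γ) τ),
    qf A -> derivable e [] (A ⊃ eqt s t) ->
    derivable e H (A ⊃ eqt (tsub (scons s (sid (Γ := Γ))) r)
                           (tsub (scons t (sid (Γ := Γ))) r)).

Definition provable (e : endpoints) (A : fm []) : Prop := derivable e [] A.

(** * The two modes of convergence *)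

(** [∀k ∀a ∀F ∃b  Pr (⋂_(m=0)^b ⋃_(i=m)^(F m) ⋃_(j=m)^(F m) P(a,i,j)^c) ≤ 2^-k]. *)
Definition au_metastable_pointwise : fm [] :=
  All tN (All tN (All t1 (Ex tN
    (rle (Pr · (bigcap
                · (lam (bigcup
                     · (lam (bigcup
                          · (lam (compl · (Pset · v5 · v1 · v0)))
                          · v1 · (v3 · v1)))
                     · v0 · (v2 · v0)))
                · zero · v0))
         (rhalfpow · v3))))).
(** [∀k ∀a ∃b ∀c  Pr (⋃_(i=b)^c ⋃_(j=b)^c P(a,i,j)^c) ≤ 2^-k]. *)
Definition au_finite_unions : fm [] :=
  All tN (All tN (Ex tN (All tN
    (rle (Pr · (bigcup
                · (lam (bigcup
                     · (lam (compl · (Pset · v4 · v1 · v0)))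
                     · v2 · v1))
                · v1 · v0))
         (rhalfpow · v3))))).

(* Main.v *)
(** By a Henkin construction every formula that is true in all models is
    provable, where a model is a combinatory algebra with genuine equality
    satisfying all derivable formulas.  So one may argue inside a model, whose
    numbers form a possibly nonstandard model of Peano arithmetic; the rationals
    of the model live in its ordered field of fractions, where inequalities are
    ordinary linear arithmetic.

    Suppose that convergence with respect to finite unions fails for [k] and [a],
    and let [B m c] be the union over [m <= i, j <= c] of the sets [P(a,i,j)^c].
    The numbers [Pr (B m c)] are bounded, so dependent choice gives [F] such that
    [Pr (B m (F m))] is within [eps_m] of all [Pr (B m d)], with summable [eps_m].
    Then for [m <= b] the intersection of the first [m + 1] sets [B i (F i)] loses
    at most the sum of the [eps_i] from any [C = B b c], by induction on [m].
    Metastability for [F] and [k + 1] now contradicts [Pr C > 2^-k]. *)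

(* Induction and choice hold in a model only for formulas of the system, and the bounds [b], [F m]
   and the precisions may be nonstandard. So each claim about them has to be internal: inequalities
   become equations on terms such as [minus] and [qle], and long intersections are formed by
   [bigcap].

   The reals of the model are not elements of its field of fractions, which need not be complete. A
   real [x] is handled through its approximations [hv x n]. At a fixed index the comparison of two
   approximations is the vanishing of a term, so it can stand under induction and choice; each
   passage from a real relation to approximations costs a small multiple of some 2^-j, and [j] is
   fixed before the final index [n].

   The error budget: [F m] is optimal up to 2^-(k+m+5), and step [m] may lose 2^-(k+m+3), which
   leaves room for the approximation errors. These losses add up to less than 2^-(k+2); with the
   2^-(k+1) from metastability the total stays below 2^-k. *)
From HB Require Import structures.
From mathcomp Require Import all_boot all_order all_algebra.
From mathcomp Require Import boolp ring lra.
From Stdlib Require Cantor Eqdep.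
From Stdlib Require Import Program.Equality.
Require Import Defs.

Set Implicit Arguments.
Unset Strict Implicit.
Unset Printing Implicit Defensive.
Import Order.TTheory GRing.Theory Num.Theory.

(** * The ordered field of fractions over a model of arithmetic *)

Section Quotient.
Variables (T : Type) (R : T -> T -> Prop).

(** The elements are the classes themselves, as predicates, so [R] may be undecidable. It is used
    for formal differences and for provable equality of terms. *)
Definition quot := {P : T -> Prop | exists x, P = R x}.
Definition cls (x : T) : quot := exist _ (R x) (ex_intro _ x erefl).
Definition rep (q : quot) : T := projT1 (cid (svalP q)).

Lemma quot_eq (p q : quot) : sval p = sval q -> p = q.
Proof. by case: p q => [P hP] [Q hQ] /= E; subst Q; rewrite (Prop_irrelevance hP hQ). Qed.

Lemma repK q : cls (rep q) = q.
Proof. by apply: quot_eq; rewrite /rep /=; case: cid => x /= ->. Qed.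

Hypotheses (Rrefl : forall x, R x x) (Rsym : forall x y, R x y -> R y x)
  (Rtrans : forall x y z, R x y -> R y z -> R x z).

Lemma cls_eq x y : cls x = cls y <-> R x y.
Proof.
split=> [/(f_equal sval) /= E|h]; first by rewrite E.
apply: quot_eq => /=; apply/funext => z; apply/propext.
by split; apply: Rtrans => //; exact: Rsym.
Qed.

Lemma rep_cls x : R (rep (cls x)) x.
Proof. by apply/cls_eq; exact: repK. Qed.

End Quotient.

Section Peano.
Local Open Scope ring_scope.

(** What arithmetic has to supply for an ordered field: cancellation embeds the numbers in a ring of
    differences, the last axiom makes that ring a domain, and totality and positivity order it. *)
Record peano := Peano {
  peano_sort :> comNzSemiRingType;
  peano_addI : forall x y z : peano_sort, x + y = x + z -> y = z;
  peano_total : forall x y : peano_sort, (exists z, y = x + z) \/ (exists z, x = y + z);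
  peano_add_eq0 : forall x y : peano_sort, x + y = 0 -> x = 0;
  peano_mul_eq0 : forall x y : peano_sort, x * y = 0 -> x = 0 \/ y = 0 }.

End Peano.

Section Integers.
Local Open Scope ring_scope.
Variable N : peano.

(** [(a, b)] stands for [a - b]. *)
Definition zrel (p q : N * N) : Prop := p.1 + q.2 = q.1 + p.2.

Lemma zrel_refl p : zrel p p. Proof. by []. Qed.
Lemma zrel_sym p q : zrel p q -> zrel q p. Proof. by rewrite /zrel => ->. Qed.
Lemma zrel_trans p q r : zrel p q -> zrel q r -> zrel p r.
Proof.
rewrite /zrel => h1 h2; apply: (@peano_addI _ (q.1 + q.2)).
have -> : q.1 + q.2 + (p.1 + r.2) = (p.1 + q.2) + (q.1 + r.2) by ring.
by rewrite h1 h2; ring.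
Qed.

Definition pint := quot zrel.
Definition zc (p : N * N) : pint := cls zrel p.

Lemma zc_eq p q : zc p = zc q <-> zrel p q.
Proof. exact: (cls_eq zrel_refl zrel_sym zrel_trans). Qed.

Lemma zrep_cls p : zrel (rep (zc p)) p.
Proof. exact: (rep_cls zrel_refl zrel_sym zrel_trans). Qed.

Lemma zc_surj x : exists a b, x = zc (a, b).
Proof. by exists (rep x).1, (rep x).2; rewrite -surjective_pairing /zc repK. Qed.

Definition zadd (x y : pint) := zc ((rep x).1 + (rep y).1, (rep x).2 + (rep y).2).
Definition zopp (x : pint) := zc ((rep x).2, (rep x).1).
Definition zmul (x y : pint) :=
  zc ((rep x).1 * (rep y).1 + (rep x).2 * (rep y).2,
      (rep x).1 * (rep y).2 + (rep x).2 * (rep y).1).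

Lemma zaddE a b c d : zadd (zc (a, b)) (zc (c, d)) = zc (a + c, b + d).
Proof.
apply/zc_eq; have := zrep_cls (a, b); have := zrep_cls (c, d).
rewrite /zrel /=; move: (rep _) (rep _) => [a' b'] [c' d'] /= h2 h1.
have -> : a' + c' + (b + d) = (a' + b) + (c' + d) by ring.
by rewrite h1 h2; ring.
Qed.

Lemma zoppE a b : zopp (zc (a, b)) = zc (b, a).
Proof.
apply/zc_eq; have := zrep_cls (a, b).
by rewrite /zrel /=; move: (rep _) => [a' b'] /= h; rewrite addrC -h addrC.
Qed.

Lemma zmulE a b c d : zmul (zc (a, b)) (zc (c, d)) = zc (a * c + b * d, a * d + b * c).
Proof.
apply/zc_eq; have := zrep_cls (a, b); have := zrep_cls (c, d).
move: (rep _) (rep _) => [a' b'] [c' d'] h2 h1.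
(* One factor is changed at a time: the intermediate pair is the product of [(a', b')] and
   [(c, d)]. *)
apply: (@zrel_trans _ (a' * c + b' * d, a' * d + b' * c)); move: h1 h2; rewrite /zrel /= => h1 h2.
- have h3 : b' * (c + d') = b' * (c' + d) by rewrite h2.
  have -> : a' * c' + b' * d' + (a' * d + b' * c) = a' * (c' + d) + b' * (c + d') by ring.
  by rewrite h2 h3; ring.
- have h3 : (a + b') * d = (a' + b) * d by rewrite h1.
  have -> : a' * c + b' * d + (a * d + b * c) = (a' + b) * c + (a + b') * d by ring.
  by rewrite h1 h3; ring.
Qed.

Local Ltac zcases := repeat (let a := fresh "a" in let b := fresh "b" in
  let x := fresh in intro x; have [a [b ->]] := zc_surj x; clear x).

Lemma zaddA : associative zadd.
Proof. by zcases; rewrite !zaddE !addrA. Qed.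
Lemma zaddC : commutative zadd.
Proof. by zcases; rewrite !zaddE; apply/zc_eq; rewrite /zrel /=; ring. Qed.
Lemma zadd0 : left_id (zc (0, 0)) zadd.
Proof. by zcases; rewrite zaddE !add0r. Qed.
Lemma zaddN : left_inverse (zc (0, 0)) zopp zadd.
Proof. by zcases; rewrite zoppE zaddE; apply/zc_eq; rewrite /zrel /=; ring. Qed.
Lemma zmulA : associative zmul.
Proof. by zcases; rewrite !zmulE; apply/zc_eq; rewrite /zrel /=; ring. Qed.
Lemma zmulC : commutative zmul.
Proof. by zcases; rewrite !zmulE; apply/zc_eq; rewrite /zrel /=; ring. Qed.
Lemma zmul1 : left_id (zc (1, 0)) zmul.
Proof. by zcases; rewrite !zmulE; apply/zc_eq; rewrite /zrel /=; ring. Qed.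
Lemma zmulDl : left_distributive zmul zadd.
Proof. by zcases; rewrite !(zmulE, zaddE); apply/zc_eq; rewrite /zrel /=; ring. Qed.

HB.instance Definition _ := gen_eqMixin pint.
HB.instance Definition _ := gen_choiceMixin pint.
HB.instance Definition _ := GRing.isZmodule.Build pint zaddA zaddC zadd0 zaddN.

Lemma zone_neq0 : zc (1, 0) != 0.
Proof.
apply/eqP => /zc_eq; rewrite /zrel /= => /eqP.
by rewrite !addr0 oner_eq0.
Qed.

HB.instance Definition _ :=
  GRing.Zmodule_isComNzRing.Build pint zmulA zmulC zmul1 zmulDl zone_neq0.

(** The fraction construction expects a domain with a unit test and an inverse. Both are obtained
    classically; off the units the inverse is the identity. *)
Definition zunit : {pred pint} := fun x => `[< exists y : pint, y * x = 1 >].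
Definition zinv (x : pint) : pint :=
  if pselect (exists y : pint, y * x = 1) is left h then projT1 (cid h) else x.

Lemma zmulVx : {in zunit, left_inverse 1 zinv *%R}.
Proof.
move=> x /asboolP hx; rewrite /zinv; case: pselect => // h; exact: (projT2 (cid h)).
Qed.
Lemma zunitPl (x y : pint) : y * x = 1 -> zunit x.
Proof. by move=> h; apply/asboolP; exists y. Qed.
Lemma zinv_out : {in [predC zunit], zinv =1 id}.
Proof. by move=> x /asboolPn hx; rewrite /zinv; case: pselect. Qed.

HB.instance Definition _ :=
  GRing.ComNzRing_hasMulInverse.Build pint zmulVx zunitPl zinv_out.

Definition zof (a : N) : pint := zc (a, 0).

Lemma zofD a b : zof (a + b) = zof a + zof b.
Proof. by rewrite /zof -[RHS]/(zadd _ _) zaddE addr0. Qed.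
Lemma zofM a b : zof (a * b) = zof a * zof b.
Proof. by rewrite /zof -[RHS]/(zmul _ _) zmulE !mulr0 !mul0r !addr0. Qed.
Lemma zof1 : zof 1 = 1. Proof. by []. Qed.
Lemma zof0 : zof 0 = 0. Proof. by []. Qed.
Lemma zof_inj : injective zof.
Proof. by move=> a b /zc_eq; rewrite /zrel /= !addr0. Qed.

Lemma zof_total x : (exists a, x = zof a) \/ (exists a, x = - zof a).
Proof.
have [a [b ->]] := zc_surj x.
have [[c ->]|[c ->]] := peano_total a b; [right|left]; exists c.
- by rewrite -[RHS]/(zopp _) zoppE; apply/zc_eq; rewrite /zrel /=; ring.
- by apply/zc_eq; rewrite /zrel /=; ring.
Qed.

Lemma zmul_integral : GRing.integral_domain_axiom pint.
Proof.
move=> x y; have [[a ->]|[a ->]] := zof_total x; have [[b ->]|[b ->]] := zof_total y;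
  rewrite ?mulrN ?mulNr ?opprK -zofM; (try move/eqP; rewrite ?oppr_eq0 -?zof0);
  (try move/eqP); (try move/oppr_inj) => /zof_inj /peano_mul_eq0 [] ->;
  by rewrite ?oppr_eq0 zof0 eqxx ?orbT.
Qed.

HB.instance Definition _ := GRing.ComUnitRing_isIntegral.Build pint zmul_integral.

End Integers.

Section Fractions.
Local Open Scope ring_scope.
Variable N : peano.

Definition pfrac := {fraction (pint N)}.
HB.instance Definition _ := GRing.Field.on pfrac.

Definition nf (a : N) : pfrac := FracField.tofrac (zof a).

Lemma nfD a b : nf (a + b) = nf a + nf b.
Proof. by rewrite /nf zofD tofracD. Qed.
Lemma nfM a b : nf (a * b) = nf a * nf b.
Proof. by rewrite /nf zofM tofracM. Qed.
Lemma nf1 : nf 1 = 1. Proof. by rewrite /nf zof1 tofrac1. Qed.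
Lemma nf0 : nf 0 = 0. Proof. by rewrite /nf zof0 tofrac0. Qed.
Lemma nf_inj : injective nf.
Proof. by move=> a b /eqP; rewrite tofrac_eq => /eqP /zof_inj. Qed.
Lemma nf_neq0 (a : N) : a <> 0 -> nf a != 0.
Proof. by move=> h; apply/eqP; rewrite -nf0 => /nf_inj. Qed.

(** The positive cone that orders the field. *)
Definition fnneg (x : pfrac) := exists a b : N, b <> 0 /\ x = nf a / nf b.

Lemma frac_surj (R : idomainType) (x : {fraction R}) :
  exists n d : R, d != 0 /\ x = FracField.tofrac n / FracField.tofrac d.
Proof.
elim/quotW: x => r; have d0 := denom_ratioP r.
exists (frac r).1, (frac r).2; split=> //; unlock FracField.tofrac.
rewrite -[RHS]/(FracField.mul _ (FracField.inv _)) -FracField.pi_inv -FracField.pi_mul.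
set m := FracField.mulf _ _; suff -> : m = r by [].
rewrite /m /FracField.mulf /FracField.invf !numden_Ratio ?oner_eq0 //.
by rewrite mulr1 mul1r Ratio_numden.
Qed.

Lemma fnneg_total (x : pfrac) : fnneg x \/ fnneg (- x).
Proof.
have [n [d [d0 ->]]] := frac_surj x.
have [[a Ea]|[a Ea]] := zof_total n; have [[b Eb]|[b Eb]] := zof_total d; subst n d;
  [left|right|right|left]; exists a, b; (split=> [E|]; [by move: d0; rewrite E ?oppr0 eqxx|]).
- by [].
- by rewrite /nf tofracN invrN mulrN opprK.
- by rewrite /nf tofracN mulNr opprK.
- by rewrite /nf !tofracN invrN mulrNN.
Qed.

Lemma fnneg_add x y : fnneg x -> fnneg y -> fnneg (x + y).
Proof.
move=> [a [b [hb ->]]] [c [d [hd ->]]]; exists (a * d + c * b), (b * d); split.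
  by move/peano_mul_eq0 => [].
rewrite nfD !nfM addf_div //; exact: nf_neq0.
Qed.

Lemma fnneg_mul x y : fnneg x -> fnneg y -> fnneg (x * y).
Proof.
move=> [a [b [hb ->]]] [c [d [hd ->]]]; exists (a * c), (b * d); split.
  by move/peano_mul_eq0 => [].
by rewrite !nfM mulf_div.
Qed.

(** Adding the two representations gives [a * d + c * b = 0] already in [N], so [a * d = 0] and,
    since [d <> 0], [a = 0]. *)
Lemma fnneg_anti x : fnneg x -> fnneg (- x) -> x = 0.
Proof.
move=> [a [b [hb Ex]]] [c [d [hd Ey]]]; subst x.
have /eqP : nf (a * d + c * b) / nf (b * d) = 0.
  by rewrite nfD !nfM -addf_div ?nf_neq0 // -Ey subrr.
rewrite mulf_eq0 invr_eq0 => /orP [] /eqP; rewrite -nf0 => /nf_inj.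
- by move/peano_add_eq0/peano_mul_eq0 => [->|//]; rewrite nf0 mul0r.
- by move/peano_mul_eq0 => [].
Qed.

Definition fle : rel pfrac := fun x y => `[< fnneg (y - x) >].
Definition flt : rel pfrac := fun x y => (y != x) && fle x y.
Definition fnorm (x : pfrac) : pfrac := if fle 0 x then x else - x.

Lemma fle0 x : fle 0 x <-> fnneg x.
Proof. by rewrite /fle subr0; split=> [/asboolP|] // h; apply/asboolP. Qed.
Lemma fge0 x : fle x 0 <-> fnneg (- x).
Proof. by rewrite /fle sub0r; split=> [/asboolP|] // h; apply/asboolP. Qed.

Lemma fle0_add x y : fle 0 x -> fle 0 y -> fle 0 (x + y).
Proof. by move=> /fle0 h /fle0 h'; apply/fle0/fnneg_add. Qed.
Lemma fle0_mul x y : fle 0 x -> fle 0 y -> fle 0 (x * y).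
Proof. by move=> /fle0 h /fle0 h'; apply/fle0/fnneg_mul. Qed.
Lemma fle0_anti x : fle 0 x -> fle x 0 -> x = 0.
Proof. by move=> /fle0 h /fge0 h'; exact: fnneg_anti. Qed.
Lemma fsub_ge0 x y : fle 0 (y - x) = fle x y.
Proof. by rewrite /fle subr0. Qed.
Lemma fle0_total x : fle 0 x || fle x 0.
Proof. by apply/orP; case: (fnneg_total x) => h; [left; apply/fle0|right; apply/fge0]. Qed.
Lemma fnormN x : fnorm (- x) = fnorm x.
Proof.
rewrite /fnorm opprK; case: ifP => [/fle0 h|h]; case: ifP => [/fle0 h'|h'] //.
- by rewrite (fnneg_anti h' h) oppr0.
- have := fle0_total x; rewrite h' /= => /fge0/fle0; rewrite h //.
Qed.
Lemma fge0_norm x : fle 0 x -> fnorm x = x.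
Proof. by rewrite /fnorm => ->. Qed.
Lemma flt_def x y : flt x y = (y != x) && fle x y.
Proof. by []. Qed.

HB.instance Definition _ := Num.IntegralDomain_isLeReal.Build pfrac
  fle0_add fle0_mul fle0_anti fsub_ge0 fle0_total fnormN fge0_norm flt_def.

Lemma nf_ge0 a : 0 <= nf a.
Proof.
by apply/fle0; exists a, 1; split; [move/eqP; rewrite oner_eq0|rewrite nf1 divr1].
Qed.

Lemma nf_le a b : (nf a <= nf b) <-> exists c, b = a + c.
Proof.
split=> [h|[c ->]]; last by rewrite nfD lerDl nf_ge0.
have [[c ->]|[c E]] := peano_total a b; first by exists c.
exists 0; rewrite addr0; apply: nf_inj; apply: le_anti.
by rewrite h E nfD lerDl nf_ge0.
Qed.

End Fractions.

Section FieldOfFractions.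
Local Open Scope ring_scope.

Record fractions (N : peano) := Fractions {
  frac_field :> realFieldType;
  frac_of : N -> frac_field;
  frac_ofD : forall a b, frac_of (a + b) = frac_of a + frac_of b;
  frac_ofM : forall a b, frac_of (a * b) = frac_of a * frac_of b;
  frac_of0 : frac_of 0 = 0;
  frac_of1 : frac_of 1 = 1;
  frac_of_inj : injective frac_of;
  frac_of_ge0 : forall a, 0 <= frac_of a;
  frac_of_le : forall a b, frac_of a <= frac_of b <-> exists c, b = a + c }.

(** Opaque: unification must not look into the construction of the field. *)
Lemma fractions_of (N : peano) : fractions N.
Proof.
exact: (@Fractions N (pfrac N) (@nf N) (@nfD N) (@nfM N) (@nf0 N) (@nf1 N) (@nf_inj N)
  (@nf_ge0 N) (@nf_le N)).
Qed.

End FieldOfFractions.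

(** * Substitution *)

Lemma vext (T : ty -> Type) Γ (f g : forall τ, var Γ τ -> T τ) :
  (forall τ v, f τ v = g τ v) -> f = g.
Proof.
move=> h; apply: functional_extensionality_dep => τ.
exact: functional_extensionality_dep.
Qed.

Lemma vcons_ext (T : ty -> Type) Γ σ (f g : forall τ, var (σ :: Γ) τ -> T τ) :
  f σ VZ = g σ VZ -> (forall τ v, f τ (VS v) = g τ (VS v)) -> f = g.
Proof. by move=> h0 hS; apply: vext; apply: (vcons (fun τ v => f τ v = g τ v)). Qed.

Definition vnil (T : ty -> Type) τ (v : var [::] τ) : T τ :=
  match v in var Γ τ return match Γ with [::] => T τ | _ => unit end with
  | VZ _ _ => tt | VS _ _ _ _ => tt end.

Lemma vnil_ext (T : ty -> Type) (f g : forall τ, var [::] τ -> T τ) : f = g.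
Proof. by apply: vext => τ v; inversion v. Qed.

Lemma tsub_comp Γ Δ Θ (f : sub Γ Δ) (g : sub Δ Θ) τ (t : tm Γ τ) :
  tsub g (tsub f t) = tsub (fun _ v => tsub g (f _ v)) t.
Proof. by elim: t => //= σ τ' s -> u ->. Qed.

Lemma tsub_id Γ τ (t : tm Γ τ) : tsub (sid (Γ := Γ)) t = t.
Proof. by elim: t => //= σ τ' s -> u ->. Qed.

Lemma wk_sub Γ Δ σ (f : sub Γ Δ) (s : tm Δ σ) τ (t : tm Γ τ) :
  tsub (scons s f) (wk t) = tsub f t.
Proof. by rewrite /wk tsub_comp. Qed.

Lemma wk_inst Γ σ (s : tm Γ σ) τ (t : tm Γ τ) : tsub (scons s (sid (Γ := Γ))) (wk t) = t.
Proof. by rewrite wk_sub tsub_id. Qed.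

Lemma sup_comp Γ Δ Θ σ (f : sub Γ Δ) (g : sub Δ Θ) :
  (fun τ v => tsub (sup (σ := σ) g) (sup f v)) = sup (fun τ v => tsub g (f τ v)).
Proof. by apply: vcons_ext => //= τ v; rewrite /sup /= wk_sub /wk tsub_comp. Qed.

Lemma sup_id Γ σ : sup (σ := σ) (sid (Γ := Γ)) = sid (Γ := σ :: Γ).
Proof. by apply: vcons_ext. Qed.

Lemma fsub_comp Γ (A : fm Γ) Δ Θ (f : sub Γ Δ) (g : sub Δ Θ) :
  fsub (fsub A f) g = fsub A (fun _ v => tsub g (f _ v)).
Proof.
elim: A Δ Θ f g => //= {Γ}.
- by move=> Γ s t Δ Θ f g; rewrite !tsub_comp.
- by move=> Γ A IA B IB Δ Θ f g; rewrite IA IB.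
- by move=> Γ A IA B IB Δ Θ f g; rewrite IA IB.
- by move=> Γ A IA B IB Δ Θ f g; rewrite IA IB.
- by move=> Γ σ A IA Δ Θ f g; rewrite IA sup_comp.
- by move=> Γ σ A IA Δ Θ f g; rewrite IA sup_comp.
Qed.

Lemma fsub_id Γ (A : fm Γ) : fsub A (sid (Γ := Γ)) = A.
Proof.
elim: A => //= {Γ}.
- by move=> Γ s t; rewrite !tsub_id.
- by move=> Γ A -> B ->.
- by move=> Γ A -> B ->.
- by move=> Γ A -> B ->.
- by move=> Γ σ A IA; rewrite sup_id IA.
- by move=> Γ σ A IA; rewrite sup_id IA.
Qed.

Lemma finst_sup Γ Δ σ (A : fm (σ :: Γ)) (f : sub Γ Δ) (t : tm Δ σ) :
  finst (fsub A (sup f)) t = fsub A (scons t f).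
Proof.
rewrite /finst fsub_comp; congr fsub.
by apply: vcons_ext => //= τ v; rewrite /sup /= wk_inst.
Qed.

Lemma finst_var Γ σ (A : fm (σ :: Γ)) :
  finst (fsub A (sup (fun _ v => Var (VS v)))) (Var VZ) = A.
Proof.
by rewrite finst_sup -[RHS]fsub_id; congr fsub; apply: vcons_ext.
Qed.

(** * Formulas are countable *)

Definition code_pair (a b : nat) : nat := Cantor.to_nat (a, b).

Lemma code_pair_inj a b c d : code_pair a b = code_pair c d -> a = c /\ b = d.
Proof. by move/Cantor.to_nat_inj => [-> ->]. Qed.

Fixpoint ty_code (τ : ty) : nat :=
  match τ with
  | tN => code_pair 0 0 | tO => code_pair 1 0 | tS => code_pair 2 0
  | tArr σ τ => code_pair 3 (code_pair (ty_code σ) (ty_code τ))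
  end.

Lemma ty_code_inj : injective ty_code.
Proof.
elim=> [|||σ Iσ τ Iτ] [|||σ' τ'] //= /code_pair_inj [] // _ /code_pair_inj [].
by move/Iσ => -> /Iτ ->.
Qed.

Fixpoint tys_code (ρs : list ty) : nat :=
  match ρs with
  | nil => code_pair 0 0
  | cons ρ ρs => code_pair 1 (code_pair (ty_code ρ) (tys_code ρs))
  end.

Lemma tys_code_inj : injective tys_code.
Proof.
elim=> [|ρ ρs I] [|ρ' ρs'] //= /code_pair_inj [] // _ /code_pair_inj [].
by move/ty_code_inj => -> /I ->.
Qed.

Fixpoint var_code Γ τ (v : var Γ τ) : nat :=
  match v with VZ _ _ => 0 | VS _ _ _ u => S (var_code u) end.

Lemma var_code_inj Γ τ (v : var Γ τ) τ' (v' : var Γ τ') :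
  var_code v = var_code v' -> existT (var Γ) τ v = existT (var Γ) τ' v'.
Proof.
elim: v τ' v' => {Γ τ} [Γ τ|Γ σ τ v I] τ'.
- by apply: (vcons (fun τ' v' => 0 = var_code v' -> existT _ τ VZ = existT _ τ' v')).
- apply: (vcons (fun τ' v' => S (var_code v) = var_code v' ->
    existT _ τ (VS v) = existT _ τ' v')) => //= τ'' u [].
  by move/I/(f_equal (fun p => existT (var (σ :: Γ)) (projT1 p) (VS (projT2 p)))).
Qed.

Definition cst_code τ (c : cst τ) : nat :=
  match c with
  | cZero => code_pair 0 0 | cSucc => code_pair 1 0
  | cK ρ τ => code_pair 2 (code_pair (ty_code ρ) (ty_code τ))
  | cS δ ρ τ => code_pair 3 (code_pair (ty_code δ) (code_pair (ty_code ρ) (ty_code τ)))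
  | cRec ρs τ i => code_pair 4 (code_pair (tys_code ρs) (var_code i))
  | cEq => code_pair 5 0 | cIn => code_pair 6 0 | cCup => code_pair 7 0 | cCompl => code_pair 8 0
  | cEmpty => code_pair 9 0 | cOmega => code_pair 10 0 | cProb => code_pair 11 0
  | cItv => code_pair 12 0 | cInv => code_pair 13 0 | cI => code_pair 14 0
  | cNorm => code_pair 15 0 | cInt => code_pair 16 0
  | cX => code_pair 17 0 | cP => code_pair 18 0
  end.

Lemma cst_code_inj τ (c : cst τ) τ' (c' : cst τ') :
  cst_code c = cst_code c' -> existT cst τ c = existT cst τ' c'.
Proof.
case: c; case: c' => //= *;
  match goal with H : code_pair _ _ = code_pair _ _ |- _ => case/code_pair_inj: H end => //.
- by move=> _ /code_pair_inj [/ty_code_inj -> /ty_code_inj ->].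
- by move=> _ /code_pair_inj [/ty_code_inj -> /code_pair_inj [/ty_code_inj -> /ty_code_inj ->]].
- by move=> _ /code_pair_inj [/tys_code_inj E]; subst => /var_code_inj
    /(f_equal (fun p => existT cst _ (cRec (projT2 p)))).
Qed.

Fixpoint tm_code Γ τ (t : tm Γ τ) : nat :=
  match t with
  | Var _ v => code_pair 0 (var_code v)
  | Cst _ c => code_pair 1 (cst_code c)
  | App _ _ s u => code_pair 2 (code_pair (tm_code s) (tm_code u))
  end.

(** Two types are allowed because the code of [App s u] does not record the hidden argument type; it
    is recovered from the dependent pair given by induction on the function part. *)
Lemma tm_code_inj_tag Γ τ (t : tm Γ τ) τ' (t' : tm Γ τ') :
  tm_code t = tm_code t' -> existT (tm Γ) τ t = existT (tm Γ) τ' t'.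
Proof.
elim: t τ' t' => {τ} [τ v|τ c|σ τ s Is u Iu] τ' [τ'' v'|τ'' c'|σ' τ'' s' u'] /=
  /code_pair_inj [] // _.
- by move=> /var_code_inj h;
    apply: (f_equal (fun p => existT (tm Γ) (projT1 p) (Var (projT2 p))) h).
- by move=> /cst_code_inj h;
    apply: (f_equal (fun p => existT (tm Γ) (projT1 p) (Cst (projT2 p))) h).
- case/code_pair_inj => /Is E /Iu E'.
  have [E1 E2] := EqdepFacts.eq_sigT_fst E; subst.
  by rewrite (Eqdep.EqdepTheory.inj_pair2 _ _ _ _ _ E)
             (Eqdep.EqdepTheory.inj_pair2 _ _ _ _ _ E').
Qed.

Lemma tm_code_inj Γ τ : injective (@tm_code Γ τ).
Proof.
move=> t t' h; exact: (Eqdep.EqdepTheory.inj_pair2 _ _ _ _ _ (tm_code_inj_tag h)).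
Qed.

Fixpoint fm_code Γ (A : fm Γ) : nat :=
  match A with
  | Eq0 _ s t => code_pair 0 (code_pair (tm_code s) (tm_code t))
  | Bot _ => code_pair 1 0
  | And _ A B => code_pair 2 (code_pair (fm_code A) (fm_code B))
  | Or _ A B => code_pair 3 (code_pair (fm_code A) (fm_code B))
  | Imp _ A B => code_pair 4 (code_pair (fm_code A) (fm_code B))
  | All _ σ A => code_pair 5 (code_pair (ty_code σ) (fm_code A))
  | Ex _ σ A => code_pair 6 (code_pair (ty_code σ) (fm_code A))
  end.

Lemma fm_code_inj Γ : injective (@fm_code Γ).
Proof.
elim=> {Γ} [Γ s t|Γ|Γ A IA B IB|Γ A IA B IB|Γ A IA B IB|Γ σ A IA|Γ σ A IA] C;
  dependent destruction C; case/code_pair_inj => //= _ /code_pair_inj [] //.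
- by move/tm_code_inj => -> /tm_code_inj ->.
- by move/IA => -> /IB ->.
- by move/IA => -> /IB ->.
- by move/IA => -> /IB ->.
- by move/ty_code_inj => E; subst => /IA ->.
- by move/ty_code_inj => E; subst => /IA ->.
Qed.

Lemma fm_enum Γ : exists f : nat -> fm Γ, forall A, exists n, f n = A.
Proof.
have h n : exists A : fm Γ, forall B, fm_code B = n -> B = A.
  have [[A EA]|nA] := pselect (exists A : fm Γ, fm_code A = n).
    by exists A => B; rewrite -EA => /fm_code_inj.
  by exists (Bot (Γ := Γ)) => B EB; case: nA; exists B.
have [f hf] := choice h.
by exists f => A; exists (fm_code A); rewrite -(hf _ A).
Qed.

(** * Henkin extensions *)

Section Chain.
Variable e : endpoints.

Definition neg Γ (A : fm Γ) : fm Γ := Imp A (Bot (Γ := Γ)).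

Definition consistent Γ (H : list (fm Γ)) : Prop := ~ derivable e H (Bot (Γ := Γ)).

Fixpoint dummy Γ (σ : ty) : tm Γ σ :=
  match σ with
  | tN => Cst cZero
  | tO => Cst cOmega
  | tS => Cst cEmpty
  | tArr σ τ => App (Cst (@cK τ σ)) (dummy Γ τ)
  end.

(** A contradiction under a fresh variable generalizes to [All σ ⊥], which can be instantiated
    because every type has a closed inhabitant [dummy]. *)
Lemma consistent_wk Γ σ (H : list (fm Γ)) :
  consistent H -> consistent (List.map (fwk (σ := σ)) H).
Proof.
move=> hc hd; apply: hc.
exact (@d_all_e e Γ H σ (Bot (Γ := σ :: Γ)) (dummy Γ σ) (d_all_i hd)).
Qed.

Lemma consistent_witness Γ σ (A : fm (σ :: Γ)) (H : list (fm Γ)) :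
  consistent H -> List.In (Ex σ A) H -> consistent (A :: List.map (fwk (σ := σ)) H).
Proof.
move=> hc hi hd; apply: hc.
exact (@d_ex_e e Γ H σ A (Bot (Γ := Γ)) (d_hyp hi) hd).
Qed.

Lemma consistent_neg Γ (A : fm Γ) (H : list (fm Γ)) :
  consistent H -> ~ consistent (A :: H) -> consistent (neg A :: H).
Proof.
move=> hc hA hn; apply: hc; apply: d_imp_e (d_imp_i hn) _.
by apply: d_imp_i; apply: contrapT.
Qed.

(** Every stage adds exactly one variable. For a task that is not existential it is an unconstrained
    one of type [tN]. *)
Definition witness_ty Γ (A : fm Γ) : ty := match A with Ex _ σ _ => σ | _ => tN end.

Definition witness Γ (A : fm Γ) : list (fm (witness_ty A :: Γ)) :=
  match A with Ex _ _ B => [:: B] | _ => [::] end.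

Lemma consistent_next Γ (A : fm Γ) (H : list (fm Γ)) :
  consistent (A :: H) -> consistent (witness A ++ List.map (fwk (σ := witness_ty A)) (A :: H)).
Proof.
case: A H => *; try exact: consistent_wk.
by apply: consistent_witness => //; left.
Qed.

(** [queue i j] is the [j]-th formula enumerated [i] stages earlier, weakened to the present
    context. Carrying it along replaces any transport of formulas between contexts. *)
Record stage := Stage {
  vars : ctx;
  hyps : list (fm vars);
  queue : nat -> nat -> fm vars }.

Definition enum Γ : nat -> fm Γ := projT1 (cid (fm_enum Γ)).

Lemma enum_surj Γ (A : fm Γ) : exists j, enum Γ j = A.
Proof. by rewrite /enum; case: cid => f /= h; exact: h. Qed.

(** The task [n = (m, j)] is the [j]-th formula of stage [m]. *)
Definition task (n : nat) (s : stage) : fm (vars s) :=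
  let A := queue s (n - (Cantor.of_nat n).1) (Cantor.of_nat n).2 in
  if `[< consistent (A :: hyps s) >] then A else neg A.

Definition next (n : nat) (s : stage) : stage :=
  @Stage (witness_ty (task n s) :: vars s)
    (witness (task n s) ++ List.map (fwk (σ := witness_ty (task n s))) (task n s :: hyps s))
    (fun i j => match i with
                | 0 => enum (witness_ty (task n s) :: vars s) j
                | S i => fwk (queue s i j)
                end).

Variable H0 : list (fm [::]).
Hypothesis H0_consistent : consistent H0.

Fixpoint chain (n : nat) : stage :=
  match n with
  | 0 => @Stage [::] H0 (fun _ j => enum [::] j)
  | S n => next n (chain n)
  end.

Definition stage_vars n := vars (chain n).
Definition thy n : list (fm (stage_vars n)) := hyps (chain n).
Definition new_ty n : ty := witness_ty (task n (chain n)).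

Lemma task_consistent n : consistent (thy n) -> consistent (task n (chain n) :: thy n).
Proof. by rewrite /task; case: asboolP => // h hc; exact: consistent_neg. Qed.

Lemma thy_consistent n : consistent (thy n).
Proof.
by elim: n => //= n /task_consistent; exact: consistent_next.
Qed.

Lemma thy_mono n (A : fm (stage_vars n)) :
  List.In A (thy n) -> List.In (fwk (σ := new_ty n) A) (thy n.+1).
Proof.
move=> h; rewrite /thy /=; apply: List.in_or_app; right; right.
exact: List.in_map.
Qed.

Lemma thy_task n : List.In (fwk (σ := new_ty n) (task n (chain n))) (thy n.+1).
Proof. by rewrite /thy /=; apply: List.in_or_app; right; left. Qed.

Lemma thy_witness n σ (B : fm (σ :: stage_vars n)) : task n (chain n) = Ex σ B ->
  exists y : tm (stage_vars n.+1) σ,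
    List.In (fsub B (scons y (fun _ v => Var (VS v)))) (thy n.+1).
Proof.
rewrite /thy /stage_vars /=; move: (task n (chain n)) => A EA; subst A.
exists (Var VZ); left.
by rewrite -[LHS]fsub_id; congr fsub; apply: vcons_ext.
Qed.

Definition eventually (P : nat -> Prop) := exists N, forall n, N <= n -> P n.

Lemma eventually_and P Q : eventually P -> eventually Q -> eventually (fun n => P n /\ Q n).
Proof.
move=> [N hN] [M hM]; exists (maxn N M) => n; rewrite geq_max => /andP [h h'].
by split; [exact: hN|exact: hM].
Qed.

Lemma eventuallyW (P Q : nat -> Prop) : (forall n, P n -> Q n) -> eventually P -> eventually Q.
Proof. by move=> h [N hN]; exists N => n /hN; exact: h. Qed.

Lemma eventually_le N : eventually (fun n => N <= n).
Proof. by exists N. Qed.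

Lemma eventually_ex P : eventually P -> exists n, P n.
Proof. by case=> N h; exists N; exact: h. Qed.

Definition fcoh (A : forall n, fm (stage_vars n)) :=
  eventually (fun n => A n.+1 = fwk (σ := new_ty n) (A n)).

(** [A N] is some [j]-th formula of stage [N]. The task with code [(N, j)] is met at a stage
    [n >= N], where the queue has weakened it to [A n]. *)
Lemma queue_coh (A : forall n, fm (stage_vars n)) N :
  (forall n, N <= n -> A n.+1 = fwk (σ := new_ty n) (A n)) ->
  exists2 n, N <= n &
    task n (chain n) = if `[< consistent (A n :: thy n) >] then A n else neg (A n).
Proof.
move=> hA; have [j hj] := enum_surj (A N).
pose n := Cantor.to_nat (N, j).
have hn : N <= n.
  have /ssrnat.leP := Cantor.to_nat_non_decreasing N j; apply: leq_trans.
  exact: leq_addl.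
exists n => //; rewrite /task -/n Cantor.cancel_of_to /=.
suff h i : queue (chain (i + N)) i j = A (i + N).
  by have := h (n - N); rewrite subnK // => ->.
elim: i => [|i IH]; first by case: N hA hj {n hn}.
by rewrite addSn hA ?leq_addl // -IH.
Qed.

Definition persistent (A : forall n, fm (stage_vars n)) :=
  eventually (fun n => List.In (A n) (thy n)).

Lemma persistent_intro (A : forall n, fm (stage_vars n)) N :
  (forall n, N <= n -> A n.+1 = fwk (σ := new_ty n) (A n)) ->
  (exists2 n, N <= n & List.In (A n) (thy n)) -> persistent A.
Proof.
move=> hA [n hn hi]; exists n => m; elim: m => [|m IH].
  by rewrite leqn0 => /eqP E; rewrite -E in hi *.
rewrite leq_eqVlt => /orP [/eqP <- //|]; rewrite ltnS => hm.
by rewrite hA ?(leq_trans hn) //; apply: thy_mono; exact: IH.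
Qed.

Lemma persistent_dec A : fcoh A -> persistent A \/ persistent (fun n => neg (A n)).
Proof.
move=> [N hA]; have [n hn ht] := queue_coh hA; have := thy_task n; rewrite ht.
case: asboolP => _ hi; [left|right]; apply: (persistent_intro (N := N)).
- exact: hA.
- by exists n.+1; rewrite ?hA //; exact: leqW.
- by move=> m /hA ->.
- by exists n.+1; [exact: leqW|rewrite hA].
Qed.

Lemma persistent_der A :
  fcoh A -> eventually (fun n => derivable e (thy n) (A n)) -> persistent A.
Proof.
move=> /persistent_dec [//|hN] hd; have [n [hn {}hd]] := eventually_ex (eventually_and hN hd).
by case: (@thy_consistent n); apply: d_imp_e (d_hyp hn) hd.
Qed.

Lemma persistent_neg A : persistent A -> persistent (fun n => neg (A n)) -> False.
Proof.
move=> hA hN; have [n [{}hA {}hN]] := eventually_ex (eventually_and hA hN).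
by case: (@thy_consistent n); apply: d_imp_e (d_hyp hN) (d_hyp hA).
Qed.

(** The witness is available beyond any given [N], so it can be placed after the point from which an
    environment is coherent. *)
Lemma persistent_witness σ (B : forall n, fm (σ :: stage_vars n)) :
  eventually (fun n => B n.+1 = fsub (B n) (sup (fun _ v => Var (@VS _ (new_ty n) _ v)))) ->
  persistent (fun n => Ex σ (B n)) ->
  forall N, exists2 n, N <= n & exists y : tm (stage_vars n.+1) σ,
    List.In (fsub (B n) (scons y (fun _ v => Var (VS v)))) (thy n.+1).
Proof.
move=> [N1 hB] hE N.
have [M hM] := eventually_and (eventually_le N) (eventually_and (eventually_le N1) hE).
have [n hn ht] : exists2 n, M <= n & task n (chain n) =
    if `[< consistent (Ex σ (B n) :: thy n) >] then Ex σ (B n) else neg (Ex σ (B n)).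
  by apply: (queue_coh (A := fun n => Ex σ (B n))) => n /hM [_ [/hB -> _]].
have [h1 [_ h2]] := hM n hn.
exists n => //; apply: thy_witness; rewrite ht; case: asboolP => // -[].
move=> hd; apply: (@thy_consistent n); apply: d_imp_e (d_imp_i hd) (d_hyp h2).
Qed.

End Chain.

(** * Structures and the completeness theorem *)

Record structure := Structure {
  car :> ty -> Type;
  ap : forall σ τ, car (σ ⇒ τ) -> car σ -> car τ;
  cint : forall τ, cst τ -> car τ }.

Definition env (M : structure) (Γ : ctx) := forall τ, var Γ τ -> M τ.

Definition nil_env (M : structure) : env M [::] := @vnil M.

Definition ec (M : structure) Γ σ (x : M σ) (ρ : env M Γ) : env M (σ :: Γ) :=
  vcons (fun τ _ => M τ) x ρ.

Fixpoint eval (M : structure) Γ (ρ : env M Γ) τ (t : tm Γ τ) : M τ :=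
  match t with
  | Var _ v => ρ _ v
  | Cst _ c => cint M c
  | App _ _ s u => ap (eval ρ s) (eval ρ u)
  end.

Fixpoint sat (M : structure) Γ (A : fm Γ) : env M Γ -> Prop :=
  match A with
  | Eq0 _ s t => fun ρ => eval ρ s = eval ρ t
  | Bot _ => fun _ => False
  | And _ A B => fun ρ => sat A ρ /\ sat B ρ
  | Or _ A B => fun ρ => sat A ρ \/ sat B ρ
  | Imp _ A B => fun ρ => sat A ρ -> sat B ρ
  | All _ σ A => fun ρ => forall x : M σ, sat A (ec x ρ)
  | Ex _ σ A => fun ρ => exists x : M σ, sat A (ec x ρ)
  end.

(** Quantifying over [f] and [H] builds closure under substitution and weakening into this
    definition and the next, so both apply directly at each stage of the chain. *)
Definition valid_eq e Γ τ (s t : tm Γ τ) :=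
  forall Δ (f : sub Γ Δ) (H : list (fm Δ)), derivable e H (eqt (tsub f s) (tsub f t)).

Definition valid e Γ (A : fm Γ) :=
  forall Δ (f : sub Γ Δ) (H : list (fm Δ)), derivable e H (fsub A f).

(** The first clause makes provable equations of every type identities of elements. Mere truth of
    [eqt] at a function type is pointwise equality and need not give an identity, in keeping with
    weak extensionality. *)
Definition is_model e (M : structure) : Prop :=
  (forall Γ τ (s t : tm Γ τ) (ρ : env M Γ), valid_eq e s t -> eval ρ s = eval ρ t) /\
  (forall Γ (A : fm Γ) (ρ : env M Γ), valid e A -> sat A ρ).

Lemma derivable_not_all e Γ (H : list (fm Γ)) σ (A : fm (σ :: Γ)) :
  List.In (neg (All σ A)) H -> derivable e H (Ex σ (neg A)).
Proof.
move=> h; apply: d_dne; apply: d_imp_i.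
apply: d_imp_e (d_hyp _) _; first by right; exact: h.
apply: d_all_i; apply: d_dne; apply: d_imp_i.
apply: d_imp_e (d_hyp _) _; first by right; left.
apply: (@d_ex_i _ _ _ _ _ (Var VZ)).
rewrite (_ : finst _ _ = neg A); first by apply: d_hyp; left.
by rewrite -[RHS]finst_var.
Qed.

Lemma derivable_absurd e Γ (A B : fm Γ) (H : list (fm Γ)) :
  List.In (neg A) H -> derivable e (A :: H) B.
Proof.
move=> h; apply: d_bot_e; apply: (@d_imp_e _ _ _ A); apply: d_hyp; last by left.
by right.
Qed.

(** * The term model of the limit theory *)

Section Henkin.
Variables (e : endpoints) (H0 : list (fm [::])).
Hypothesis H0_consistent : consistent e H0.

Notation stage_vars := (stage_vars e H0).
Notation thy := (thy e H0).
Notation new_ty := (new_ty e H0).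

Definition tcoh τ (x : forall n, tm (stage_vars n) τ) :=
  eventually (fun n => x n.+1 = wk (σ := new_ty n) (x n)).

(** Elements of the term model are sequences of terms, one per stage, that are
    eventually related by weakening; no term has to be cast to another context. *)
Definition thread τ := {x : forall n, tm (stage_vars n) τ | tcoh x}.

Definition tenv Γ := forall τ, var Γ τ -> thread τ.

Definition tenv_at Γ (ρ : tenv Γ) n : sub Γ (stage_vars n) := fun _ v => sval (ρ _ v) n.

Definition tcons Γ σ (x : thread σ) (ρ : tenv Γ) : tenv (σ :: Γ) :=
  vcons (fun τ _ => thread τ) x ρ.

Lemma at_tcons Γ σ (x : thread σ) (ρ : tenv Γ) n :
  tenv_at (tcons x ρ) n = scons (sval x n) (tenv_at ρ n).
Proof. by apply: vcons_ext. Qed.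

Lemma at_coh Γ (ρ : tenv Γ) :
  eventually (fun n => tenv_at ρ n.+1 = fun τ v => wk (σ := new_ty n) (tenv_at ρ n v)).
Proof.
elim: Γ ρ => [|σ Γ IH] ρ.
  by exists 0 => n _; exact: vnil_ext.
have [N hN] := eventually_and (svalP (ρ _ VZ)) (IH (fun τ v => ρ _ (VS v))).
exists N => n /hN [h1 h2]; apply: vcons_ext => // τ v.
by move: (f_equal (fun f => f τ v) h2).
Qed.

Lemma tsub_coh Γ (ρ : tenv Γ) τ (t : tm Γ τ) : tcoh (fun n => tsub (tenv_at ρ n) t).
Proof.
have [N hN] := at_coh ρ; exists N => n /hN ->.
by rewrite /wk tsub_comp.
Qed.

Definition tthread Γ (ρ : tenv Γ) τ (t : tm Γ τ) : thread τ :=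
  exist _ _ (tsub_coh ρ t).

Lemma fsub_coh Γ (ρ : tenv Γ) (A : fm Γ) : fcoh (fun n => fsub A (tenv_at ρ n)).
Proof.
have [N hN] := at_coh ρ; exists N => n /hN ->.
by rewrite /fwk fsub_comp.
Qed.

(** The thread starts with weakened dummies, is reset to [t] at stage [m], and is weakened from
    there on. The only cast is along an equation [m = m], which proof irrelevance removes. *)
Lemma thread_of_tm τ m (t : tm (stage_vars m) τ) :
  exists2 x : thread τ, sval x m = t &
    forall n, m <= n -> sval x n.+1 = wk (σ := new_ty n) (sval x n).
Proof.
pose c n (d : tm (stage_vars n) τ) : tm (stage_vars n) τ :=
  if pselect (m = n) is left E then eq_rect m (fun k => tm (stage_vars k) τ) t n E else d.
have cm d : c m d = t.
  by rewrite /c; case: pselect => // E; rewrite (Prop_irrelevance E erefl).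
pose x := nat_rect (fun n => tm (stage_vars n) τ) (c 0 (dummy _ _))
  (fun n xn => c n.+1 (wk (σ := new_ty n) xn)).
have hx n : m <= n -> x n.+1 = wk (σ := new_ty n) (x n).
  move=> hn; rewrite /x /= {1}/c; case: pselect => // E.
  by exfalso; move: hn; rewrite E ltnn.
exists (exist _ x (ex_intro _ m hx)) => //=; rewrite /x.
by case: (m) t c cm {x hx} => [|k] t c cm /=; exact: cm.
Qed.

Definition holds Γ (A : fm Γ) (ρ : tenv Γ) := @persistent e H0 (fun n => fsub A (tenv_at ρ n)).

Lemma holds_der Γ (A : fm Γ) (ρ : tenv Γ) :
  eventually (fun n => derivable e (thy n) (fsub A (tenv_at ρ n))) -> holds A ρ.
Proof. exact/(persistent_der H0_consistent)/fsub_coh. Qed.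

Lemma holds_neg Γ (A : fm Γ) (ρ : tenv Γ) : holds (neg A) ρ <-> ~ holds A ρ.
Proof.
split=> [hn hA|hA]; first exact: (persistent_neg H0_consistent hA hn).
by case: (persistent_dec (fsub_coh ρ A)).
Qed.

Lemma holds_and Γ (A B : fm Γ) ρ : holds (And A B) ρ <-> holds A ρ /\ holds B ρ.
Proof.
split=> [h|[hA hB]].
- by split; apply: holds_der; apply: eventuallyW h => n h;
    [apply: d_and_e1|apply: d_and_e2]; exact: (d_hyp h).
- by apply: holds_der; apply: eventuallyW (eventually_and hA hB) => n [? ?];
    apply: d_and_i; exact: d_hyp.
Qed.

Lemma holds_or Γ (A B : fm Γ) ρ : holds (Or A B) ρ <-> holds A ρ \/ holds B ρ.
Proof.
split=> [h|[hA|hB]].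
- apply: contrapT => /not_orP [/holds_neg hA /holds_neg hB].
  suff : holds (Bot (Γ := Γ)) ρ.
    by case/eventually_ex => n /d_hyp h'; exact: (thy_consistent H0_consistent (h' e)).
  apply: holds_der.
  apply: eventuallyW (eventually_and h (eventually_and hA hB)) => n [h1 [h2 h3]].
  apply: d_or_e (d_hyp h1) _ _.
  + exact: derivable_absurd h2.
  + exact: derivable_absurd h3.
- by apply: holds_der; apply: eventuallyW hA => n h; apply: d_or_i1; exact: d_hyp.
- by apply: holds_der; apply: eventuallyW hB => n h; apply: d_or_i2; exact: d_hyp.
Qed.

Lemma holds_imp Γ (A B : fm Γ) ρ : holds (Imp A B) ρ <-> (holds A ρ -> holds B ρ).
Proof.
split=> [h hA|h].
- by apply: holds_der; apply: eventuallyW (eventually_and h hA) => n [h1 h2];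
    exact: d_imp_e (d_hyp h1) (d_hyp h2).
- have [/h hB|/holds_neg hA] := pselect (holds A ρ).
  + by apply: holds_der; apply: eventuallyW hB => n hn; apply: d_imp_i; apply: d_hyp; right.
  + apply: holds_der; apply: eventuallyW hA => n hn; apply: d_imp_i.
    exact: derivable_absurd hn.
Qed.

Lemma holds_witness Γ σ (A : fm (σ :: Γ)) ρ :
  holds (Ex σ A) ρ -> exists x : thread σ, holds A (tcons x ρ).
Proof.
have [N hN] := at_coh ρ => h.
have hB : eventually (fun n => fsub A (sup (tenv_at ρ n.+1)) =
     fsub (fsub A (sup (tenv_at ρ n))) (sup (fun _ v => Var (@VS _ (new_ty n) _ v)))).
  by exists N => n /hN ->; rewrite fsub_comp sup_comp.
have [n hn [y thy]] := persistent_witness H0_consistent hB h N.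
have [x hx hc] := thread_of_tm y.
exists x; apply: (@persistent_intro _ _ _ n.+1).
- move=> m hm; rewrite !at_tcons hc // hN ?(leq_trans _ hm) ?leqW // /fwk fsub_comp.
  by congr fsub; apply: vcons_ext.
- exists n.+1 => //; rewrite at_tcons hx.
  move: thy; rewrite fsub_comp; congr (List.In (fsub A _) _).
  by apply: vcons_ext => //= τ v; rewrite wk_sub hN.
Qed.

Lemma holds_all Γ σ (A : fm (σ :: Γ)) ρ :
  holds (All σ A) ρ <-> forall x : thread σ, holds A (tcons x ρ).
Proof.
split=> [h x|h].
- apply: holds_der; apply: eventuallyW h => n h; rewrite at_tcons -finst_sup.
  by apply: d_all_e; exact: d_hyp.
- apply: contrapT => /holds_neg hn.
  have [|x /holds_neg] := @holds_witness _ _ (neg A) ρ; last exact.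
  by apply: holds_der; apply: eventuallyW hn => n /derivable_not_all.
Qed.

Lemma holds_ex Γ σ (A : fm (σ :: Γ)) ρ :
  holds (Ex σ A) ρ <-> exists x : thread σ, holds A (tcons x ρ).
Proof.
split=> [|[x h]]; first exact: holds_witness.
apply: holds_der; apply: eventuallyW h => n h; apply: (@d_ex_i _ _ _ _ _ (sval x n)).
by rewrite finst_sup -at_tcons; exact: d_hyp.
Qed.

(** Leibniz equality: it makes application well defined on the quotient, and the
    quantifier-free extensionality rule gives it for all derivable equations. *)
Definition teq τ (x y : thread τ) := eventually (fun n => forall r : tm (τ :: stage_vars n) tN,
  derivable e (thy n) (Eq0 (tsub (scons (sval x n) (sid (Γ := stage_vars n))) r)
                          (tsub (scons (sval y n) (sid (Γ := stage_vars n))) r))).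

Lemma derivable_eq Γ (H : list (fm Γ)) (s t : tm Γ tN) :
  s = t -> derivable e H (Eq0 s t).
Proof. by move=> ->; apply: d_axiom; apply: axiom_WEPA; exact: ax_refl. Qed.

Lemma teq_ext τ (x y : thread τ) : (forall n, sval x n = sval y n) -> teq x y.
Proof. by move=> h; exists 0 => n _ r; apply: derivable_eq; rewrite h. Qed.

Lemma teq_refl τ (x : thread τ) : teq x x.
Proof. exact: teq_ext. Qed.

Lemma teq_sym τ (x y : thread τ) : teq x y -> teq y x.
Proof.
apply: eventuallyW => n h r; apply: d_imp_e (h r).
by apply: d_axiom; apply: axiom_WEPA; exact: ax_sym.
Qed.

Lemma teq_trans τ (x y z : thread τ) : teq x y -> teq y z -> teq x z.
Proof.
move=> h h'; apply: eventuallyW (eventually_and h h') => n [{}h {}h'] r.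
apply: d_imp_e (d_and_i (h r) (h' r)).
by apply: d_axiom; apply: axiom_WEPA; exact: ax_trans.
Qed.

Definition tap σ τ (f : thread (σ ⇒ τ)) (x : thread σ) : thread τ :=
  tthread (tcons f (tcons x (@vnil thread))) (App v0 v1).

(** The function is replaced first and then the argument, by Leibniz equality for the contexts
    [r[z · x]] and [r[g · z]]. *)
Lemma tap_cong σ τ (f g : thread (σ ⇒ τ)) (x y : thread σ) :
  teq f g -> teq x y -> teq (tap f x) (tap g y).
Proof.
move=> hf hx; apply: (@teq_trans _ _ (tap g x)).
- apply: eventuallyW hf => n h r.
  have := h (tsub (scons (App (Var VZ) (wk (sval x n))) (fun _ v => Var (VS v))) r).
  rewrite !tsub_comp; congr (derivable _ _ (Eq0 (tsub _ r) (tsub _ r)));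
    by apply: vcons_ext => //=; rewrite /= wk_inst.
- apply: eventuallyW hx => n h r.
  have := h (tsub (scons (App (wk (sval g n)) (Var VZ)) (fun _ v => Var (VS v))) r).
  rewrite !tsub_comp; congr (derivable _ _ (Eq0 (tsub _ r) (tsub _ r)));
    by apply: vcons_ext => //=; rewrite /= wk_inst.
Qed.

Definition term_model : structure :=
  @Structure (fun τ => quot (@teq τ))
    (fun σ τ f x => cls (@teq τ) (tap (rep f) (rep x)))
    (fun τ c => cls (@teq τ) (tthread (@vnil thread) (Cst c))).

Definition cenv Γ (ρ : tenv Γ) : env term_model Γ := fun τ v => cls (@teq τ) (ρ τ v).

Lemma cls_teq τ (x y : thread τ) : cls (@teq τ) x = cls (@teq τ) y <-> teq x y.
Proof. exact: (cls_eq (@teq_refl τ) (@teq_sym τ) (@teq_trans τ)). Qed.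

Lemma rep_teq τ (x : thread τ) : teq (rep (cls (@teq τ) x)) x.
Proof. exact: (rep_cls (@teq_refl τ) (@teq_sym τ) (@teq_trans τ)). Qed.

Lemma eval_term_model Γ (ρ : tenv Γ) τ (t : tm Γ τ) :
  eval (cenv ρ) t = cls (@teq τ) (tthread ρ t).
Proof.
elim: t => [{}τ v|{}τ c|σ {}τ s Is u Iu].
- by apply/cls_teq; exact: teq_ext.
- by apply/cls_teq; exact: teq_ext.
- change (ap (eval (cenv ρ) s) (eval (cenv ρ) u) = cls (@teq τ) (tthread ρ (App s u))).
  rewrite Is Iu; apply/cls_teq.
  apply: teq_trans (tap_cong (rep_teq _) (rep_teq _)) _.
  exact: teq_ext.
Qed.

Lemma ec_cenv Γ (ρ : tenv Γ) σ (x : thread σ) :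
  ec (cls (@teq σ) x : term_model σ) (cenv ρ) = cenv (tcons x ρ).
Proof. by apply: vcons_ext. Qed.

Lemma holds_eq Γ (s t : tm Γ tN) (ρ : tenv Γ) :
  holds (Eq0 s t) ρ <-> teq (tthread ρ s) (tthread ρ t).
Proof.
split=> h.
- apply: eventuallyW h => n h r.
  apply: (@d_imp_e _ _ _ (Eq0 (tsub (tenv_at ρ n) s) (tsub (tenv_at ρ n) t))); last exact: d_hyp.
  (* The rule forbids open assumptions. The equation, assumed in [thy n], is therefore taken as the
     quantifier-free antecedent of the rule and discharged afterwards. *)
  apply: (@d_qf_er _ _ _ _ tN) => //.
  by apply: d_imp_i; apply: d_hyp; left.
- apply: holds_der; apply: eventuallyW h => n /(_ (Var VZ)); exact.
Qed.

Lemma truth Γ (A : fm Γ) (ρ : tenv Γ) : sat A (cenv ρ) <-> holds A ρ.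
Proof.
elim: A ρ => {Γ} [Γ s t|Γ|Γ A IA B IB|Γ A IA B IB|Γ A IA B IB|Γ σ A IA|Γ σ A IA] ρ /=.
- by rewrite !eval_term_model cls_teq holds_eq.
- split=> // /eventually_ex [n] h; exact: (thy_consistent H0_consistent (d_hyp h)).
- by rewrite IA IB holds_and.
- by rewrite IA IB holds_or.
- by rewrite IA IB holds_imp.
- rewrite holds_all; split=> h x.
  + by have := h (cls (@teq σ) x); rewrite ec_cenv IA.
  + by rewrite -(repK x) ec_cenv IA; exact: h.
- rewrite holds_ex; split=> -[x h].
  + by exists (rep x); rewrite -IA -ec_cenv repK.
  + by exists (cls (@teq σ) x); rewrite ec_cenv IA.
Qed.

Lemma cenv_surj Γ (ρ : env term_model Γ) : exists ρ', ρ = cenv ρ'.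
Proof.
exists (fun τ v => rep (ρ τ v)); apply: vext => τ v.
by rewrite /cenv repK.
Qed.

Lemma term_model_is_model : is_model e term_model.
Proof.
split=> Γ => [τ s t ρ h|A ρ h]; have [{}ρ ->] := cenv_surj ρ.
- rewrite !eval_term_model cls_teq; exists 0 => n _ r.
  (* The equation is derivable outright, so a trivially true antecedent serves for the
     extensionality rule. *)
  apply: (@d_imp_e _ _ _ (Eq0 zero zero)); last exact: derivable_eq.
  apply: (@d_qf_er _ _ _ _ tN) => //.
  by apply: d_imp_i; exact: h.
- by apply/truth; apply: holds_der; exists 0 => n _; exact: h.
Qed.

Lemma term_model_hyps (A : fm [::]) : List.In A H0 -> sat A (@nil_env term_model).
Proof.
move=> hA; have -> : @nil_env term_model = cenv (@vnil thread) by exact: vnil_ext.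
apply/truth; apply: (@persistent_intro _ _ _ 0).
- move=> n _; rewrite /fwk fsub_comp; congr fsub; exact: vnil_ext.
- exists 0 => //; move: hA; rewrite -[A in List.In A _]fsub_id.
  by congr (List.In (fsub A _) _); exact: vnil_ext.
Qed.

End Henkin.

Theorem completeness e (A : fm [::]) :
  (forall M, is_model e M -> sat A (@nil_env M)) -> provable e A.
Proof.
move=> h; apply: contrapT => hA.
have hc : consistent e [:: neg A].
  by move=> hd; apply: hA; apply: d_dne; exact: d_imp_i.
have := term_model_hyps hc (or_introl erefl); apply.
exact: h (term_model_is_model hc).
Qed.

(** * Evaluation in a model *)

Arguments lam : simpl never.
Notation "f @@ x" := (ap f x) (at level 37, left associativity).

Lemma eval_sub (M : structure) Γ Δ (f : sub Γ Δ) (ρ : env M Δ) τ (t : tm Γ τ) :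
  eval ρ (tsub f t) = eval (fun τ v => eval ρ (f τ v)) t.
Proof. by elim: t => //= σ τ' s -> u ->. Qed.

Lemma sat_sub (M : structure) Γ (A : fm Γ) Δ (f : sub Γ Δ) (ρ : env M Δ) :
  sat (fsub A f) ρ <-> sat A (fun τ v => eval ρ (f τ v)).
Proof.
have hE Γ' Δ' (g : sub Γ' Δ') σ (x : M σ) (r : env M Δ') :
    (fun τ v => eval (ec x r) (sup g v)) = ec x (fun τ v => eval r (g τ v)).
  by apply: vcons_ext => // τ v; rewrite /sup /= /wk eval_sub.
elim: A Δ f ρ => {Γ} [Γ s t|Γ|Γ A IA B IB|Γ A IA B IB|Γ A IA B IB|Γ σ A IA|Γ σ A IA] Δ f ρ /=.
- by rewrite !eval_sub.
- by [].
- by rewrite IA IB.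
- by rewrite IA IB.
- by rewrite IA IB.
- by split=> h x; have := h x; rewrite IA hE.
- by split=> -[x h]; exists x; move: h; rewrite IA hE.
Qed.

Record fmodel (e : endpoints) := FModel {
  fmodel_structure :> structure;
  fmodelP : is_model e fmodel_structure }.

Section Model.
Variables (e : endpoints) (M : fmodel e).

Lemma eval_valid_eq Γ τ (s t : tm Γ τ) (ρ : env M Γ) : valid_eq e s t -> eval ρ s = eval ρ t.
Proof. exact: (fmodelP M).1. Qed.

Lemma sat_valid Γ (A : fm Γ) (ρ : env M Γ) : valid e A -> sat A ρ.
Proof. exact: (fmodelP M).2. Qed.

(** A closed axiom is written as a family over all contexts; stability under substitution turns its
    derivability in each context into validity. *)
Lemma sat_axiom (A : forall Γ, fm Γ) :
  (forall Γ, axiom e (A Γ)) -> (forall Γ Δ (f : sub Γ Δ), fsub (A Γ) f = A Δ) ->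
  sat (A [::]) (@nil_env M).
Proof. by move=> hA hs; apply: sat_valid => Δ f H; rewrite hs; exact: d_axiom. Qed.

Local Notation nil := (@nil_env M).

Lemma apK σ τ (x : M σ) (y : M τ) : cint M cK @@ x @@ y = x.
Proof.
apply: (@eval_valid_eq [:: σ; τ] _ (App (App (Cst cK) v0) v1) v0 (ec x (ec y nil))).
by move=> Δ f H; apply: d_axiom; apply: axiom_WEPA; exact: ax_K.
Qed.

Lemma apS δ ρ τ (x : M (δ ⇒ ρ ⇒ τ)) (y : M (δ ⇒ ρ)) (z : M δ) :
  cint M cS @@ x @@ y @@ z = x @@ z @@ (y @@ z).
Proof.
apply: (@eval_valid_eq [:: _; _; _] _ (App (App (App (Cst cS) v0) v1) v2)
  (App (App v0 v2) (App v1 v2)) (ec x (ec y (ec z nil)))).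
by move=> Δ f H; apply: d_axiom; apply: axiom_WEPA; exact: ax_S.
Qed.

Definition rec τ (n : M tN) (a : M τ) (f : M (τ ⇒ tN ⇒ τ)) : M τ :=
  cint M (@cRec [:: τ] τ VZ) @@ n @@ a @@ f.

Definition suc (n : M tN) : M tN := cint M cSucc @@ n.

Lemma rec0 τ (a : M τ) f : rec (cint M cZero) a f = a.
Proof.
apply: (@eval_valid_eq [:: _; _] _ (natrec zero v0 v1) v0 (ec a (ec f nil))).
move=> Δ g H; apply: d_axiom; apply: axiom_WEPA.
exact: (@ax_rec0 _ [:: τ] τ VZ (fun τ v => tsub g (scons v0 (@vnil _) v))
  (scons (tsub g v1) (@vnil _))).
Qed.

Lemma recS τ (n : M tN) (a : M τ) f : rec (suc n) a f = f @@ rec n a f @@ n.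
Proof.
apply: (@eval_valid_eq [:: _; _; _] _ (natrec (App succ v2) v0 v1)
  (App (App v1 (natrec v2 v0 v1)) v2) (ec a (ec f (ec n nil)))).
move=> Δ g H; apply: d_axiom; apply: axiom_WEPA.
exact: (@ax_recS _ [:: τ] τ VZ (tsub g v2) (scons (tsub g v0) (@vnil _))
  (scons (tsub g v1) (@vnil _))).
Qed.

Definition rec2 τ (i : var [:: tN; tN] τ) (n a b : M tN)
    (f g : M (tN ⇒ tN ⇒ tN ⇒ tN)) : M τ :=
  cint M (@cRec [:: tN; tN] τ i) @@ n @@ a @@ b @@ f @@ g.

Lemma rec20 a b f g :
  rec2 VZ (cint M cZero) a b f g = a /\ rec2 (VS VZ) (cint M cZero) a b f g = b.
Proof.
split.
- apply: (@eval_valid_eq [:: _; _; _; _] _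
    (App (App (App (App (App (Cst (@cRec [:: tN; tN] tN VZ)) zero) v0) v1) v2) v3) v0
    (ec a (ec b (ec f (ec g nil))))).
  move=> Δ h H; apply: d_axiom; apply: axiom_WEPA.
  exact: (@ax_rec0 _ [:: tN; tN] tN VZ (scons (tsub h v0) (scons (tsub h v1) (@vnil _)))
    (scons (tsub h v2) (scons (tsub h v3) (@vnil _)))).
- apply: (@eval_valid_eq [:: _; _; _; _] _
    (App (App (App (App (App (Cst (@cRec [:: tN; tN] tN (VS VZ))) zero) v0) v1) v2) v3) v1
    (ec a (ec b (ec f (ec g nil))))).
  move=> Δ h H; apply: d_axiom; apply: axiom_WEPA.
  exact: (@ax_rec0 _ [:: tN; tN] tN (VS VZ) (scons (tsub h v0) (scons (tsub h v1) (@vnil _)))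
    (scons (tsub h v2) (scons (tsub h v3) (@vnil _)))).
Qed.

Lemma rec2S n a b f g :
  rec2 VZ (suc n) a b f g = f @@ rec2 VZ n a b f g @@ rec2 (VS VZ) n a b f g @@ n /\
  rec2 (VS VZ) (suc n) a b f g = g @@ rec2 VZ n a b f g @@ rec2 (VS VZ) n a b f g @@ n.
Proof.
pose r Γ τ (i : var [:: tN; tN] τ) (n a b : tm Γ tN) f g :=
  App (App (App (App (App (Cst (@cRec [:: tN; tN] τ i)) n) a) b) f) g.
split.
- apply: (@eval_valid_eq [:: _; _; _; _; _] _ (r _ _ VZ (App succ v4) v0 v1 v2 v3)
    (App (App (App v2 (r _ _ VZ v4 v0 v1 v2 v3)) (r _ _ (VS VZ) v4 v0 v1 v2 v3)) v4)
    (ec a (ec b (ec f (ec g (ec n nil)))))).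
  move=> Δ h H; apply: d_axiom; apply: axiom_WEPA.
  exact: (@ax_recS _ [:: tN; tN] tN VZ (tsub h v4)
    (scons (tsub h v0) (scons (tsub h v1) (@vnil _)))
    (scons (tsub h v2) (scons (tsub h v3) (@vnil _)))).
- apply: (@eval_valid_eq [:: _; _; _; _; _] _ (r _ _ (VS VZ) (App succ v4) v0 v1 v2 v3)
    (App (App (App v3 (r _ _ VZ v4 v0 v1 v2 v3)) (r _ _ (VS VZ) v4 v0 v1 v2 v3)) v4)
    (ec a (ec b (ec f (ec g (ec n nil)))))).
  move=> Δ h H; apply: d_axiom; apply: axiom_WEPA.
  exact: (@ax_recS _ [:: tN; tN] tN (VS VZ) (tsub h v4)
    (scons (tsub h v0) (scons (tsub h v1) (@vnil _)))
    (scons (tsub h v2) (scons (tsub h v3) (@vnil _)))).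
Qed.

Lemma absE Γ σ τ (t : tm (σ :: Γ) τ) (ρ : env M Γ) (x : M σ) :
  match abs t with
  | inl s => eval ρ s = eval (ec x ρ) t
  | inr s => eval ρ s @@ x = eval (ec x ρ) t
  end.
Proof.
elim: t => [{}τ v|{}τ c|σ' {}τ s Is u Iu] //=.
- move: τ v; apply: vcons => //=.
  by rewrite apS apK.
- by move: Is Iu; case: (abs s) => s'; case: (abs u) => u' /= <- <-;
    rewrite ?apS ?apK.
Qed.

(** [ev] and [cl] are [eval], sealed against unfolding by unification. *)
Lemma ev_sig : {f : forall Γ (ρ : env M Γ) τ, tm Γ τ -> M τ | f = @eval M}.
Proof. by exists (@eval M). Qed.

Definition ev Γ (ρ : env M Γ) τ (t : tm Γ τ) : M τ := sval ev_sig Γ ρ τ t.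

Lemma evE Γ (ρ : env M Γ) τ (t : tm Γ τ) : ev ρ t = eval ρ t.
Proof. by rewrite /ev (svalP ev_sig). Qed.

Lemma cl_sig : {f : forall τ, tm [::] τ -> M τ | f = ev nil}.
Proof. by exists (ev nil). Qed.

Definition cl τ (t : tm [::] τ) : M τ := sval cl_sig τ t.

Lemma clE τ (t : tm [::] τ) : cl t = ev nil t.
Proof. by rewrite /cl (svalP cl_sig). Qed.

Lemma lamE Γ σ τ (t : tm (σ :: Γ) τ) (ρ : env M Γ) (x : M σ) :
  ev ρ (lam t) @@ x = ev (ec x ρ) t.
Proof.
rewrite !evE; have := absE t ρ x; rewrite /lam; case: (abs t) => s //= <-.
by rewrite apK.
Qed.

Lemma natrecE Γ τ (ρ : env M Γ) n (a : tm Γ τ) f :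
  ev ρ (natrec n a f) = rec (ev ρ n) (ev ρ a) (ev ρ f).
Proof. by rewrite ?evE. Qed.

(** The primitive recursive operations are defined in every context at once. The hypothesis holds by
    computation for each of them and reduces all their versions to a single element [cl t]. *)
Lemma eval_closed (τ : ty) (t : forall Γ, tm Γ τ) Γ (ρ : env M Γ) :
  tsub (@vnil (tm Γ)) (t [::]) = t Γ -> ev ρ (t Γ) = cl (t [::]).
Proof.
move=> <-; rewrite clE !evE eval_sub; apply: (f_equal (fun ρ => eval ρ _)).
exact: vnil_ext.
Qed.

Lemma eval_plus Γ (ρ : env M Γ) : ev ρ plus = cl plus.
Proof. exact: (eval_closed (t := @plus) ρ erefl). Qed.
Lemma eval_times Γ (ρ : env M Γ) : ev ρ times = cl times.
Proof. exact: (eval_closed (t := @times) ρ erefl). Qed.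
Lemma eval_minus Γ (ρ : env M Γ) : ev ρ minus = cl minus.
Proof. exact: (eval_closed (t := @minus) ρ erefl). Qed.
Lemma eval_pred Γ (ρ : env M Γ) : ev ρ pred = cl pred.
Proof. exact: (eval_closed (t := @pred) ρ erefl). Qed.
Lemma eval_pow2 Γ (ρ : env M Γ) : ev ρ pow2 = cl pow2.
Proof. exact: (eval_closed (t := @pow2) ρ erefl). Qed.
Lemma eval_cond Γ (ρ : env M Γ) : ev ρ cond = cl cond.
Proof. exact: (eval_closed (t := @cond) ρ erefl). Qed.
Lemma eval_half Γ (ρ : env M Γ) : ev ρ half = cl half.
Proof. exact: (eval_closed (t := @half) ρ erefl). Qed.
Lemma eval_parity Γ (ρ : env M Γ) : ev ρ parity = cl parity.
Proof. exact: (eval_closed (t := @parity) ρ erefl). Qed.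
Lemma eval_search Γ (ρ : env M Γ) : ev ρ search = cl search.
Proof. exact: (eval_closed (t := @search) ρ erefl). Qed.
Lemma eval_triangle Γ (ρ : env M Γ) : ev ρ triangle = cl triangle.
Proof. exact: (eval_closed (t := @triangle) ρ erefl). Qed.
Lemma eval_pair Γ (ρ : env M Γ) : ev ρ pair = cl pair.
Proof. exact: (eval_closed (t := @pair) ρ erefl). Qed.
Lemma eval_proj1 Γ (ρ : env M Γ) : ev ρ proj1 = cl proj1.
Proof. exact: (eval_closed (t := @proj1) ρ erefl). Qed.
Lemma eval_proj2 Γ (ρ : env M Γ) : ev ρ proj2 = cl proj2.
Proof. exact: (eval_closed (t := @proj2) ρ erefl). Qed.
Lemma eval_qpos Γ (ρ : env M Γ) : ev ρ qpos = cl qpos.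
Proof. exact: (eval_closed (t := @qpos) ρ erefl). Qed.
Lemma eval_qneg Γ (ρ : env M Γ) : ev ρ qneg = cl qneg.
Proof. exact: (eval_closed (t := @qneg) ρ erefl). Qed.
Lemma eval_qden Γ (ρ : env M Γ) : ev ρ qden = cl qden.
Proof. exact: (eval_closed (t := @qden) ρ erefl). Qed.
Lemma eval_qmake Γ (ρ : env M Γ) : ev ρ qmake = cl qmake.
Proof. exact: (eval_closed (t := @qmake) ρ erefl). Qed.
Lemma eval_qnat Γ (ρ : env M Γ) : ev ρ qnat = cl qnat.
Proof. exact: (eval_closed (t := @qnat) ρ erefl). Qed.
Lemma eval_qopp Γ (ρ : env M Γ) : ev ρ qopp = cl qopp.
Proof. exact: (eval_closed (t := @qopp) ρ erefl). Qed.
Lemma eval_qabs Γ (ρ : env M Γ) : ev ρ qabs = cl qabs.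
Proof. exact: (eval_closed (t := @qabs) ρ erefl). Qed.
Lemma eval_qadd Γ (ρ : env M Γ) : ev ρ qadd = cl qadd.
Proof. exact: (eval_closed (t := @qadd) ρ erefl). Qed.
Lemma eval_qsub Γ (ρ : env M Γ) : ev ρ qsub = cl qsub.
Proof. exact: (eval_closed (t := @qsub) ρ erefl). Qed.
Lemma eval_qle Γ (ρ : env M Γ) : ev ρ qle = cl qle.
Proof. exact: (eval_closed (t := @qle) ρ erefl). Qed.
Lemma eval_qlt Γ (ρ : env M Γ) : ev ρ qlt = cl qlt.
Proof. exact: (eval_closed (t := @qlt) ρ erefl). Qed.
Lemma eval_qdyadic Γ (ρ : env M Γ) : ev ρ qdyadic = cl qdyadic.
Proof. exact: (eval_closed (t := @qdyadic) ρ erefl). Qed.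
Lemma eval_qhalfpow Γ (ρ : env M Γ) : ev ρ qhalfpow = cl qhalfpow.
Proof. exact: (eval_closed (t := @qhalfpow) ρ erefl). Qed.
Lemma eval_hat Γ (ρ : env M Γ) : ev ρ hat = cl hat.
Proof. exact: (eval_closed (t := @hat) ρ erefl). Qed.
Lemma eval_rconst Γ (ρ : env M Γ) : ev ρ rconst = cl rconst.
Proof. exact: (eval_closed (t := @rconst) ρ erefl). Qed.
Lemma eval_rnat Γ (ρ : env M Γ) : ev ρ rnat = cl rnat.
Proof. exact: (eval_closed (t := @rnat) ρ erefl). Qed.
Lemma eval_radd Γ (ρ : env M Γ) : ev ρ radd = cl radd.
Proof. exact: (eval_closed (t := @radd) ρ erefl). Qed.
Lemma eval_rsub Γ (ρ : env M Γ) : ev ρ rsub = cl rsub.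
Proof. exact: (eval_closed (t := @rsub) ρ erefl). Qed.
Lemma eval_rhalfpow Γ (ρ : env M Γ) : ev ρ rhalfpow = cl rhalfpow.
Proof. exact: (eval_closed (t := @rhalfpow) ρ erefl). Qed.
Lemma eval_cap Γ (ρ : env M Γ) : ev ρ cap = cl cap.
Proof. exact: (eval_closed (t := @cap) ρ erefl). Qed.
Lemma eval_bigcup Γ (ρ : env M Γ) : ev ρ bigcup = cl bigcup.
Proof. exact: (eval_closed (t := @bigcup) ρ erefl). Qed.
Lemma eval_bigcap Γ (ρ : env M Γ) : ev ρ bigcap = cl bigcap.
Proof. exact: (eval_closed (t := @bigcap) ρ erefl). Qed.

#[global] Opaque lam.

Lemma eval_app Γ (ρ : env M Γ) σ τ (s : tm Γ (σ ⇒ τ)) u :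
  ev ρ (App s u) = ev ρ s @@ ev ρ u.
Proof. by rewrite ?evE. Qed.

Lemma eval_cst Γ (ρ : env M Γ) τ (c : cst τ) : ev ρ (Cst c) = cint M c.
Proof. by rewrite evE. Qed.

Lemma eval_succ Γ (ρ : env M Γ) n : ev ρ succ @@ n = suc n.
Proof. by rewrite ?evE. Qed.

Lemma eval_zero Γ (ρ : env M Γ) : ev ρ zero = cint M cZero.
Proof. by rewrite ?evE. Qed.

Lemma eval_one Γ (ρ : env M Γ) : ev ρ one = suc (cint M cZero).
Proof. by rewrite ?evE. Qed.

Lemma eval_two Γ (ρ : env M Γ) : ev ρ two = suc (suc (cint M cZero)).
Proof. by rewrite ?evE. Qed.

Section DeBruijn.
Variables (a b c d f g : ty) (Γ : ctx) (ρ : env M Γ).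
Variables (xa : M a) (xb : M b) (xc : M c) (xd : M d) (xf : M f) (xg : M g).
Lemma eval_v0 : ev (ec xa ρ) v0 = xa. Proof. by rewrite ?evE. Qed.
Lemma eval_v1 : ev (ec xa (ec xb ρ)) v1 = xb. Proof. by rewrite ?evE. Qed.
Lemma eval_v2 : ev (ec xa (ec xb (ec xc ρ))) v2 = xc. Proof. by rewrite ?evE. Qed.
Lemma eval_v3 : ev (ec xa (ec xb (ec xc (ec xd ρ)))) v3 = xd. Proof. by rewrite ?evE. Qed.
Lemma eval_v4 : ev (ec xa (ec xb (ec xc (ec xd (ec xf ρ))))) v4 = xf. Proof. by rewrite ?evE. Qed.
Lemma eval_v5 : ev (ec xa (ec xb (ec xc (ec xd (ec xf (ec xg ρ)))))) v5 = xg.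
Proof. by rewrite ?evE. Qed.
End DeBruijn.

Definition evalE := (@eval_plus,
  @eval_times,
  @eval_minus,
  @eval_pred,
  @eval_pow2,
  @eval_cond,
  @eval_half,
  @eval_parity,
  @eval_search,
  @eval_triangle,
  @eval_pair,
  @eval_proj1,
  @eval_proj2,
  @eval_qpos,
  @eval_qneg,
  @eval_qden,
  @eval_qmake,
  @eval_qnat,
  @eval_qopp,
  @eval_qabs,
  @eval_qadd,
  @eval_qsub,
  @eval_qle,
  @eval_qlt,
  @eval_qdyadic,
  @eval_qhalfpow,
  @eval_hat,
  @eval_rconst,
  @eval_rnat,
  @eval_radd,
  @eval_rsub,
  @eval_rhalfpow,
  @eval_cap,
  @eval_bigcup,
  @eval_bigcap,
  eval_succ, eval_zero, eval_one, eval_two,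
  eval_v0, eval_v1, eval_v2, eval_v3, eval_v4, eval_v5, rec0, recS).

End Model.
Arguments eval : simpl never.

(** The rules for application and abstraction are only tried on syntactic
    matches: up to conversion they would apply to every closed term. *)
Ltac evs := repeat first
  [ match goal with |- context [ap (ev ?r (lam ?t)) ?x] => rewrite (lamE t r x) end
  | match goal with |- context [ev ?r (natrec ?n ?a ?f)] => rewrite (natrecE r n a f) end
  | match goal with |- context [ev ?r (App ?s ?u)] => rewrite (eval_app r s u) end
  | match goal with |- context [ev ?r (Cst ?c)] => rewrite (eval_cst r c) end
  | rewrite evalE ].

(** * Arithmetic in a model *)

Section Induction.
Variables (e : endpoints) (M : fmodel e).
Local Notation nil := (@nil_env M).
Local Notation cl := (cl M).
Local Notation "0" := (cint M cZero).

Lemma nat_ind Γ (A : fm (tN :: Γ)) (ρ : env M Γ) :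
  sat A (ec 0 ρ) -> (forall x, sat A (ec x ρ) -> sat A (ec (suc x) ρ)) ->
  forall x, sat A (ec x ρ).
Proof.
move=> h0 hS.
have h : sat (Imp (And (finst A zero)
    (All tN (Imp A (fsub A (scons (App succ v0) (fun _ v => Var (VS v)))))))
    (All tN A)) ρ.
  apply: sat_valid => Δ f H; apply: d_axiom; apply: axiom_WEPA.
  have E0 : fsub (finst A zero) f = finst (fsub A (sup f)) zero.
    by rewrite finst_sup /finst fsub_comp; congr fsub; exact: vcons_ext.
  have ES : fsub (fsub A (scons (App succ v0) (fun _ v => Var (VS v)))) (sup f) =
      fsub (fsub A (sup f)) (scons (App succ v0) (fun _ v => Var (VS v))).
    rewrite !fsub_comp; congr fsub; apply: vcons_ext => //= τ v.
    by rewrite /sup /= wk_sub.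
  by rewrite /= E0 ES; exact: ax_ind.
apply: h; split=> [|x h]; apply/sat_sub.
- rewrite (_ : (fun _ _ => _) = ec 0 ρ) //; exact: vcons_ext.
- move: (hS x h); rewrite (_ : (fun _ _ => _) = ec (suc x) ρ) //; exact: vcons_ext.
Qed.

(** Induction in the model accepts only formulas with parameters. A function of the metatheory may
    enter one when an element of the model computes it; the closure lemmas below are the combinator
    translation of abstraction. *)
Definition representable τ (F : M tN -> M τ) := exists c : M (tN ⇒ τ), forall x, F x = c @@ x.

Lemma repr_cst τ (a : M τ) : representable (fun=> a).
Proof. by exists (cint M cK @@ a) => x; rewrite apK. Qed.

Lemma repr_id : representable id.
Proof.
by exists (cint M cS @@ cint M cK @@ cint M (@cK tN tN)) => x; rewrite apS apK.
Qed.

Lemma repr_ap σ τ (F : M tN -> M (σ ⇒ τ)) (G : M tN -> M σ) :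
  representable F -> representable G -> representable (fun x => F x @@ G x).
Proof.
move=> [f hf] [g hg]; exists (cint M cS @@ f @@ g) => x.
by rewrite apS hf hg.
Qed.

Lemma repr_suc (F : M tN -> M tN) : representable F -> representable (fun x => suc (F x)).
Proof. by move=> h; apply: repr_ap h; exact: repr_cst. Qed.

Lemma nat_ind_eq (F G : M tN -> M tN) : representable F -> representable G ->
  F 0 = G 0 -> (forall x, F x = G x -> F (suc x) = G (suc x)) -> forall x, F x = G x.
Proof.
move=> [f hf] [g hg] h0 hS x; rewrite hf hg; move: x.
apply: (@nat_ind [:: _; _] (Eq0 (App v1 v0) (App v2 v0)) (ec f (ec g nil))).
- by change (f @@ 0 = g @@ 0); rewrite -hf -hg.
- move=> y; change (f @@ y = g @@ y -> f @@ suc y = g @@ suc y).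
  by rewrite -!hf -!hg; exact: hS.
Qed.

End Induction.

Ltac representable := repeat first
  [ exact: repr_id | exact: repr_cst | apply: repr_suc | apply: repr_ap ].

Tactic Notation "nat_induct" constr(F) constr(G) :=
  apply: (@nat_ind_eq _ _ F G); [by representable|by representable| |].

Section Arithmetic.
Variables (e : endpoints) (M : fmodel e).
Local Notation nil := (@nil_env M).
Local Notation cl := (cl M).
Local Notation "0" := (cint M cZero).

Lemma suc_inj (x y : M tN) : suc x = suc y -> x = y.
Proof.
apply: (@sat_valid _ M [:: _; _] (Imp (Eq0 (App succ v0) (App succ v1)) (Eq0 v0 v1))
  (ec x (ec y nil))).
by move=> Δ f H; apply: d_axiom; apply: axiom_WEPA; exact: ax_succ_inj.
Qed.

Lemma suc_neq0 (x : M tN) : suc x <> 0.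
Proof.
apply: (@sat_valid _ M [:: _] (neg (Eq0 (App succ v0) zero)) (ec x nil)).
by move=> Δ f H; apply: d_axiom; apply: axiom_WEPA; exact: ax_succ_neq0.
Qed.

Lemma natP (x : M tN) : x = 0 \/ exists y, x = suc y.
Proof.
apply: (@nat_ind _ _ [::] (Or (Eq0 v0 zero) (Ex tN (Eq0 v1 (App succ v0)))) nil) => /=.
  by left.
by move=> y _; right; exists y.
Qed.

Local Notation "x +' y" := (cl plus @@ x @@ y) (at level 50, left associativity).
Local Notation "x *' y" := (cl times @@ x @@ y) (at level 40, left associativity).
Local Notation "x -' y" := (cl minus @@ x @@ y) (at level 50, left associativity).

Local Tactic Notation "unfold_op" reference(op) :=
  rewrite clE; unfold op; evs; rewrite ?evE; try reflexivity.

Lemma plus0 x : x +' 0 = x. Proof. by unfold_op plus. Qed.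
Lemma plusS x y : x +' suc y = suc (x +' y). Proof. by unfold_op plus. Qed.
Lemma times0 x : x *' 0 = 0. Proof. by unfold_op times. Qed.
Lemma timesS x y : x *' suc y = x *' y +' x. Proof. by unfold_op times. Qed.
Lemma pred0 : cl pred @@ 0 = 0. Proof. by unfold_op pred. Qed.
Lemma predS x : cl pred @@ suc x = x. Proof. by unfold_op pred. Qed.
Lemma minus0 x : x -' 0 = x. Proof. by unfold_op minus. Qed.
Lemma minusS x y : x -' suc y = cl pred @@ (x -' y). Proof. by unfold_op minus. Qed.
Lemma pow20 : cl pow2 @@ 0 = suc 0. Proof. by unfold_op pow2. Qed.
Lemma pow2S x : cl pow2 @@ suc x = cl pow2 @@ x +' cl pow2 @@ x.
Proof. by unfold_op pow2. Qed.
Lemma cond0 a b : cl cond @@ 0 @@ a @@ b = a. Proof. by unfold_op cond. Qed.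
Lemma condS n a b : cl cond @@ suc n @@ a @@ b = b. Proof. by unfold_op cond. Qed.
Lemma half0 : cl half @@ 0 = 0. Proof. by unfold_op half. Qed.
Lemma halfS n : cl half @@ suc n = n -' cl half @@ n. Proof. by unfold_op half. Qed.
Lemma parity0 : cl parity @@ 0 = 0. Proof. by unfold_op parity. Qed.
Lemma parityS n : cl parity @@ suc n = suc 0 -' cl parity @@ n. Proof. by unfold_op parity. Qed.
Lemma search0 g : cl search @@ g @@ 0 = 0. Proof. by unfold_op search. Qed.
Lemma searchS g n (p := cl search @@ g @@ n) : cl search @@ g @@ suc n =
  cl cond @@ (n -' p) @@ (cl cond @@ (g @@ n) @@ suc n @@ n) @@ p.
Proof. by rewrite /p; unfold_op search. Qed.
Lemma triangle0 : cl triangle @@ 0 = 0. Proof. by unfold_op triangle. Qed.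
Lemma triangleS n : cl triangle @@ suc n = cl triangle @@ n +' suc n.
Proof. by unfold_op triangle. Qed.
Lemma pairE x y : cl pair @@ x @@ y = cl triangle @@ (x +' y) +' x.
Proof. by unfold_op pair. Qed.

Lemma proj0 : cl proj1 @@ 0 = 0 /\ cl proj2 @@ 0 = 0.
Proof.
rewrite !clE; unfold proj1, proj2; evs.
exact: (rec20 0 0 (ev (ec 0 nil) fst_step) (ev (ec 0 nil) snd_step)).
Qed.

Lemma projS n : cl proj1 @@ suc n =
    cl cond @@ (cl proj2 @@ n) @@ 0 @@ suc (cl proj1 @@ n) /\
  cl proj2 @@ suc n =
    cl cond @@ (cl proj2 @@ n) @@ suc (cl proj1 @@ n) @@ (cl pred @@ (cl proj2 @@ n)).
Proof.
have E k : ev (ec k nil) fst_step = cl fst_step /\ ev (ec k nil) snd_step = cl snd_step.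
  by split; apply: eval_closed.
have [E1 E2] := E _ n; have [E1' E2'] := E _ (suc n).
rewrite [cl proj1]clE [cl proj2]clE; unfold proj1, proj2; evs; rewrite E1 E2 E1' E2'.
have [] := rec2S n 0 0 (cl fst_step) (cl snd_step); rewrite /rec2 => h1 h2.
rewrite h1 h2 [X in X @@ _ @@ _ @@ _ = _ /\ _]clE [X in _ /\ X @@ _ @@ _ @@ _ = _]clE.
by unfold fst_step, snd_step; evs.
Qed.

Lemma plus0n x : 0 +' x = x.
Proof.
move: x; nat_induct (fun x => 0 +' x) (fun x : M tN => x); first exact: plus0.
by move=> x E; rewrite plusS E.
Qed.

Lemma plusSn x y : suc x +' y = suc (x +' y).
Proof.
move: y; nat_induct (fun y => suc x +' y) (fun y => suc (x +' y)).
  by rewrite !plus0.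
by move=> y E; rewrite !plusS E.
Qed.

Lemma plusC x y : x +' y = y +' x.
Proof.
move: y; nat_induct (fun y => x +' y) (fun y => y +' x); first by rewrite plus0 plus0n.
by move=> y E; rewrite plusS plusSn E.
Qed.

Lemma plusA x y z : x +' (y +' z) = x +' y +' z.
Proof.
move: z; nat_induct (fun z => x +' (y +' z)) (fun z => x +' y +' z); first by rewrite !plus0.
by move=> z E; rewrite !plusS E.
Qed.

Lemma times0n x : 0 *' x = 0.
Proof.
move: x; nat_induct (fun x => 0 *' x) (fun x : M tN => 0); first by rewrite times0.
by move=> x E; rewrite timesS E plus0.
Qed.

Lemma timesSn x y : suc x *' y = x *' y +' y.
Proof.
move: y; nat_induct (fun y => suc x *' y) (fun y => x *' y +' y); first by rewrite !times0 plus0.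
by move=> y E; rewrite !timesS E !plusS -!plusA (plusC x y).
Qed.

Lemma timesC x y : x *' y = y *' x.
Proof.
move: y; nat_induct (fun y => x *' y) (fun y => y *' x); first by rewrite times0 times0n.
by move=> y E; rewrite timesS timesSn E.
Qed.

Lemma timesDl x y z : (x +' y) *' z = x *' z +' y *' z.
Proof.
move: z; nat_induct (fun z => (x +' y) *' z) (fun z => x *' z +' y *' z).
  by rewrite !times0 plus0.
by move=> z E; rewrite !timesS E !plusA -(plusA (x *' z)) (plusC _ x) plusA.
Qed.

Lemma timesA x y z : x *' (y *' z) = x *' y *' z.
Proof.
move: z; nat_induct (fun z => x *' (y *' z)) (fun z => x *' y *' z); first by rewrite !times0.
by move=> z E; rewrite !timesS -E ![x *' _]timesC timesDl.
Qed.

Lemma times1n x : suc 0 *' x = x.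
Proof. by rewrite timesSn times0n plus0n. Qed.

Definition nat_of : Type := M tN.
HB.instance Definition _ := gen_eqMixin nat_of.
HB.instance Definition _ := gen_choiceMixin nat_of.
HB.instance Definition _ := GRing.isNmodule.Build nat_of plusA plusC plus0n.
Lemma one_neq0 : (suc 0 : nat_of) != 0 :> nat_of.
Proof. by apply/eqP; exact: suc_neq0. Qed.
HB.instance Definition _ := GRing.Nmodule_isComNzSemiRing.Build nat_of
  timesA timesC times1n timesDl times0n one_neq0.

Local Open Scope ring_scope.

Lemma plusE (x y : nat_of) : x +' y = x + y. Proof. by []. Qed.
Lemma timesE (x y : nat_of) : x *' y = x * y. Proof. by []. Qed.
Lemma zeroE : cint M cZero = 0 :> nat_of. Proof. by []. Qed.

Lemma plus_inj (x y z : nat_of) : x + y = x + z -> y = z.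
Proof.
rewrite ![x + _]addrC.
(* Addition is passed as a parameter of the formula, so that the instances below are convertible to
   statements about [cl plus]. *)
apply: (@nat_ind _ _ [:: _; _; _]
  (Imp (Eq0 (App (App v1 v2) v0) (App (App v1 v3) v0)) (Eq0 v2 v3))
  (ec (cl plus) (ec y (ec z nil)))).
  by change (y +' cint M cZero = z +' cint M cZero -> y = z); rewrite !plus0.
move=> {}x; change ((y +' x = z +' x -> y = z) -> y +' suc x = z +' suc x -> y = z).
by rewrite !plusS => h /suc_inj.
Qed.

Lemma plus_total (x y : nat_of) : (exists z, y = x + z) \/ (exists z, x = y + z).
Proof.
move: x y; apply: (@nat_ind _ _ [:: _] (All tN
  (Or (Ex tN (Eq0 v1 (App (App v3 v2) v0))) (Ex tN (Eq0 v2 (App (App v3 v1) v0)))))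
  (ec (cl plus) nil)).
  by move=> y; left; exists y; change (y = cint M cZero +' y); rewrite plus0n.
move=> x; change ((forall y : nat_of, (exists z, y = x +' z) \/ (exists z, x = y +' z)) ->
   (forall y : nat_of, (exists z, y = suc x +' z) \/ (exists z, suc x = y +' z))).
move=> h y; have [->|[{}y ->]] := natP y.
  by right; exists (suc x); rewrite plus0n.
by have [[z ->]|[z ->]] := h y; [left|right]; exists z; rewrite plusSn.
Qed.

Lemma plus_eq0 (x y : nat_of) : x + y = 0 -> x = 0.
Proof.
have [->|[{}y ->]] := natP y; first by rewrite zeroE addr0.
by rewrite -plusE plusS => /suc_neq0.
Qed.

Lemma times_eq0 (x y : nat_of) : x * y = 0 -> x = 0 \/ y = 0.
Proof.
have [->|[{}y ->]] := natP y; first by right.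
have [->|[{}x ->]] := natP x; first by left.
by rewrite -timesE timesS plusS => /suc_neq0.
Qed.

End Arithmetic.

Canonical nat_peano (e : endpoints) (M : fmodel e) : peano :=
  @Peano (nat_of M) (@plus_inj e M) (@plus_total e M) (@plus_eq0 e M) (@times_eq0 e M).

(** * Rationals *)

Section Rationals.
Variables (e : endpoints) (M : fmodel e).
Local Notation nil := (@nil_env M).
Local Notation cl := (cl M).
Local Notation z0 := (cint M cZero).
Local Notation "x +' y" := (cl plus @@ x @@ y) (at level 50, left associativity).
Local Notation "x *' y" := (cl times @@ x @@ y) (at level 40, left associativity).
Local Notation "x -' y" := (cl minus @@ x @@ y) (at level 50, left associativity).
Local Open Scope ring_scope.

Local Notation K := (fractions_of (nat_peano M)).
Definition nv (x : M tN) : K := @frac_of _ K x.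

Lemma nv0 : nv z0 = 0. Proof. exact: frac_of0. Qed.
Lemma nv1 : nv (suc z0) = 1. Proof. exact: frac_of1. Qed.
Lemma nvD x y : nv (x +' y) = nv x + nv y. Proof. exact: frac_ofD. Qed.
Lemma nvM x y : nv (x *' y) = nv x * nv y. Proof. exact: frac_ofM. Qed.
Lemma nvS x : nv (suc x) = nv x + 1.
Proof.
have -> : suc x = x +' suc z0 by rewrite plusS plus0.
by rewrite nvD nv1.
Qed.
Lemma nv_inj x y : nv x = nv y -> x = y. Proof. exact: frac_of_inj. Qed.
Lemma nv_ge0 x : 0 <= nv x. Proof. exact: frac_of_ge0. Qed.
Lemma nv_le x y : nv x <= nv y <-> exists z, y = x +' z. Proof. exact (@frac_of_le _ K x y). Qed.

Lemma minusSS x y : suc x -' suc y = x -' y.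
Proof.
move: y; nat_induct (fun y => suc x -' suc y) (fun y => x -' y).
  by rewrite minusS !minus0 predS.
by move=> y E; rewrite minusS E minusS.
Qed.

Lemma minusDl x z : (x +' z) -' x = z.
Proof.
move: x; nat_induct (fun x => (x +' z) -' x) (fun x : M tN => z).
  by rewrite plus0n minus0.
by move=> y E; rewrite plusSn minusSS.
Qed.

Lemma minus_ge x z : x -' (x +' z) = z0.
Proof.
move: x; nat_induct (fun x => x -' (x +' z)) (fun x : M tN => z0).
  rewrite plus0n; move: z; nat_induct (fun z => z0 -' z) (fun z : M tN => z0).
    by rewrite minus0.
  by move=> z E; rewrite minusS E pred0.
by move=> y E; rewrite plusSn minusSS.
Qed.

(** Discreteness of the numbers, which linear arithmetic over the field cannot see. *)
Lemma nv_leP x y : nv x <= nv y \/ nv y + 1 <= nv x.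
Proof.
have [[z E]|[z E]] := @plus_total e M x y; first by left; apply/nv_le; exists z.
have [Ez|[w Ew]] := natP z.
  by left; rewrite E Ez nvD nv0; lra.
by right; rewrite E Ew nvD nvS; have := nv_ge0 w; lra.
Qed.

(** This gives an inequality the form of an equation, to which induction in the model applies. *)
Lemma minus_eq0 x y : x -' y = z0 <-> nv x <= nv y.
Proof.
split=> [E|/nv_le [z ->]]; last exact: minus_ge.
have [//|h] := nv_leP x y.
have /nv_le [z Ez] : nv y <= nv x by lra.
by move: E; rewrite Ez minusDl => ->; rewrite plus0.
Qed.

Lemma nv_minus x y : nv y <= nv x -> nv (x -' y) = nv x - nv y.
Proof. by move=> /nv_le [z ->]; rewrite minusDl nvD; lra. Qed.

Lemma condP n a b : cl cond @@ n @@ a @@ b = if `[< n = z0 >] then a else b.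
Proof.
case: asboolP => [->|h]; first exact: cond0.
by case: (natP n) => [//|[m ->]]; exact: condS.
Qed.

Lemma suc_pred x : x <> z0 -> suc (cl pred @@ x) = x.
Proof. by case: (natP x) => [//|[y ->]] _; rewrite predS. Qed.

Lemma parity_double x : cl parity @@ (x +' x) = z0.
Proof.
move: x; nat_induct (fun x => cl parity @@ (x +' x)) (fun x : M tN => z0).
  by rewrite plus0 parity0.
move=> x E; rewrite plusS plusSn !parityS E minus0.
by apply/minus_eq0.
Qed.

Lemma parity_doubleS x : cl parity @@ suc (x +' x) = suc z0.
Proof. by rewrite parityS parity_double minus0. Qed.

Lemma half_double x : cl half @@ (x +' x) = x.
Proof.
move: x; nat_induct (fun x => cl half @@ (x +' x)) (fun x : M tN => x).
  by rewrite plus0 half0.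
by move=> x E; rewrite plusS plusSn !halfS E minusDl -plusS minusDl.
Qed.

Lemma two_times x : suc (suc z0) *' x = x +' x.
Proof. by rewrite timesSn times1n. Qed.

Lemma nv_triangle x : nv (cl triangle @@ x) = nv x * (nv x + 1) / 2.
Proof.
(* Doubled, the identity is free of division and can be proved by induction in the model. *)
suff E : cl triangle @@ x +' cl triangle @@ x = x *' suc x.
  have := congr1 nv E; rewrite nvD nvM nvS => h; lra.
move: x; nat_induct (fun x => cl triangle @@ x +' cl triangle @@ x) (fun x => x *' suc x).
  by rewrite triangle0 times0n plus0.
move=> x E; rewrite triangleS; apply: nv_inj.
have := congr1 nv E; rewrite !(nvD, nvM, nvS) => h; lra.
Qed.

(** Write [T] for the triangular numbers and [s], [s'] for the two sums. If [s + 1 <= s'], then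
    [T s + x <= T s + s < T (s + 1) <= T s'], so equal codes have equal sums and hence equal first
    components. *)
Lemma pair_inj x y x' y' : cl pair @@ x @@ y = cl pair @@ x' @@ y' -> x = x' /\ y = y'.
Proof.
rewrite !pairE => /(congr1 nv); rewrite !(nvD, nv_triangle).
have := nv_leP (x +' y) (x' +' y'); have := nv_leP (x' +' y') (x +' y).
have := nv_ge0 x; have := nv_ge0 y; have := nv_ge0 x'; have := nv_ge0 y'; rewrite !nvD.
suff hs : forall a b a' b' : K, 0 <= b' -> 0 <= a' -> 0 <= b -> 0 <= a ->
   a + b + 1 <= a' + b' ->
   (a + b) * (a + b + 1) / 2 + a = (a' + b') * (a' + b' + 1) / 2 + a' -> False.
  move=> h1 h2 h3 h4 [k1|k1] [k2|k2] E.
  - have E' : nv x + nv y = nv x' + nv y' by lra.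
    by move: E; rewrite E' => E; split; apply: nv_inj; lra.
  - by case: (hs _ _ _ _ h3 h4 h1 h2 k2).
  - by case: (hs _ _ _ _ h1 h2 h3 h4 k1 E).
  - by case: (hs _ _ _ _ h1 h2 h3 h4 k1 E).
move=> a b a' b' h1 h2 h3 h4 h5; suff : (a + b) * (a + b + 1) / 2 + a <
  (a' + b') * (a' + b' + 1) / 2 + a' by move=> + E; rewrite E ltxx.
nra.
Qed.

Lemma pair_proj n : cl pair @@ (cl proj1 @@ n) @@ (cl proj2 @@ n) = n.
Proof.
move: n; nat_induct (fun n => cl pair @@ (cl proj1 @@ n) @@ (cl proj2 @@ n)) (fun n : M tN => n).
  by have [-> ->] := proj0 M; rewrite pairE !plus0 triangle0.
move=> n; have [-> ->] := projS n; have [->|[y ->]] := natP (cl proj2 @@ n).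
  rewrite !cond0 !pairE !plus0 !plus0n => E.
  by rewrite triangleS plusS E.
by rewrite !condS predS !pairE !plusS plusSn => ->.
Qed.

Lemma projP x y : cl proj1 @@ (cl pair @@ x @@ y) = x /\ cl proj2 @@ (cl pair @@ x @@ y) = y.
Proof. exact: pair_inj (pair_proj _). Qed.

Definition val (c : M tN) : K :=
  (nv (cl qpos @@ c) - nv (cl qneg @@ c)) / nv (cl qden @@ c).

Lemma qden_gt0 c : 0 < nv (cl qden @@ c).
Proof. by rewrite clE; unfold qden; evs; rewrite nvS; have := nv_ge0 (cl proj2 @@ c); lra. Qed.

Lemma qden_neq0 c : nv (cl qden @@ c) != 0.
Proof. exact: lt0r_neq0 (qden_gt0 c). Qed.

Lemma val_qmake a b d : d <> z0 -> val (cl qmake @@ a @@ b @@ d) = (nv a - nv b) / nv d.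
Proof.
(* [p] is the signed numerator: [2n] when [a - b = n], and [2n + 1] when [b - a = n + 1]. *)
move=> hd; have [p [-> hp]] : exists p,
    cl qmake @@ a @@ b @@ d = cl pair @@ p @@ (cl pred @@ d) /\
    ((exists n, p = n +' n /\ nv n = nv a - nv b) \/
     (exists n, p = suc (n +' n) /\ nv (suc n) = nv b - nv a)).
  rewrite clE; unfold qmake; evs; rewrite condP two_times; case: asboolP => h.
    exists ((a -' b) +' (a -' b)); split=> //; left; exists (a -' b); split=> //.
    by rewrite nv_minus //; exact/minus_eq0.
  have [E|[n E]] := natP (b -' a); first by case: h.
  rewrite two_times E plusS plusSn predS.
  exists (suc (n +' n)); split=> //; right; exists n; split=> //.
  rewrite -E nv_minus //; case: (nv_leP b a) => // k; last lra.
  by case: h; exact/minus_eq0.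
rewrite /val; have [E1 E2] := projP p (cl pred @@ d).
have -> : cl qden @@ (cl pair @@ p @@ (cl pred @@ d)) = d.
  by rewrite clE; unfold qden; evs; rewrite E2 suc_pred.
congr (_ / _).
rewrite ![cl qpos]clE ![cl qneg]clE; unfold qpos, qneg; evs; rewrite E1.
case: hp => -[n [-> En]]; rewrite ?(parity_double, parity_doubleS).
- by rewrite half_double minus0 times1n times0n nv0 En; lra.
- rewrite -plusSn -plusS half_double times1n minusSS minus0 times0n nv0 En; lra.
Qed.

Lemma qden_nz c : cl qden @@ c <> z0.
Proof. by move=> E; have := qden_gt0 c; rewrite E nv0 ltxx. Qed.

Lemma qden_mul_nz c d : cl qden @@ c *' cl qden @@ d <> z0.
Proof. by move=> /(congr1 nv) /eqP; rewrite nvM nv0 mulf_eq0 !(negbTE (qden_neq0 _)). Qed.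

Lemma val_qnat n : val (cl qnat @@ n) = nv n.
Proof.
by rewrite [cl qnat]clE; unfold qnat; evs; rewrite val_qmake ?nv0 ?nv1; [lra|exact: suc_neq0].
Qed.

Lemma val_qopp c : val (cl qopp @@ c) = - val c.
Proof.
rewrite [cl qopp]clE; unfold qopp; evs; rewrite val_qmake; last exact: qden_nz.
by rewrite -mulNr opprB.
Qed.

Lemma val_qadd c d : val (cl qadd @@ c @@ d) = val c + val d.
Proof.
rewrite [cl qadd]clE; unfold qadd; evs; rewrite val_qmake; last exact: qden_mul_nz.
rewrite !(nvD, nvM) /val addf_div ?qden_neq0 //; congr (_ / _); ring.
Qed.

Lemma val_qsub c d : val (cl qsub @@ c @@ d) = val c - val d.
Proof. by rewrite [cl qsub]clE; unfold qsub; evs; rewrite val_qadd val_qopp. Qed.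

(** Parity of the numerator code decides the sign; this is why [qabs] may add the two parts. *)
Lemma qpos_qneg c : nv (cl qpos @@ c) = 0 \/ nv (cl qneg @@ c) = 0.
Proof.
rewrite ![cl qpos]clE ![cl qneg]clE; unfold qpos, qneg; evs; rewrite !nvM.
have [->|[n E]] := natP (cl parity @@ (cl proj1 @@ c)); first by right; rewrite nv0 mul0r.
by left; rewrite E minusSS (_ : z0 -' n = z0) ?nv0 ?mul0r //; apply/minus_eq0; rewrite nv0 nv_ge0.
Qed.

Lemma val_qabs c : val (cl qabs @@ c) = `|val c|.
Proof.
rewrite [cl qabs]clE; unfold qabs; evs; rewrite val_qmake; last exact: qden_nz.
rewrite /val normrM normfV (gtr0_norm (qden_gt0 c)) nvD nv0 subr0; congr (_ / _).
have := nv_ge0 (cl qpos @@ c); have := nv_ge0 (cl qneg @@ c).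
by have [->|->] := qpos_qneg c; rewrite ?subr0 ?sub0r ?add0r ?addr0 ?normrN => ? ?;
  rewrite ger0_norm.
Qed.

Lemma qleP c d : cl qle @@ c @@ d = z0 <-> val c <= val d.
Proof.
rewrite [cl qle]clE; unfold qle; evs; rewrite minus_eq0 !(nvD, nvM) /val.
rewrite ler_pdivrMr ?qden_gt0 // mulrAC ler_pdivlMr ?qden_gt0 //.
split=> h; lra.
Qed.

Lemma qltP c d : cl qlt @@ c @@ d = z0 <-> val c < val d.
Proof.
rewrite [cl qlt]clE; unfold qlt; evs; rewrite ltNge.
have [E|[n E]] := natP (cl qle @@ d @@ c).
- rewrite E minus0; split=> [/suc_neq0 //|]; by move/qleP: E => ->.
- rewrite E minusSS; split=> _.
  + by apply/negP => /qleP; rewrite E; exact: suc_neq0.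
  + by apply/minus_eq0; rewrite nv0 nv_ge0.
Qed.

Lemma pow2_gt0 n : 0 < nv (cl pow2 @@ n).
Proof.
suff : 1 <= nv (cl pow2 @@ n) by lra.
rewrite -nv1; apply/minus_eq0.
move: n; nat_induct (fun n => suc z0 -' cl pow2 @@ n) (fun n : M tN => z0).
  by rewrite pow20 minusSS minus0.
by move=> n /minus_eq0; rewrite nv1 => h; apply/minus_eq0; rewrite nv1 pow2S nvD; lra.
Qed.

(** The exponent may be nonstandard, so this is not an integer power in the field; it is handled
    through the recursion [epS]. *)
Definition ep n : K := (nv (cl pow2 @@ n))^-1.

Lemma ep0 : ep z0 = 1. Proof. by rewrite /ep pow20 nv1 invr1. Qed.
Lemma epS n : ep n = 2 * ep (suc n).
Proof.
rewrite /ep pow2S nvD; have := lt0r_neq0 (pow2_gt0 n); move: (nv _) => p p0.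
have -> : p + p = 2 * p by lra.
by rewrite invfM mulVKf ?pnatr_eq0.
Qed.
Lemma ep_gt0 n : 0 < ep n. Proof. by rewrite invr_gt0 pow2_gt0. Qed.

Lemma val_qdyadic n k : val (cl qdyadic @@ n @@ k) = nv n * ep k.
Proof.
rewrite [cl qdyadic]clE; unfold qdyadic; evs; rewrite val_qmake ?nv0 ?subr0 //.
by move=> E; have := pow2_gt0 k; rewrite E nv0 ltxx.
Qed.

Lemma val_qhalfpow n : val (cl qhalfpow @@ n) = ep n.
Proof. by rewrite [cl qhalfpow]clE; unfold qhalfpow; evs; rewrite val_qdyadic nv1 mul1r. Qed.

End Rationals.

(** * Reals *)

Section Reals.
Variables (e : endpoints) (M : fmodel e).
Local Notation nil := (@nil_env M).
Local Notation cl := (cl M).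
Local Notation z0 := (cint M cZero).
Local Notation "x +' y" := (cl plus @@ x @@ y) (at level 50, left associativity).
Local Notation "x *' y" := (cl times @@ x @@ y) (at level 40, left associativity).
Local Notation "x -' y" := (cl minus @@ x @@ y) (at level 50, left associativity).
Local Open Scope ring_scope.
Local Notation K := (fractions_of (nat_peano M)).

Lemma search_le g n : nv (cl search @@ g @@ n) <= nv n.
Proof.
apply/minus_eq0; move: n.
nat_induct (fun n => cl search @@ g @@ n -' n) (fun n : M tN => z0).
  by rewrite search0 minus0.
move=> n /minus_eq0 h; apply/minus_eq0; rewrite searchS !condP nvS.
case: asboolP => _; last lra.
by case: asboolP => _; rewrite ?nvS; lra.
Qed.

Lemma search_id g : (forall k, g @@ k = z0) -> forall n, cl search @@ g @@ n = n.
Proof.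
move=> hg; nat_induct (fun n => cl search @@ g @@ n) (fun n : M tN => n); first exact: search0.
move=> n E; rewrite searchS E hg cond0 (_ : n -' n = z0) ?cond0 //.
exact/minus_eq0.
Qed.

(** Either the search is stuck, or it has just passed an index where the test succeeds. Hence
    [hat x] converges fast for every [x], as [hv_step] states. *)
Lemma searchS_cases g n : cl search @@ g @@ suc n = cl search @@ g @@ n \/
  [/\ cl search @@ g @@ n = n, cl search @@ g @@ suc n = suc n & g @@ n = z0].
Proof.
rewrite searchS !condP; case: asboolP => [/minus_eq0 h|_]; last by left.
have E : cl search @@ g @@ n = n.
  by apply: nv_inj; apply: le_anti; rewrite h search_le.
by case: asboolP => hg; rewrite E; [right|left].
Qed.

Lemma hatE (x : M t1) : exists2 g : M t1,
  forall n, cl hat @@ x @@ n = x @@ (cl search @@ g @@ n) &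
  forall k, g @@ k = z0 <-> `|val (x @@ k) - val (x @@ suc k)| < ep (suc k).
Proof.
exists (ev (ec z0 (ec x nil))
  (lam (App (App qlt (App qabs (App (App qsub (App v2 v0)) (App v2 (App succ v0)))))
            (App qhalfpow (App succ v0))))).
- by move=> n; rewrite [cl hat]clE; unfold hat; evs; rewrite !evE.
- by move=> k; evs; rewrite qltP val_qabs val_qsub val_qhalfpow.
Qed.

Definition hv (x : M t1) (n : M tN) : K := val (cl hat @@ x @@ n).

Lemma hv_step x n : `|hv x n - hv x (suc n)| < ep (suc n).
Proof.
rewrite /hv; have [g Eg hg] := hatE x; rewrite !Eg.
have [->|[-> -> /hg //]] := searchS_cases g n.
by rewrite subrr normr0 ep_gt0.
Qed.

Lemma hv_id (x : M t1) :
  (forall k, `|val (x @@ k) - val (x @@ suc k)| < ep (suc k)) -> forall n, hv x n = val (x @@ n).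
Proof.
move=> hx n; rewrite /hv; have [g -> hg] := hatE x.
by rewrite search_id // => k; apply/hg.
Qed.

(** [hv_step] telescopes, as [ep i - ep (i + 1) = ep (i + 1)]. The number of steps may be
    nonstandard, so the bound is coded by [qle] and proved by induction in the model. *)
Lemma hv_add x n m : `|hv x n - hv x (n +' m)| <= ep n - ep (n +' m).
Proof.
rewrite /hv -val_qsub -val_qabs -!val_qhalfpow -val_qsub; apply/qleP; move: m.
nat_induct (fun m => cl qle
  @@ (cl qabs @@ (cl qsub @@ (cl hat @@ x @@ n) @@ (cl hat @@ x @@ (n +' m))))
  @@ (cl qsub @@ (cl qhalfpow @@ n) @@ (cl qhalfpow @@ (n +' m)))) (fun m : M tN => z0).
  by apply/qleP; rewrite val_qabs !val_qsub plus0 !subrr normr0.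
move=> m /qleP h; apply/qleP; move: h; rewrite plusS.
rewrite !(val_qabs, val_qsub, val_qhalfpow) -!/(hv _ _) => h.
have := hv_step x (n +' m); rewrite (epS (n +' m)) in h * => h'.
rewrite -(subrKA (hv x (n +' m))); apply: le_trans (ler_normD _ _) _; lra.
Qed.

Lemma hv_near x n m : nv n <= nv m -> `|hv x n - hv x m| <= ep n - ep m.
Proof. by move/nv_le => [k ->]; exact: hv_add. Qed.

Lemma eval_wk Γ (ρ : env M Γ) σ (a : M σ) τ (t : tm Γ τ) : ev (ec a ρ) (wk t) = ev ρ t.
Proof. by rewrite !evE /wk eval_sub. Qed.

Lemma sat_rlt Γ (s t : tm Γ t1) (ρ : env M Γ) :
  sat (rlt s t) ρ <-> exists k, ep k <= hv (ev ρ t) (suc k) - hv (ev ρ s) (suc k).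
Proof.
by split=> -[k hk]; exists k; move: hk; rewrite /= -!evE; evs;
  rewrite !eval_wk qleP val_qhalfpow val_qsub.
Qed.

(** At index [k + 1] the excess is below [ep k]; moving both sides to [n] costs at most
    [2 * ep (k + 1) = ep k] more. *)
Lemma sat_rle Γ (s t : tm Γ t1) (ρ : env M Γ) : sat (rle s t) ρ ->
  forall k n, nv (suc k) <= nv n -> hv (ev ρ s) n <= hv (ev ρ t) n + 2 * ep k.
Proof.
move=> h k n hn.
have {}h : hv (ev ρ s) (suc k) - hv (ev ρ t) (suc k) < ep k.
  by rewrite ltNge; apply/negP => hk; apply: h; apply/sat_rlt; exists k.
have := hv_near (ev ρ s) hn; have := hv_near (ev ρ t) hn; have := ep_gt0 n; have := epS k.
rewrite !ler_norml => ? ? /andP [? ?] /andP [? ?]; lra.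
Qed.

Lemma sat_rlt_ge Γ (s t : tm Γ t1) (ρ : env M Γ) : sat (rlt s t) ρ ->
  exists k, forall n, nv k <= nv n -> hv (ev ρ s) n <= hv (ev ρ t) n.
Proof.
move=> /sat_rlt [k hk]; exists (suc k) => n hn.
have := hv_near (ev ρ s) hn; have := hv_near (ev ρ t) hn; have := ep_gt0 n; have := epS k.
rewrite !ler_norml => ? ? /andP [? ?] /andP [? ?]; lra.
Qed.

Lemma sat_req Γ (s t : tm Γ t1) (ρ : env M Γ) : sat (req s t) ρ ->
  forall k n, nv (suc k) <= nv n -> `|hv (ev ρ s) n - hv (ev ρ t) n| <= 2 * ep k.
Proof.
move=> h k n hn.
have {}h : `|hv (ev ρ s) (suc k) - hv (ev ρ t) (suc k)| < ep k.
  by move: (h k); rewrite /= -!evE; evs; rewrite !eval_wk qltP val_qhalfpow val_qabs val_qsub.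
have := hv_near (ev ρ s) hn; have := hv_near (ev ρ t) hn; have := ep_gt0 n; have := epS k.
move: h; rewrite !ler_norml ltr_norml => /andP [? ?] ? ? /andP [? ?] /andP [? ?].
by apply/andP; split; lra.
Qed.

Lemma hv_rconst q n : hv (cl rconst @@ q) n = val q.
Proof.
have E k : cl rconst @@ q @@ k = q by rewrite clE; unfold rconst; evs.
by rewrite hv_id ?E // => k; rewrite !E subrr normr0 ep_gt0.
Qed.

Lemma hv_rhalfpow k n : hv (cl rhalfpow @@ k) n = ep k.
Proof. by rewrite [cl rhalfpow]clE; unfold rhalfpow; evs; rewrite hv_rconst val_qhalfpow. Qed.

Lemma hv_rnat k n : hv (cl rnat @@ k) n = nv k.
Proof. by rewrite [cl rnat]clE; unfold rnat; evs; rewrite hv_rconst val_qnat. Qed.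

(** Reading both summands one index later halves their steps, so the sum is again fast and [hat]
    leaves it unchanged. *)
Lemma hv_radd x y n : hv (cl radd @@ x @@ y) n = hv x (suc n) + hv y (suc n).
Proof.
have E k : val (cl radd @@ x @@ y @@ k) = hv x (suc k) + hv y (suc k).
  by rewrite [cl radd]clE; unfold radd; evs; rewrite val_qadd.
rewrite hv_id ?E // => k; rewrite !E.
have := hv_step x (suc k); have := hv_step y (suc k); have := epS (suc k).
rewrite !ltr_norml => ? /andP [? ?] /andP [? ?]; apply/andP; split; lra.
Qed.

Lemma hv_rsub x y n : hv (cl rsub @@ x @@ y) n = hv x (suc n) - hv y (suc n).
Proof.
have E k : val (cl rsub @@ x @@ y @@ k) = hv x (suc k) - hv y (suc k).
  by rewrite [cl rsub]clE; unfold rsub; evs; rewrite val_qsub.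
rewrite hv_id ?E // => k; rewrite !E.
have := hv_step x (suc k); have := hv_step y (suc k); have := epS (suc k).
rewrite !ltr_norml => ? /andP [? ?] /andP [? ?]; apply/andP; split; lra.
Qed.

(** Read off from [hv_add] for a constant sequence, whose left side is zero. *)
Lemma ep_le n m : nv n <= nv m -> ep m <= ep n :> K.
Proof.
move=> /nv_le [k ->]; have := hv_add (cl rconst @@ z0) n k.
by rewrite !hv_rconst subrr normr0 subr_ge0.
Qed.

End Reals.

(** * Events and probabilities *)

Section Events.
Variables (e : endpoints) (M : fmodel e).
Local Notation nil := (@nil_env M).
Local Notation cl := (cl M).
Local Notation z0 := (cint M cZero).
Local Notation "x +' y" := (cl plus @@ x @@ y) (at level 50, left associativity).
Local Notation "x *' y" := (cl times @@ x @@ y) (at level 40, left associativity).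
Local Notation "x -' y" := (cl minus @@ x @@ y) (at level 50, left associativity).
Local Open Scope ring_scope.
Local Notation K := (fractions_of (nat_peano M)).

Definition emem (x : M tO) (A : M tS) : Prop := cint M cIn @@ x @@ A = z0.
Definition ecompl (A : M tS) : M tS := cint M cCompl @@ A.
Definition ecup (A B : M tS) : M tS := cint M cCup @@ A @@ B.

Lemma emem_empty x : ~ emem x (cint M cEmpty).
Proof.
have h := @sat_axiom e M (fun Γ => All tO (v0 ∉ emptyset))%fm
  (fun _ => axiom_F ax_in_empty) (fun _ _ _ => erefl).
exact: (h x).
Qed.

Lemma emem_cup x A B : emem x (ecup A B) <-> emem x A \/ emem x B.
Proof.
have h := @sat_axiom e M (fun Γ => All tO (All tS (All tS
    (v2 ∈ cup · v1 · v0 <-> (v2 ∈ v1 \/ v2 ∈ v0)))))%fm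
  (fun _ => axiom_F ax_in_cup) (fun _ _ _ => erefl).
by have [] := h x A B.
Qed.

Lemma emem_compl x A : emem x (ecompl A) <-> ~ emem x A.
Proof.
have h := @sat_axiom e M (fun Γ => All tO (All tS (v1 ∈ compl · v0 <-> v1 ∉ v0)))%fm
  (fun _ => axiom_F ax_in_compl) (fun _ _ _ => erefl).
by have [] := h x A.
Qed.

Definition ecap (A B : M tS) : M tS := cl cap @@ A @@ B.

Lemma emem_cap x A B : emem x (ecap A B) <-> emem x A /\ emem x B.
Proof.
have -> : ecap A B = ecompl (ecup (ecompl A) (ecompl B)).
  by rewrite /ecap clE; unfold cap, compl, cup; evs.
rewrite emem_compl emem_cup !emem_compl.
by split=> [/not_orP[/contrapT ? /contrapT]|[? ?] []].
Qed.

Definition prob (A : M tS) (n : M tN) : K := hv (cint M cProb @@ A) n.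

Lemma prob_bounds A k n : nv (suc k) <= nv n -> - (2 * ep k) <= prob A n <= 1 + 2 * ep k.
Proof.
move=> hn; have h := @sat_axiom e M (fun Γ => All tS
    (rle (rnat · zero) (Pr · v0) /\ rle (Pr · v0) (rnat · one)))%fm
  (fun _ => axiom_Pr ax_Pr_bounds) (fun _ _ _ => erefl).
have [h0 h1] := h A.
have := sat_rle h0 hn; have := sat_rle h1 hn.
unfold Pr; evs; rewrite !hv_rnat nv0 nv1 -/(prob A n) => ? ?.
by apply/andP; split; lra.
Qed.

(** If [Pr B < Pr A], the last axiom on [Pr] provides a point of [A] outside [B], which inclusion
    excludes. *)
Lemma prob_mono A B k n : (forall x, emem x A -> emem x B) ->
  nv (suc k) <= nv n -> prob A n <= prob B n + 2 * ep k.
Proof.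
move=> hAB hn; have h := @sat_axiom e M (fun Γ => All tS (All tS (Ex tO
      (rlt (Pr · v1) (Pr · v2) ⊃ v0 ∈ v2 /\ v0 ∉ v1))))%fm
  (fun _ => axiom_Pr ax_Pr_mono) (fun _ _ _ => erefl).
have [x hx] := h A B.
have hle : sat (rle (Pr · v1) (Pr · v0))%fm (ec B (ec A nil)).
  move=> /sat_rlt [j hj].
  have [] : emem x A /\ ~ emem x B.
    by apply: hx; apply/sat_rlt; exists j; move: hj; unfold Pr; evs.
  by move=> /hAB.
by have := sat_rle hle hn; unfold Pr; evs.
Qed.

(** The real equation costs [2 * ep k]. [rsub] and [radd] read [A] and [B] at [n + 2] and the
    intersection at [n + 1]; moving these back to [n] costs at most another [ep k]. *)
Lemma prob_cup A B k n : nv (suc k) <= nv n ->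
  `|prob (ecup A B) n + prob (ecap A B) n - prob A n - prob B n| <= 4 * ep k.
Proof.
move=> hn; have h := @sat_axiom e M (fun Γ => All tS (All tS
      (req (Pr · (cup · v1 · v0))
           (rsub · (radd · (Pr · v1) · (Pr · v0)) · (Pr · (cap · v1 · v0))))))%fm
  (fun _ => axiom_Pr ax_Pr_cup) (fun _ _ _ => erefl).
have := sat_req (h A B) hn; unfold Pr, cup; evs.
rewrite hv_rsub hv_radd -/(ecup A B) -/(ecap A B).
have hS (m : M tN) : nv m <= nv (suc m) by rewrite nvS; lra.
have hA := hv_near (cint M cProb @@ A) (hS n).
have hA' := hv_near (cint M cProb @@ A) (hS (suc n)).
have hB := hv_near (cint M cProb @@ B) (hS n).
have hB' := hv_near (cint M cProb @@ B) (hS (suc n)).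
have hC := hv_near (cint M cProb @@ ecap A B) (hS n).
have hE := ep_le hn.
move: hA hA' hB hB' hC; have := epS n; have := epS (suc n); have := epS k.
have := ep_gt0 (suc (suc n)).
rewrite /prob !ler_norml.
move=> ? ? ? ? /andP [? ?] /andP [? ?] /andP [? ?] /andP [? ?] /andP [? ?] /andP [? ?].
by apply/andP; split; lra.
Qed.

End Events.

(** * The convergence theorem *)

Section Convergence.
Variables (e : endpoints) (M : fmodel e).
Local Notation nil := (@nil_env M).
Local Notation cl := (cl M).
Local Notation z0 := (cint M cZero).
Local Notation "x +' y" := (cl plus @@ x @@ y) (at level 50, left associativity).
Local Notation "x *' y" := (cl times @@ x @@ y) (at level 40, left associativity).
Local Notation "x -' y" := (cl minus @@ x @@ y) (at level 50, left associativity).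
Local Open Scope ring_scope.
Local Notation K := (fractions_of (nat_peano M)).

(** This serves inductions that run only up to a bound, with [F m = z0] expressing [m <= b]. *)
Lemma nat_ind_imp (F G : M tN -> M tN) : representable F -> representable G ->
  (F z0 = z0 -> G z0 = z0) ->
  (forall m, (F m = z0 -> G m = z0) -> F (suc m) = z0 -> G (suc m) = z0) ->
  forall m, F m = z0 -> G m = z0.
Proof.
move=> [f hf] [g hg] h0 hS m; rewrite hf hg; move: m.
apply: (@nat_ind _ _ [:: _; _] (Eq0 (v1 · v0) zero ⊃ Eq0 (v2 · v0) zero)%fm (ec f (ec g nil))).
- by change (f @@ z0 = z0 -> g @@ z0 = z0); rewrite -hf -hg.
- move=> m; change ((f @@ m = z0 -> g @@ m = z0) -> f @@ suc m = z0 -> g @@ suc m = z0).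
  by rewrite -!hf -!hg; exact: hS.
Qed.

Lemma emem_bigcup (A : M (tN ⇒ tS)) n m x : emem x (cl bigcup @@ A @@ n @@ m) <->
  exists i, [/\ nv n <= nv i, nv i <= nv m & emem x (A @@ i)].
Proof.
have [f hf ->] : exists2 f, forall s i, f @@ s @@ i = ecup s (A @@ (n +' i)) &
    cl bigcup @@ A @@ n @@ m = rec (suc m -' n) (cint M cEmpty) f.
  exists (ev (ec m (ec n (ec A nil))) (lam (lam (cup · v1 · (v4 · (plus · v3 · v0)))))).
    by move=> s i; unfold cup; evs.
  by rewrite [cl bigcup]clE; unfold bigcup, emptyset; evs.
have [u hu] : representable (fun k => rec k (cint M cEmpty) f) by rewrite /rec; representable.
have [a ha] : representable (fun i => A @@ (n +' i)) by representable.
(* A term for [i < k]: it lets the invariant, that [k] steps have collected the [A (n + i)] with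
   [i < k], be a formula. *)
pose lt := ev nil (lam (lam (minus · (succ · v1) · v0))).
have hlt i k : lt @@ i @@ k = z0 <-> nv i + 1 <= nv k.
  by rewrite /lt; evs; rewrite minus_eq0 nvS.
have h k : (emem x (u @@ k) -> exists i, lt @@ i @@ k = z0 /\ emem x (a @@ i)) /\
    ((exists i, lt @@ i @@ k = z0 /\ emem x (a @@ i)) -> emem x (u @@ k)).
  move: k; apply: (@nat_ind _ _ [:: _; _; _; _]
    (v1 ∈ v2 · v0 <-> Ex tN (v5 · v0 · v1 ≈ zero /\ v2 ∈ v4 · v0))%fm
    (ec x (ec u (ec a (ec lt nil))))).
    change ((emem x (u @@ z0) -> exists i, lt @@ i @@ z0 = z0 /\ emem x (a @@ i)) /\
    ((exists i, lt @@ i @@ z0 = z0 /\ emem x (a @@ i)) -> emem x (u @@ z0))).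
    rewrite -hu rec0; split=> [/emem_empty //|[i [/hlt]]].
    by rewrite nv0; have := nv_ge0 i => h1 h2; exfalso; lra.
  move=> k; change ((emem x (u @@ k) -> exists i, lt @@ i @@ k = z0 /\ emem x (a @@ i)) /\
    ((exists i, lt @@ i @@ k = z0 /\ emem x (a @@ i)) -> emem x (u @@ k)) ->
   (emem x (u @@ suc k) -> exists i, lt @@ i @@ suc k = z0 /\ emem x (a @@ i)) /\
    ((exists i, lt @@ i @@ suc k = z0 /\ emem x (a @@ i)) -> emem x (u @@ suc k))).
  rewrite -!hu recS hf emem_cup => -[h1 h2]; split.
    move=> [/h1 [i [/hlt hi hx]]|hx].
      by exists i; split=> //; apply/hlt; rewrite nvS; lra.
    by exists k; split; [apply/hlt; rewrite nvS|rewrite -ha].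
  move=> [i [/hlt]]; rewrite nvS => hi hx.
  have [hik|hik] := nv_leP k i.
    have E : i = k by apply: nv_inj; apply: le_anti; apply/andP; split; lra.
    by right; rewrite ha -E.
  by left; apply: h2; exists i; split=> //; apply/hlt.
rewrite hu; split.
- move=> /(h _).1 [i [/hlt hi]]; rewrite -ha => hx; exists (n +' i).
  (* If [n] exceeded [m + 1], truncated subtraction would give zero steps and the union would be
     empty. *)
  have hnm : nv n <= nv (suc m).
    have [//|k1] := nv_leP n (suc m).
    have E : suc m -' n = z0 by apply/minus_eq0; lra.
    by move: hi; rewrite E nv0; have := nv_ge0 i => ? ?; exfalso; lra.
  move: hi; rewrite nv_minus // nvS => hi.
  by split=> //; rewrite nvD; have := nv_ge0 i; lra.
- move=> [i [h1 h2 hx]]; apply/(h _).2; move/nv_le: (h1) => [j Ej]; subst i.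
  by exists j; rewrite -ha; split=> //; apply/hlt; rewrite nv_minus nvS;
    move: h1 h2; rewrite nvD => ? ?; lra.
Qed.

Lemma emem_bigcap (A : M (tN ⇒ tS)) n m x : emem x (cl bigcap @@ A @@ n @@ m) <->
  forall i, nv n <= nv i -> nv i <= nv m -> emem x (A @@ i).
Proof.
rewrite [cl bigcap]clE; unfold bigcap, compl; evs.
rewrite -/(ecompl _) emem_compl emem_bigcup; split.
- move=> h i h1 h2; apply: contrapT => hx; apply: h; exists i; split=> //.
  by evs; rewrite -/(ecompl _) emem_compl.
- by move=> h [i [h1 h2]]; evs; rewrite -/(ecompl _) emem_compl; apply; exact: h.
Qed.

(** If every value could be exceeded by more than [ep L], induction in the model would give, for
    each [i], a value at least [i * ep L - 1]. For [i = 4 * 2^L] this is 3, above the bound 2. *)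
Lemma bounded_sup (q : M t1) L : (forall d, -1 <= val (q @@ d) <= 2) ->
  exists c, forall d, val (q @@ d) <= val (q @@ c) + ep L.
Proof.
move=> hq; apply: contrapT => hn.
have {}hn c : exists d, val (q @@ c) + ep L < val (q @@ d).
  apply: contrapT => hd; apply: hn; exists c => d; rewrite leNgt; apply/negP => h.
  by apply: hd; exists d.
have [dy hdy] : representable (fun i => cl qdyadic @@ i @@ L) by representable.
have [q' hq'] : representable (fun c => cl qadd @@ (q @@ c) @@ (cl qnat @@ suc z0)).
  by representable.
have hle i c : cl qle @@ (dy @@ i) @@ (q' @@ c) = z0 <-> nv i * ep L <= val (q @@ c) + 1.
  by rewrite qleP -hdy -hq' val_qdyadic val_qadd val_qnat nv1.
have h i : exists c, cl qle @@ (dy @@ i) @@ (q' @@ c) = z0.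
  move: i; apply: (@nat_ind _ _ [:: _; _; _] (Ex tN (v4 · (v2 · v1) · (v3 · v0) ≈ zero))%fm
    (ec dy (ec q' (ec (cl qle) nil)))).
    change (exists c, cl qle @@ (dy @@ z0) @@ (q' @@ c) = z0).
    exists z0; apply/hle; rewrite nv0 mul0r; have /andP [? ?] := hq z0; lra.
  move=> i; change ((exists c, cl qle @@ (dy @@ i) @@ (q' @@ c) = z0) ->
     exists c, cl qle @@ (dy @@ suc i) @@ (q' @@ c) = z0).
  move=> [c /hle hc]; have [d hd] := hn c; exists d; apply/hle; rewrite nvS mulrDl mul1r; lra.
have [c /hle] := h (cl pow2 @@ L *' suc (suc (suc (suc z0)))).
rewrite nvM !nvS nv0 /ep mulrAC mulfV ?mul1r; last exact: lt0r_neq0 (pow2_gt0 L).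
by have /andP [? ?] := hq c; lra.
Qed.

(** Dependent choice for a relation that ignores the previous value. *)
Definition dc_formula Γ : fm ((tN ⇒ tN ⇒ tN ⇒ tN) :: Γ) :=
  @DC _ [:: tN] (All tN (v4 · v3 · v1 · v0 ≈ zero))%fm.

Lemma choice_fun (r : M (tN ⇒ tN ⇒ tN ⇒ tN)) :
  (forall m, exists c, forall d, r @@ m @@ c @@ d = z0) ->
  exists f : M t1, forall m d, r @@ m @@ (f @@ m) @@ d = z0.
Proof.
move=> hr.
have h : sat (All (tN ⇒ tN ⇒ tN ⇒ tN) (dc_formula [::])) nil.
  apply: sat_valid => Δ f H; change (derivable e H (All (tN ⇒ tN ⇒ tN ⇒ tN) (dc_formula Δ))).
  by apply: d_all_i; apply: d_axiom; apply: axiom_choice; exact: ax_DC.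
(* Dependent choice puts the value chosen for [x] at [f (x + 1)], hence the shift to [f'] below. *)
have [f hf] : exists f : M t1, forall x d, r @@ x @@ (f @@ suc x) @@ d = z0.
  by apply: (h r) => x y; have [c hc] := hr x; exists c.
have [f' hf'] : representable (fun x => f @@ suc x) by representable.
by exists f' => m d; rewrite -hf'.
Qed.

(** Since [U] contains [C ∪ E] and is hardly larger than [E], modularity gives Pr(C ∩ E) >= Pr C -
    eps; applied to [C ∩ D] and [C ∩ E] inside [C], it gives Pr(C ∩ D ∩ E) >= Pr(C ∩ D) - eps. Two
    uses of [prob_cup] and three of [prob_mono] cost [14 * ep j], rounded up to 20. *)
Lemma prob_split (C D D' E U : M tS) n j (s eps : K) : nv (suc j) <= nv n ->
  (forall x, emem x C -> emem x D -> emem x E -> emem x D') ->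
  (forall x, emem x C \/ emem x E -> emem x U) ->
  prob C n <= prob (ecap C D) n + s -> prob U n <= prob E n + eps ->
  prob C n <= prob (ecap C D') n + s + eps + 20 * ep j.
Proof.
move=> hn hD' hU hs heps.
have h1 : prob (ecup C E) n <= prob U n + 2 * ep j.
  by apply: prob_mono hn => x /emem_cup; exact: hU.
have h2 : prob (ecup (ecap C D) (ecap C E)) n <= prob C n + 2 * ep j.
  by apply: prob_mono hn => x /emem_cup [] /emem_cap [].
have h3 : prob (ecap (ecap C D) (ecap C E)) n <= prob (ecap C D') n + 2 * ep j.
  apply: prob_mono hn => x /emem_cap [/emem_cap [? ?] /emem_cap [_ ?]].
  by apply/emem_cap; split=> //; exact: hD'.
have := prob_cup C E hn; have := prob_cup (ecap C D) (ecap C E) hn; have := ep_gt0 j.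
rewrite !ler_norml => ? /andP [? ?] /andP [? ?]; lra.
Qed.

(** * The measure-theoretic core, for an abstract double sequence of events *)

Section Core.
Variables (k : M tN) (B : M (tN ⇒ tN ⇒ tS)).
Hypothesis B_mono : forall x m c m' c', nv m' <= nv m -> nv c <= nv c' ->
  emem x (B @@ m @@ c) -> emem x (B @@ m' @@ c').
(** [U] here and [D] below will be values of the terms in the two convergence statements. They are
    tied to [B] only through their members, since equality of members does not give identity of
    events in the model. *)
Hypothesis B_large : forall b, exists c U,
  (forall x, emem x U <-> emem x (B @@ b @@ c)) /\
  exists n0, forall n, nv n0 <= nv n -> ep k <= prob U n.
Hypothesis B_small : forall F : M t1, exists b D,
  (forall x, emem x D <-> forall m, nv m <= nv b -> emem x (B @@ m @@ (F @@ m))) /\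
  forall j n, nv (suc j) <= nv n -> prob D n <= ep (suc k) + 2 * ep j.

(** Choice is applied at the fixed index [N m = k + m + 8], where the comparison is a term. The
    slack there is [ep (k + m + 6)], and moving to [n] adds at most [2 * ep (N m)], half as much
    again; together this is below [ep (k + m + 5)]. *)
Lemma almost_sup : exists F : M t1, forall m d n,
  nv k + nv m + 8 <= nv n ->
  prob (B @@ m @@ d) n <= prob (B @@ m @@ (F @@ m)) n + ep (suc (suc (suc (suc (suc (k +' m)))))).
Proof.
pose t m := k +' m; pose t6 m := suc (suc (suc (suc (suc (suc (t m)))))).
pose N m := suc (suc (t6 m)).
have [r hr] : exists r : M (tN ⇒ tN ⇒ tN ⇒ tN), forall m c d, r @@ m @@ c @@ d = z0 <->
    prob (B @@ m @@ d) (N m) <= prob (B @@ m @@ c) (N m) + ep (t6 m).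
  exists (ev (ec B (ec k nil)) (lam (lam (lam (qle
    · (hat · (Pr · (v3 · v2 · v0))
           · (succ · (succ · (succ · (succ · (succ · (succ · (succ · (succ
             · (plus · v4 · v2))))))))))
    · (qadd · (hat · (Pr · (v3 · v2 · v1))
           · (succ · (succ · (succ · (succ · (succ · (succ · (succ · (succ
             · (plus · v4 · v2))))))))))
        · (qhalfpow · (succ · (succ · (succ · (succ · (succ · (succ
             · (plus · v4 · v2)))))))))))))).
  by move=> m c d; unfold Pr; evs; rewrite qleP val_qadd val_qhalfpow.
have hN m : ep (N m) = ep (t6 m) / 4 :> K.
  by have := epS (suc (t6 m)); have := epS (t6 m); rewrite /N => -> ->; lra.
have [F hF] : exists F : M t1, forall m d, r @@ m @@ (F @@ m) @@ d = z0.
  apply: choice_fun => m.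
  have [q hq] : representable (fun d => cl hat @@ (cint M cProb @@ (B @@ m @@ d)) @@ N m).
    by representable.
  have [|c hc] := @bounded_sup q (t6 m).
    move=> d; rewrite -hq -/(hv _ _) -/(prob _ _).
    (* From index 2 on, approximations of probabilities are off by at most [2 * ep 1 = 1], whence
       the bounds -1 and 2 in [bounded_sup]. *)
    have h1 : nv (suc (suc z0)) <= nv (N m).
      by rewrite !nvS nv0; have := nv_ge0 (t m); lra.
    have := prob_bounds (B @@ m @@ d) h1; have := epS z0; rewrite ep0 => ? /andP [? ?].
    by apply/andP; split; lra.
  by exists c => d; apply/hr; have := hc d; rewrite -!hq.
exists F => m d n hn.
have hNn : nv (N m) <= nv n by rewrite !nvS nvD; lra.
have /hr h := hF m d.
have := hv_near (cint M cProb @@ (B @@ m @@ d)) hNn.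
have := hv_near (cint M cProb @@ (B @@ m @@ (F @@ m))) hNn.
move: h; rewrite hN /prob !ler_norml; have := epS (suc (suc (suc (suc (suc (t m)))))).
have := ep_gt0 n; rewrite -/(t6 m) -/(t m) => ? ? ? /andP [? ?] /andP [? ?].
lra.
Qed.

Lemma core_false : False.
Proof.
have [F hF] := almost_sup; have [b [D [hD hDk]]] := B_small F.
have [c [C [hC [n0 hn0]]]] := B_large b.
(* The loss allowed at step [m]. The losses up to [m] sum to [ep (k + 2) - E m], the form in which
   [claim] carries them. *)
pose E m : K := ep (suc (suc (suc (k +' m)))).
pose j := suc (suc (suc (suc (suc (suc (suc (suc (k +' b)))))))).
pose n := suc j +' n0.
have hjn : nv (suc j) <= nv n by rewrite nvD; have := nv_ge0 n0; lra.
have hEb : ep j = E b / 32.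
  have := epS (suc (suc (suc (k +' b)))); have := epS (suc (suc (suc (suc (k +' b))))).
  have := epS (suc (suc (suc (suc (suc (k +' b)))))).
  have := epS (suc (suc (suc (suc (suc (suc (k +' b))))))).
  have := epS (suc (suc (suc (suc (suc (suc (suc (k +' b)))))))).
  by rewrite /E /j => ? ? ? ? ?; lra.
have hE m : nv m <= nv b -> E b <= E m.
  by move=> h; apply: ep_le; rewrite !nvS !nvD; lra.
have hES m : E m = 2 * E (suc m) by rewrite /E plusS -epS.
have hE0 : ep (suc (suc k)) = 2 * E z0 by rewrite /E plus0 -epS.
(* As [b] may be nonstandard, the partial intersections are formed inside the model, from an element
   enumerating the events. *)
pose G := ev (ec B (ec F nil)) (lam (v1 · v0 · (v2 · v0))).
have hG m : G @@ m = B @@ m @@ (F @@ m) by rewrite /G; evs.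
pose Dm m := cl bigcap @@ G @@ z0 @@ m.
have hDm x m : emem x (Dm m) <-> forall i, nv i <= nv m -> emem x (B @@ i @@ (F @@ i)).
  rewrite emem_bigcap nv0; split=> h i; first by rewrite -hG; exact/h/nv_ge0.
  by move=> _ hi; rewrite hG; exact: h.
(* The optimality of [F m] costs [E m / 4] and the approximations [20 * ep j <= 20/32 * E m]. Enough
   is left to save the [2 * ep j] that starting the induction costs. *)
have step D1 m s : nv m <= nv b ->
    (forall x, emem x D1 -> emem x (B @@ m @@ (F @@ m)) -> emem x (Dm m)) ->
    prob C n <= prob (ecap C D1) n + s -> prob C n <= prob (ecap C (Dm m)) n + s + E m - 2 * ep j.
  move=> hm hD1 hs.
  (* Since [m <= b], the bound [c + F m] makes one event of row [m] contain both; the optimality of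
     [F m] is used against this event. *)
  have hU x : emem x C \/ emem x (B @@ m @@ (F @@ m)) -> emem x (B @@ m @@ (c +' (F @@ m))).
    move=> [/hC|]; apply: B_mono => //; rewrite nvD.
    + by have := nv_ge0 (F @@ m); lra.
    + by have := nv_ge0 c; lra.
  have hn : nv k + nv m + 8 <= nv n.
    by rewrite /n nvD !nvS nvD; have := nv_ge0 n0; lra.
  have := prob_split hjn (fun x _ => hD1 x) hU hs (hF m _ n hn).
  have := hE m hm; have := epS (suc (suc (suc (k +' m)))).
  have := epS (suc (suc (suc (suc (k +' m))))); rewrite hEb -/(E m).
  by have := ep_gt0 (suc (suc (suc (k +' b)))); rewrite -/(E b) => ? ? ? ? ?; lra.
have claim m : nv m <= nv b -> prob C n <= prob (ecap C (Dm m)) n + (ep (suc (suc k)) - E m).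
  (* At the fixed [n] the inequality is the vanishing of a representable function, so that induction
     in the model is available. *)
  pose f m := cl qle @@ (cl hat @@ (cint M cProb @@ C) @@ n)
    @@ (cl qadd @@ (cl hat @@ (cint M cProb @@ (cl cap @@ C @@ (cl bigcap @@ G @@ z0 @@ m))) @@ n)
    @@ (cl qsub @@ (cl qhalfpow @@ suc (suc k)) @@ (cl qhalfpow @@ suc (suc (suc (k +' m)))))).
  have hf i : f i = z0 <-> prob C n <= prob (ecap C (Dm i)) n + (ep (suc (suc k)) - E i).
    by rewrite /f qleP val_qadd val_qsub !val_qhalfpow.
  move=> /minus_eq0 hm; apply/hf; move: m hm.
  apply: (@nat_ind_imp (fun m => m -' b) f); [by representable|by rewrite /f; representable| |].
  - move=> /minus_eq0 hm; apply/hf.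
    (* The induction starts from the sure event; comparing [C] with its intersection with that event
       costs the [2 * ep j]. *)
    have := step (ecompl (cint M cEmpty)) z0 (2 * ep j) hm; rewrite hE0 => h.
    have : prob C n <= prob (ecap C (Dm z0)) n + 2 * ep j + E z0 - 2 * ep j; last by lra.
    apply: h.
    + move=> x _ hx; apply/hDm => i; rewrite nv0 => hi.
      have -> // : i = z0 by apply: nv_inj; apply: le_anti; rewrite nv0 hi nv_ge0.
    + apply: prob_mono hjn => x hx; apply/emem_cap; split=> //.
      by apply/emem_compl; exact: emem_empty.
  - move=> m IH /minus_eq0 hm; apply/hf.
    have hm' : nv m <= nv b by move: hm; rewrite nvS; lra.
    have /minus_eq0/IH/hf h := hm'.
    have := step (Dm m) (suc m) _ hm _ h; rewrite hES => h'.
    have : prob C n <= prob (ecap C (Dm (suc m))) n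
        + (ep (suc (suc k)) - 2 * E (suc m)) + E (suc m) - 2 * ep j.
      apply: h' => x /hDm hx hx'; apply/hDm => i; rewrite nvS => hi.
      have [/hx //|hi'] := nv_leP i m.
      have -> // : i = suc m.
      by apply: nv_inj; apply: le_anti; rewrite nvS; apply/andP; split; lra.
    by have := ep_gt0 j; lra.
have := claim b (lexx _).
have h1 : prob (ecap C (Dm b)) n <= prob D n + 2 * ep j.
  by apply: prob_mono hjn => x /emem_cap [_ /hDm hx]; exact/hD.
have hC' : ep k <= prob C n by apply: hn0; rewrite nvD; have := nv_ge0 (suc j); lra.
have := hDk j n hjn; have := epS k; have := epS (suc k); rewrite hEb in h1 *.
have := ep_gt0 (suc (suc (suc (k +' b)))); have := ep_gt0 (suc (suc k)).
by rewrite -/(E b) => ? ? ? ? ? ?; lra.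
Qed.
End Core.

(** The inner family is a term evaluated in an environment that contains [i], so [A2] is a function
    of the metatheory. *)
Lemma emem_bigcup2 (A : M (tN ⇒ tS)) (A2 : M tN -> M (tN ⇒ tS)) (Q : M tN -> M tN -> M tS) n m x :
  (forall i, A @@ i = cl bigcup @@ A2 i @@ n @@ m) ->
  (forall i j, A2 i @@ j = ecompl (Q i j)) ->
  emem x (cl bigcup @@ A @@ n @@ m) <-> exists i j,
    [/\ nv n <= nv i <= nv m, nv n <= nv j <= nv m & ~ emem x (Q i j)].
Proof.
move=> hA hA2; rewrite emem_bigcup; split.
- move=> [i [hi1 hi2]]; rewrite hA emem_bigcup => -[j [hj1 hj2]]; rewrite hA2 emem_compl => hQ.
  by exists i, j; split=> //; apply/andP; split.
- move=> [i [j [/andP [hi1 hi2] /andP [hj1 hj2] hQ]]]; exists i; split=> //.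
  by rewrite hA emem_bigcup; exists j; split=> //; rewrite hA2 emem_compl.
Qed.

Lemma metastable_finite_unions :
  sat (au_metastable_pointwise ⊃ au_finite_unions)%fm nil.
Proof.
move=> hMS k a; apply: contrapT => hFU.
pose Q i j : M tS := cint M cP @@ a @@ i @@ j.
pose B : M (tN ⇒ tN ⇒ tS) := ev (ec a nil) (lam (lam
  (bigcup · (lam (bigcup · (lam (compl · (Pset · v4 · v1 · v0))) · v2 · v1)) · v1 · v0))).
have hBB x b c : emem x (B @@ b @@ c) <-> exists i j,
    [/\ nv b <= nv i <= nv c, nv b <= nv j <= nv c & ~ emem x (Q i j)].
  rewrite /B; evs; apply: (emem_bigcup2 (A2 := fun i =>
    ev (ec i (ec c (ec b (ec a nil)))) (lam (compl · (Pset · v4 · v1 · v0))))) =>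
    [i|i j]; evs => //.
  by unfold compl, Pset; evs.
apply: (@core_false k B) => [x m c m' c' hm hc|b|F].
- move=> /hBB [i [j [/andP [? ?] /andP [? ?] ?]]]; apply/hBB; exists i, j.
  by split=> //; apply/andP; split; lra.
- have [c hc] : exists c, ~ sat (rle (Pr · (bigcup · (lam (bigcup
      · (lam (compl · (Pset · v4 · v1 · v0))) · v2 · v1)) · v1 · v0)) (rhalfpow · v3))%fm
      (ec c (ec b (ec a (ec k nil)))).
    by apply: contrapT => h; apply: hFU; exists b => c; apply: contrapT => h'; apply: h; exists c.
  (* [rle] is a negated [rlt], so its failure is a doubly negated strict inequality. *)
  have {hc} /contrapT hc := hc.
  exists c, (ev (ec c (ec b (ec a (ec k nil)))) (bigcup · (lam (bigcup
      · (lam (compl · (Pset · v4 · v1 · v0))) · v2 · v1)) · v1 · v0)); split.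
    move=> x; rewrite hBB; evs; apply: (emem_bigcup2 (A2 := fun i =>
      ev (ec i (ec c (ec b (ec a (ec k nil))))) (lam (compl · (Pset · v4 · v1 · v0))))) =>
      [i|i j]; evs => //.
    by unfold compl, Pset; evs.
  have [n0 hn0] := sat_rlt_ge hc; exists n0 => n /hn0.
  by unfold Pr; evs; rewrite hv_rhalfpow.
- have [b hb] := hMS (suc k) a F.
  exists b, (ev (ec b (ec F (ec a (ec (suc k) nil)))) (bigcap · (lam (bigcup · (lam (bigcup
      · (lam (compl · (Pset · v5 · v1 · v0))) · v1 · (v3 · v1))) · v0 · (v2 · v0))) · zero · v0)).
  split=> [x|j n hn].
    evs; rewrite emem_bigcap nv0.
    have h m : emem x (ev (ec b (ec F (ec a (ec (suc k) nil)))) (lam (bigcup · (lam (bigcup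
      · (lam (compl · (Pset · v5 · v1 · v0))) · v1 · (v3 · v1))) · v0 · (v2 · v0))) @@ m) <->
      emem x (B @@ m @@ (F @@ m)).
      rewrite hBB; evs; apply: (emem_bigcup2 (A2 := fun i =>
        ev (ec i (ec m (ec b (ec F (ec a (ec (suc k) nil))))))
          (lam (compl · (Pset · v5 · v1 · v0))))) => [i|i j]; evs => //.
      by unfold compl, Pset; evs.
    split=> hx m; first by move=> hm; apply/h; exact: hx (nv_ge0 m) hm.
    by move=> _ hm; apply/h; exact: hx.
  by have := sat_rle hb hn; unfold Pr; evs; rewrite hv_rhalfpow.
Qed.

End Convergence.

Theorem theorem9p9 (e : endpoints) :
  provable e (Imp au_metastable_pointwise au_finite_unions).
Proof.
apply: completeness => M hM; exact (@metastable_finite_unions e (FModel hM)).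
Qed.
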